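(* There is a $C^\infty$ area-preserving irrotational diffeomorphism $f\colon \mathbb{T}^2\to \mathbb{T}^2$ homotopic to the identity, with a lift $\hat{f}\colon \mathbb{R}^2\to \mathbb{R}^2$ such that: \begin{enumerate} \item[(1)] every orbit of $\hat{f}$ is bounded, but \item[(2)] for every finite set $\{v_1,\dots, v_n\}\subset \mathbb{Z}^2$, there is $z\in [0,1]^2$ such that the orbit of $z$ under $\hat f$ intersects $[0,1]^2+v_i$ for all $i\in\{1,\dots, n\}$. \end{enumerate}
   Context: $\mathbb{T}^2=\mathbb{R}^2/\mathbb{Z}^2$ with covering projection $\pi\colon\mathbb{R}^2\to\mathbb{T}^2$. A lift of $f\colon \mathbb{T}^2\to\mathbb{T}^2$ is a continuous map $\hat f\colon\mathbb{R}^2\to\mathbb{R}^2$ with $\pi\hat f=f\pi$. ''Area-preserving'' means preserving the Lebesgue probability measure $\mathrm{Leb}_{\mathbb{T}^2}$ on $\mathbb{T}^2$ induced by Lebesgue measure on $\mathbb{R}^2$, i.e. $f_*(\mathrm{Leb}_{\mathbb{T}^2})=\mathrm{Leb}_{\mathbb{T}^2}$. The orbit of $z\in\mathbb{R}^2$ under $\hat f$ is $\{\hat f^n(z):n\in\mathbb{Z}\}$. For a homeomorphism $f$ of $\mathbb{T}^2$ homotopic to the identity with lift $\hat f$, the rotation set $\rho(\hat{f})\subset\mathbb{R}^2$ is the set of all limits $v = \lim_{k\to \infty} (\hat{f}^{n_k}(z_k)-z_k)/n_k$, where $(n_k)_{k\in\mathbb{N}}$ is a sequence of positive integers with $n_k\to\infty$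 and $z_k\in\mathbb{R}^2$. If $\rho(\hat{f}) = \{(0,0)\}$ for a lift $\hat f$ of $f$, one says $f$ is irrotational and $\hat{f}$ is its irrotational lift. *)

(* Defs.v *)
From HB Require Import structures.
From mathcomp Require Import all_boot all_order all_algebra.
From mathcomp Require Import all_classical all_reals all_analysis.

Set Implicit Arguments.
Unset Strict Implicit.
Unset Printing Implicit Defensive.

Import Order.TTheory GRing.Theory Num.Theory.
Import numFieldNormedType.Exports.

Local Open Scope classical_set_scope.
Local Open Scope ring_scope.
Local Open Scope quotient_scope.

Notation plane R := (R * R)%type.

Section Torus.
Context {R : realType}.

Definition Z2_eq (x y : plane R) : bool :=
  ((x.1 - y.1) \is a Num.int) && ((x.2 - y.2) \is a Num.int).

Lemma Z2_eq_refl : reflexive Z2_eq.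
Proof. by move=> x; rewrite /Z2_eq !subrr rpred0. Qed.

Lemma Z2_eq_sym : symmetric Z2_eq.
Proof. by move=> x y; rewrite /Z2_eq -!(rpredBC _ y.1) -!(rpredBC _ y.2). Qed.

Lemma Z2_eq_trans : transitive Z2_eq.
Proof.
move=> y x z /andP[h1 h2] /andP[h3 h4]; apply/andP; split.
- by rewrite -(subrK y.1 x.1) -addrA rpredD.
- by rewrite -(subrK y.2 x.2) -addrA rpredD.
Qed.

Canonical Z2_equiv := EquivRel Z2_eq Z2_eq_refl Z2_eq_sym Z2_eq_trans.

End Torus.

Definition torus (R : realType) : Type :=
  quotient_topology {eq_quot (@Z2_equiv R)}.
HB.instance Definition _ (R : realType) := Topological.on (torus R).
HB.instance Definition _ (R : realType) := Quotient.on (torus R).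

Section TorusMaps.
Context {R : realType}.
Local Notation R2 := (plane R).
Local Notation T2 := (torus R).

Definition torus_proj : R2 -> T2 := \pi_T2.

Definition is_lift (F : R2 -> R2) (f : T2 -> T2) : Prop :=
  continuous F /\ (forall z, torus_proj (F z) = f (torus_proj z)).

(* g is C^k on the open set U: all iterated partial derivatives of g of order
   at most k exist and are continuous on U. *)
Fixpoint Ck_on (k : nat) (U : set R2) (g : R2 -> R2) : Prop :=
  {in U, continuous g} /\
  match k with
  | 0 => True
  | k'.+1 =>
      [/\ forall x, U x -> derivable g x (1, 0),
          forall x, U x -> derivable g x (0, 1),
          Ck_on k' U ('D_(1, 0) g)
        & Ck_on k' U ('D_(0, 1) g)]
  end.

Definition smooth_on (U : set R2) (g : R2 -> R2) : Prop :=
  forall k, Ck_on k U g.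

(* The smooth structure of the torus is the one for which torus_proj is a local
   diffeomorphism, i.e. the charts are the local inverses of torus_proj; g is the
   expression of f in such charts around torus_proj p and f (torus_proj p). *)
Definition smooth_map (f : T2 -> T2) : Prop :=
  forall p : R2, exists (U : set R2) (g : R2 -> R2),
    [/\ open U, U p, smooth_on U g
      & forall x, U x -> torus_proj (g x) = f (torus_proj x)].

Definition smooth_diffeo (f : T2 -> T2) : Prop :=
  smooth_map f /\
  exists g : T2 -> T2, [/\ cancel f g, cancel g f & smooth_map g].

Definition homotopic_to_id (f : T2 -> T2) : Prop :=
  exists H : R * T2 -> T2,
    [/\ {within `[0, 1]%classic `*` setT, continuous H},
        forall x, H (0, x) = f x & forall x, H (1, x) = x].

(* [0,1)^2 is a fundamental domain: torus_proj maps it bijectively onto T2. *)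
Definition leb_torus (A : set T2) : \bar R :=
  (lebesgue_measure \x lebesgue_measure)%E
    (torus_proj @^-1` A `&` (`[0, 1[%classic `*` `[0, 1[%classic)).

Definition area_preserving (f : T2 -> T2) : Prop :=
  forall A : set T2, <<s @open T2 >> A -> leb_torus (f @^-1` A) = leb_torus A.

Definition rotation_set (F : R2 -> R2) : set R2 :=
  [set v | exists (n : nat -> nat) (z : nat -> R2),
    [/\ forall k, (0 < n k)%N,
        n @ \oo --> \oo
      & (fun k => (n k)%:R^-1 *: (iter (n k) F (z k) - z k)) @ \oo --> v]].

Definition irrotational (f : T2 -> T2) : Prop :=
  exists F : R2 -> R2, is_lift F f /\ rotation_set F = [set (0, 0)].

(* Integer iterates of a bijection: pinv setT F is then its inverse. A lift of
   a homeomorphism homotopic to the identity is always bijective. *)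
Definition iterz (F : R2 -> R2) (n : int) : R2 -> R2 :=
  match n with
  | Posz m => iter m F
  | Negz m => iter m.+1 (pinv setT F)
  end.

Definition full_orbit (F : R2 -> R2) (z : R2) : set R2 := [set iterz F n z | n in setT].

Definition unit_square : set R2 := `[0, 1]%classic `*` `[0, 1]%classic.

Definition int_vec (v : int * int) : R2 := (v.1%:~R, v.2%:~R).

End TorusMaps.

(* Main.v *)
Require Import Defs.
From HB Require Import structures.
From mathcomp Require Import all_boot all_order all_algebra.
From mathcomp Require Import all_classical all_reals all_analysis.
From mathcomp Require Import ring lra zify measurable_realfun.
Import Order.TTheory GRing.Theory Num.Theory.
Import numFieldNormedType.Exports.

(** The map turns, slowly, infinitely many pairwise disjoint discs of the torus.
These discs, called tubes below, are very long: in the plane the n-th tube is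
bounded, but it comes close to (i, j) for all integers 0 <= i, j <= n.  Orbits
stay in one tube, hence are bounded, while an orbit that goes once around the
n-th tube visits (n + 1) ^ 2 translates of the unit square.

Tubes.  Take small round discs with centers (c_n, c_n), whose projections to
the axes are pairwise disjoint (slot_disj).  Let wind1 n be a horizontal shear
followed by a vertical shear, both by a periodic function of height n that
vanishes on the projections of the other discs; so wind1 n fixes the other
discs.  It stretches the n-th disc over a horizontal distance n, then raises to
the heights 0, ..., n the parts that lie near each column of integer points.
The n-th tube is the image of the n-th disc by
wind n.+1 = wind1 0 \o ... \o wind1 n.  Composing further with wind1 m on the
right, for m > n, does not change this image, so the tubes are images of disjoint
discs by one bijection, hence disjoint (tube_disj).  By the intermediate value
theorem applied twice, the circle of radius r_n in the n-th disc contains for all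
0 <= i, j <= n a point that wind n.+1 sends into the square of side r_n at
(c_n, c_n), translated by (i, j) (wind_circle).

Twists.  In the n-th disc, rotate each circle by e times a flat bump function of
its squared radius, and conjugate by wind n.+1: this is tube_twist n e, whose
inverse is tube_twist n (- e).  When e tends to 0 its displacement tends to 0
in C^k for every k (tube_twist_tame), because this property is kept by the
conjugation by a shear.  So the amplitudes e_n can be chosen with displacement
at most 2^-n in C^n, and the map Phi 1 obtained by performing all these twists,
with inverse Phi (- 1), is smooth (Phi_smooth): the derivatives of the series of
displacements converge normally.

Area.  A map is called subpreserving when taking preimages does not increase the
area of open sets of the torus.  This is stable by composition and by pointwise limits,
and for a homeomorphism and its inverse it amounts to preservation of area
(descend_area).  Shears have it by Fubini's theorem.  A rotation is a product of
three linear shears, and a twist is a limit of maps that rotate each of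
countably many pieces rigidly (subpreserving_twist).

Rotation set.  All iterates move the points of a given tube by a bounded amount,
and one step moves the points of the tubes of index at least N by at most 2^-N.
Hence n iterates move all points by at most D_N + n 2^-N, and every rotation
vector vanishes (Phi_rotation_set).

Visits.  On the circle of radius r_n the twist is a rotation whose angle is as
small as desired, so its orbits come close enough to all the points found in
wind_circle (visit). *)

Set Implicit Arguments.
Unset Strict Implicit.
Unset Printing Implicit Defensive.
Local Open Scope classical_set_scope.
Local Open Scope ring_scope.

(** * Directional derivatives along lines *)

Section DirDer.
Context {R : realType} {V : normedModType R}.
Implicit Types (u w : V -> R) (z v : V).

(** Reduces directional derivatives to derivatives of functions of one variable,
to which the chain rule and the mean value theorem apply. *)
Lemma is_derive_line u z v d :
  is_derive z v u d <-> is_derive (0 : R) 1 (fun t => u (z + t *: v)) d.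
Proof.
have E : (fun h : R => h^-1 *: ((u \o shift z) (h *: v) - u z)) =
  (fun h : R => h^-1 *: (((fun t => u (z + t *: v)) \o shift 0) (h *: 1) -
     (fun t => u (z + t *: v)) 0)).
  by apply/funext => h /=; rewrite addr0 scale0r addr0 [h *: 1]mulr1 (addrC z).
by split=> -[du eu]; split; move: du eu; rewrite /derivable /derive E.
Qed.

Lemma is_derive_line_at u z v t d :
  is_derive (z + t *: v) v u d -> is_derive t 1 (fun t => u (z + t *: v)) d.
Proof.
move/is_derive_line => -[H1 H2].
have E : (fun h : R => h^-1 *: (((fun s => u (z + t *: v + s *: v)) \o shift 0)
   (h *: 1) - (fun s => u (z + t *: v + s *: v)) 0)) =
  (fun h : R => h^-1 *: (((fun s => u (z + s *: v)) \o shift t) (h *: 1) -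
     (fun s => u (z + s *: v)) t)).
  apply/funext => h /=; rewrite addr0 scale0r addr0.
  by rewrite [in RHS]scalerDl addrA addrAC.
by split; move: H1 H2; rewrite /derivable /derive -E.
Qed.

Lemma is_derive_comp1 (a : R -> R) u z v da d :
  is_derive (u z) 1 a da -> is_derive z v u d ->
  is_derive z v (a \o u) (da * d).
Proof.
move=> ha /is_derive_line hu; apply/is_derive_line.
pose g (t : R) := u (z + t *: v).
have g0 : g 0 = u z by rewrite /g scale0r addr0.
rewrite -g0 in ha; exact: (@is_derive1_comp _ a g).
Qed.

Lemma mvt_line u z v t (M : R) :
  (forall s, derivable u (z + s *: v) v) ->
  (forall s, `|s| <= `|t| -> `|'D_v u (z + s *: v)| <= M) ->
  `|u (z + t *: v) - u z| <= M * `|t|.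
Proof.
move=> du bu; pose g (t : R) := u (z + t *: v).
have dg (s : R) : is_derive s (1 : R) g ('D_v u (z + s *: v)).
  by apply: is_derive_line_at; exact: derivableP.
have cg : continuous g.
  move=> s; apply/differentiable_continuous/derivable1_diffP.
  by have [] := dg s.
have -> : u z = g 0 by rewrite /g scale0r addr0.
case: (leP 0 t) => t0.
  have [c ci ->] := @MVT_segment R g (fun s => 'D_v u (z + s *: v)) 0 t t0
    (fun x _ => dg x) (continuous_subspaceT cg).
  rewrite subr0 normrM ler_wpM2r// bu// !ger0_norm// ?(itvP ci)//.
have [c ci E] := @MVT_segment R g (fun s => 'D_v u (z + s *: v)) t 0 (ltW t0)
  (fun x _ => dg x) (continuous_subspaceT cg).
rewrite distrC E sub0r normrM normrN ler_wpM2r// bu//.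
by rewrite (ltr0_norm t0) ler0_norm ?lerN2 (itvP ci).
Qed.

End DirDer.

Lemma lip_of_derive {R : realType} (a : R -> R) (M : R) :
  (forall t, derivable a t 1) -> (forall t, `|'D_1 a t| <= M) ->
  forall s t, `|a s - a t| <= M * `|s - t|.
Proof.
move=> da ba s t; have := @mvt_line _ _ a t 1 (s - t) M.
have -> : t + (s - t) *: (1 : R) = s by rewrite [_ *: 1]mulr1 addrC subrK.
by apply=> r; [exact: da|move=> _; exact: ba].
Qed.

(** * Bounds in C^k *)

Section Ck_le.
Context {R : realType} {V : normedModType R}.
Implicit Types (u w : V -> R) (z v : V) (D U : set V).

(** One constant M bounds the values and the derivatives of all orders at most k,
so that a bound of order k.+1 on u contains a bound of order k on each
derivative with the same M; all inductions on k rest on this. *)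
Fixpoint Ck_le D U (k : nat) (M : R) u : Prop :=
  (forall z, U z -> {for z, continuous u} /\ `|u z| <= M) /\
  match k with
  | 0 => True
  | k'.+1 => forall v, D v ->
      (forall z, U z -> derivable u z v) /\ Ck_le D U k' M ('D_v u)
  end.

Lemma Ck_le_C0 D U k M u : Ck_le D U k M u ->
  forall z, U z -> {for z, continuous u} /\ `|u z| <= M.
Proof. by case: k => [[]|k []]. Qed.

Lemma Ck_le_cont D U k M u z : Ck_le D U k M u -> U z -> {for z, continuous u}.
Proof. by move=> /Ck_le_C0 h /h[]. Qed.

Lemma Ck_le_bnd D U k M u z : Ck_le D U k M u -> U z -> `|u z| <= M.
Proof. by move=> /Ck_le_C0 h /h[]. Qed.

Lemma Ck_le_derive D U k M u v : Ck_le D U k.+1 M u -> D v -> Ck_le D U k M ('D_v u).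
Proof. by move=> [_ h] /h[]. Qed.

Lemma Ck_le_derivable D U k M u v z : Ck_le D U k.+1 M u -> D v -> U z -> derivable u z v.
Proof. by move=> [_ h] /h[h1 _] /h1. Qed.

Lemma Ck_le_mono D U k M M' u : M <= M' -> Ck_le D U k M u -> Ck_le D U k M' u.
Proof.
move=> MM; elim: k u => [|k IH] u /= [h1 h2]; split=> //.
- by move=> z /h1[? h]; split=> //; exact: le_trans MM.
- by move=> z /h1[? h]; split=> //; exact: le_trans MM.
- by move=> v /h2[? h]; split=> //; exact: IH.
Qed.

Lemma Ck_leS D U k M u : Ck_le D U k.+1 M u -> Ck_le D U k M u.
Proof.
elim: k u => [|k IH] u.
  by case.
by move=> [h1 h2]; split=> // v /h2[? h]; split=> //; exact: IH.
Qed.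

Lemma Ck_le_leq D U k k' M u : (k <= k')%N -> Ck_le D U k' M u -> Ck_le D U k M u.
Proof.
move=> /subnK <-; elim: (k' - k)%N => // m IH; rewrite addSn => /Ck_leS; exact: IH.
Qed.

Lemma Ck_le_subset D U U' k M u : U `<=` U' -> Ck_le D U' k M u -> Ck_le D U k M u.
Proof.
move=> UU; elim: k u => [|k IH] u /= [h1 h2]; split=> //.
- by move=> z /UU /h1.
- by move=> z /UU /h1.
- by move=> v /h2[h3 h4]; split; [move=> z /UU/h3|exact: IH].
Qed.

(** The predicate is pointwise, so no uniformity in the members of the cover is
needed: this is how a bound is glued from a disc and its exterior. *)
Lemma Ck_le_cover D U k M u :
  (forall z, U z -> exists2 W : set V, W z & Ck_le D W k M u) -> Ck_le D U k M u.
Proof.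
elim: k u => [|k IH] u H /=; split=> //.
- by move=> z /H[W Wz /Ck_le_C0]; exact.
- by move=> z /H[W Wz /Ck_le_C0]; exact.
- move=> v Dv; split; first by move=> z /H[W Wz h]; exact: Ck_le_derivable h Dv Wz.
  by apply: IH => z /H[W Wz h]; exists W => //; exact: Ck_le_derive h Dv.
Qed.

Lemma Ck_le_eq D U k M u w : open U -> (forall z, U z -> u z = w z) ->
  Ck_le D U k M u -> Ck_le D U k M w.
Proof.
move=> oU.
have near_ext (f g : V -> R) z : (forall z, U z -> f z = g z) -> U z ->
    {near z, f =1 g}.
  by move=> fg Uz; near=> y; apply: fg; near: y; exact: open_nbhs_nbhs.
elim: k u w => [|k IH] u w uw [h1 h2].
all: have nuw z := @near_ext _ _ z uw.
all: split=> //.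
- move=> z Uz; have [h3 h4] := h1 _ Uz; split; last by rewrite -uw.
  rewrite /prop_for /continuous_at -uw //; apply: cvg_trans h3.
  exact/near_eq_cvg/nuw.
- move=> z Uz; have [h3 h4] := h1 _ Uz; split; last by rewrite -uw.
  rewrite /prop_for /continuous_at -uw //; apply: cvg_trans h3.
  exact/near_eq_cvg/nuw.
- move=> v Dv; have [h3 h4] := h2 _ Dv; split.
    by move=> z Uz; apply: near_eq_derivable (h3 _ Uz); exact: nuw.
  apply: IH h4 => z Uz; apply: near_eq_derive; exact: nuw.
Unshelve. all: by end_near. Qed.

Lemma Ck_le_is_derive D U k M u v z : Ck_le D U k.+1 M u -> D v -> U z ->
  is_derive z v u ('D_v u z).
Proof. by move=> h Dv Uz; apply: derivableP; exact: Ck_le_derivable h Dv Uz. Qed.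

(** On the open set U the iterated derivatives only depend on the values on U, so
a formula for the derivative that is valid on U is enough. *)
Lemma Ck_le_intro D U k M u (du : V -> V -> R) : open U ->
  (forall z, U z -> {for z, continuous u}) ->
  (forall z, U z -> `|u z| <= M) ->
  (forall z v, U z -> D v -> is_derive z v u (du v z)) ->
  (forall v, D v -> Ck_le D U k M (du v)) -> Ck_le D U k.+1 M u.
Proof.
move=> oU h1 h2 h3 h4; split; first by move=> z Uz; split; [exact: h1|exact: h2].
move=> v Dv; split; first by move=> z Uz; have [] := h3 _ _ Uz Dv.
apply: Ck_le_eq (h4 _ Dv) => // z Uz; by have [_ ->] := h3 _ _ Uz Dv.
Qed.

Lemma Ck_le_cst D U k M c : open U -> `|c| <= M -> Ck_le D U k M (fun=> c).
Proof.
move=> oU; elim: k c => [|k IH] c cM.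
  by split=> // z _; split=> //; exact: cst_continuous.
apply: (@Ck_le_intro _ _ _ _ _ (fun _ _ => 0)) => //.
- by move=> z _; exact: cst_continuous.
- by move=> v _; apply: IH; rewrite normr0; exact: le_trans cM.
Qed.

Lemma Ck_le_add D U k M1 M2 u w : open U -> Ck_le D U k M1 u -> Ck_le D U k M2 w ->
  Ck_le D U k (M1 + M2) (fun z => u z + w z).
Proof.
move=> oU; elim: k u w => [|k IH] u w hu hw.
all: have h1 : forall z, U z -> {for z, continuous (fun z => u z + w z)} by
  move=> z Uz; apply: cvgD; [exact: Ck_le_cont hu Uz|exact: Ck_le_cont hw Uz].
all: have h2 : forall z, U z -> `|u z + w z| <= M1 + M2 by
  move=> z Uz; apply: (le_trans (ler_normD _ _)); apply: lerD;
  [exact: Ck_le_bnd hu Uz|exact: Ck_le_bnd hw Uz].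
  by split=> // z Uz; split; [exact: h1|exact: h2].
apply: (@Ck_le_intro _ _ _ _ _ (fun v z => 'D_v u z + 'D_v w z)) => //.
- move=> z v Uz Dv; apply: is_deriveD.
    exact: Ck_le_is_derive hu Dv Uz.
  exact: Ck_le_is_derive hw Dv Uz.
- by move=> v Dv; apply: IH; apply: Ck_le_derive.
Qed.

Lemma Ck_le_opp D U k M u : open U -> Ck_le D U k M u -> Ck_le D U k M (fun z => - u z).
Proof.
move=> oU; elim: k u => [|k IH] u hu.
all: have h1 : forall z, U z -> {for z, continuous (fun z => - u z)} by
  move=> z Uz; apply: cvgN; exact: Ck_le_cont hu Uz.
all: have h2 : forall z, U z -> `|- u z| <= M by
  move=> z Uz; rewrite normrN; exact: Ck_le_bnd hu Uz.
  by split=> // z Uz; split; [exact: h1|exact: h2].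
apply: (@Ck_le_intro _ _ _ _ _ (fun v z => - 'D_v u z)) => //.
- move=> z v Uz Dv; apply: is_deriveN; exact: Ck_le_is_derive hu Dv Uz.
- by move=> v Dv; apply: IH; apply: Ck_le_derive.
Qed.

Lemma Ck_le_ge0 D U k M u z : U z -> Ck_le D U k M u -> 0 <= M.
Proof. by move=> Uz /Ck_le_bnd-/(_ _ Uz); apply: le_trans. Qed.

(** The factor 2 ^+ k comes from Leibniz's rule, each derivation replacing a product
by a sum of two products. *)
Lemma Ck_le_mul D U k M1 M2 u w : open U -> 0 <= M1 -> 0 <= M2 ->
  Ck_le D U k M1 u -> Ck_le D U k M2 w ->
  Ck_le D U k (2 ^+ k * (M1 * M2)) (fun z => u z * w z).
Proof.
move=> oU M10 M20; have M0 : 0 <= M1 * M2 by apply: mulr_ge0.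
elim: k u w => [|k IH] u w hu hw.
all: have h1 : forall z, U z -> {for z, continuous (fun z => u z * w z)} by
  move=> z Uz; apply: cvgM; [exact: Ck_le_cont hu Uz|exact: Ck_le_cont hw Uz].
all: have h2 : forall z, U z -> `|u z * w z| <= M1 * M2 by
  move=> z Uz; rewrite normrM; apply: ler_pM => //;
  [exact: Ck_le_bnd hu Uz|exact: Ck_le_bnd hw Uz].
  by rewrite expr0 mul1r; split=> // z Uz; split; [exact: h1|exact: h2].
apply: (@Ck_le_intro _ _ _ _ _ (fun v z => u z * 'D_v w z + w z * 'D_v u z)) => //.
- move=> z Uz; apply: (le_trans (h2 _ Uz)); rewrite ler_peMl //.
  by rewrite exprn_ege1 // ler1n.
- move=> z v Uz Dv; apply: is_deriveM.
    exact: Ck_le_is_derive hu Dv Uz.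
  exact: Ck_le_is_derive hw Dv Uz.
- move=> v Dv.
  have -> : 2 ^+ k.+1 * (M1 * M2) = 2 ^+ k * (M1 * M2) + 2 ^+ k * (M1 * M2).
    by rewrite exprS; ring.
  apply: Ck_le_add => //; first by apply: IH; [exact: Ck_leS|exact: Ck_le_derive].
  have := IH ('D_v u) w (Ck_le_derive hu Dv) (Ck_leS hw).
  by under eq_fun do rewrite mulrC.
Qed.

End Ck_le.

(** * Composition with smooth functions of one variable *)

Section Comp.
Context {R : realType}.

(** The functions that can be composed freely: a bound on all of R for each
derivative makes the bounds on compositions independent of the inner function. *)
Definition smooth_bounded (a : R -> R) :=
  forall k, exists2 M : R, 0 <= M & Ck_le [set (1 : R)] setT k M a.

Lemma smooth_bounded_der a : smooth_bounded a -> smooth_bounded ('D_1 a).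
Proof.
by move=> Sa k; have [M M0 h] := Sa k.+1; exists M => //; exact: (Ck_le_derive h).
Qed.

Lemma smooth_bounded_is_der a (t : R) : smooth_bounded a -> is_derive t (1 : R) a ('D_1 a t).
Proof. by move=> Sa; have [M _ h] := Sa 1%N; exact: (Ck_le_is_derive h). Qed.

Lemma smooth_bounded_cont a : smooth_bounded a -> continuous a.
Proof. by move=> Sa t; have [M _ h] := Sa 0%N; exact: (Ck_le_cont h). Qed.

Lemma smooth_bounded_bnd a : smooth_bounded a -> exists2 M, 0 <= M & forall t, `|a t| <= M.
Proof.
by move=> Sa; have [M M0 h] := Sa 0%N; exists M => // t; exact: (Ck_le_bnd h).
Qed.

Lemma smooth_bounded_lip a : smooth_bounded a ->
  exists2 M, 0 <= M & forall s t, `|a s - a t| <= M * `|s - t|.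
Proof.
move=> Sa; have [M M0 h] := Sa 1%N; exists M => //; apply: lip_of_derive => t.
  exact: (Ck_le_derivable h).
exact: (Ck_le_bnd (Ck_le_derive h _)).
Qed.

Context {V : normedModType R}.
Implicit Types (D U : set V) (u w : V -> R).

(** Unlike Ck_le this only bounds derivatives, so that coordinate functions, which
are unbounded, satisfy it. *)
Definition dCk_le D U k M w :=
  (forall z, U z -> {for z, continuous w}) /\
  forall v, D v -> (forall z, U z -> derivable w z v) /\ Ck_le D U k M ('D_v w).

Lemma Ck_le_dCk_le D U k M w : Ck_le D U k.+1 M w -> dCk_le D U k M w.
Proof. by move=> [h1 h2]; split=> [z /h1[]|]. Qed.

Lemma dCk_leS D U k M w : dCk_le D U k.+1 M w -> dCk_le D U k M w.
Proof. by move=> [h1 h2]; split=> // v /h2[? ?]; split=> //; exact: Ck_leS. Qed.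

Lemma Ck_le_comp D U k Mw w a : open U -> 0 <= Mw -> smooth_bounded a -> dCk_le D U k Mw w ->
  exists2 M, 0 <= M & Ck_le D U k M (a \o w).
Proof.
move=> oU Mw0; elim: k a => [|k IH] a Sa hw.
all: have h1 z : U z -> {for z, continuous (a \o w)} by
  move=> Uz; apply: continuous_comp; [exact: hw.1|exact: smooth_bounded_cont].
all: have [M M0 h2] := smooth_bounded_bnd Sa.
  by exists M => //; split=> // z Uz; split; [exact: h1|exact: h2].
have [M1 M10 h3] := IH _ (smooth_bounded_der Sa) (dCk_leS hw).
have M20 : 0 <= 2 ^+ k * (M1 * Mw) by rewrite !mulr_ge0.
exists (M + 2 ^+ k * (M1 * Mw)); first exact: addr_ge0.
apply: (@Ck_le_intro _ _ _ _ _ _ _ (fun v z => 'D_1 a (w z) * 'D_v w z)) => //.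
- by move=> z Uz; rewrite (le_trans (h2 _))// lerDl.
- move=> z v Uz Dv; apply: is_derive_comp1; first exact: smooth_bounded_is_der.
  by apply: derivableP; exact: (hw.2 _ Dv).1.
- move=> v Dv; apply: Ck_le_mono (Ck_le_mul oU M10 Mw0 h3 (Ck_leS (hw.2 _ Dv).2)).
  by rewrite lerDr.
Qed.

(** Differentiating a (w + u) - a w gives the same expression with the derivative of
a, times D_v w, plus a term that has the small factor D_v u; hence an induction
on k for all a at once. *)
Lemma Ck_le_comp_small D U k Mw w a : open U -> 0 <= Mw -> smooth_bounded a ->
  dCk_le D U k Mw w -> forall eta, 0 < eta -> exists2 e, 0 < e &
  forall u, Ck_le D U k e u -> Ck_le D U k eta (fun z => a (w z + u z) - a (w z)).
Proof.
move=> oU Mw0; elim: k a => [|k IH] a Sa hw eta eta0.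
all: have h1 u e k' z : Ck_le D U k' e u -> U z ->
  {for z, continuous (fun z => a (w z + u z) - a (w z))} by
  move=> hu Uz; apply: cvgB; (apply: continuous_comp; last exact: smooth_bounded_cont);
  [apply: cvgD; [exact: hw.1|exact: Ck_le_cont hu Uz]|exact: hw.1].
all: have [L L0 hL] := smooth_bounded_lip Sa.
all: have h2 u k' z : Ck_le D U k' (eta / (L + 1)) u -> U z ->
  `|a (w z + u z) - a (w z)| <= eta by
  move=> hu Uz; rewrite (le_trans (hL _ _))// addrAC subrr add0r;
  have := Ck_le_bnd hu Uz; rewrite ler_pdivlMr ?ltr_wpDl// => h;
  rewrite mulrC (le_trans _ h)// ler_wpM2l// lerDl.
  exists (eta / (L + 1)); first by rewrite divr_gt0// ltr_wpDl.
  by move=> u hu; split=> // z Uz; split; [exact: (h1 _ _ _ _ hu)|exact: (h2 _ _ _ hu)].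
pose P : R := 2 ^+ k.
have P0 : 0 < P by rewrite exprn_gt0.
have Sa' := smooth_bounded_der Sa.
pose eta' := Num.min 1 (eta / (2 * P * (Mw + 1))).
have eta'0 : 0 < eta' by rewrite lt_min ltr01 divr_gt0// !mulr_gt0// ltr_wpDl.
have [e1 e10 he1] := IH _ Sa' (dCk_leS hw) _ eta'0.
have [M1 M10 hM1] := Ck_le_comp oU Mw0 Sa' (dCk_leS hw).
pose e2 := eta / (2 * P * (M1 + 1)).
have e20 : 0 < e2 by rewrite divr_gt0// !mulr_gt0// ltr_wpDl.
exists (Num.min (eta / (L + 1)) (Num.min e1 e2)).
  by rewrite !lt_min e10 e20 divr_gt0// ltr_wpDl.
move=> u hu.
have hu1 : Ck_le D U k.+1 (eta / (L + 1)) u by apply: Ck_le_mono hu; rewrite ge_min lexx.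
have hu2 : Ck_le D U k.+1 e1 u by apply: Ck_le_mono hu; rewrite !ge_min lexx orbT.
have hu3 : Ck_le D U k.+1 e2 u by apply: Ck_le_mono hu; rewrite !ge_min lexx !orbT.
have hd := he1 _ (Ck_leS hu2).
apply: (@Ck_le_intro _ _ _ _ _ _ _ (fun v z =>
   ('D_1 a (w z + u z) - 'D_1 a (w z)) * 'D_v w z
   + ('D_1 a (w z + u z)) * 'D_v u z)) => //.
- by move=> z; exact: h1 hu.
- by move=> z; exact: h2 hu1.
- move=> z v Uz Dv.
  have dw : is_derive z v w ('D_v w z) by apply: derivableP; exact: (hw.2 _ Dv).1.
  have du := Ck_le_is_derive hu Dv Uz.
  have H1 := is_derive_comp1 (smooth_bounded_is_der (w z) Sa) dw.
  have H2 := is_derive_comp1 (smooth_bounded_is_der ((w + u) z) Sa) (is_deriveD dw du).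
  apply: is_derive_eq (is_deriveB H2 H1) _.
  rewrite [(w + u) z]/(w z + u z); ring.
- move=> v Dv.
  have -> : eta = eta / 2 + eta / 2 by field.
  apply: Ck_le_add => //.
    apply: Ck_le_mono (Ck_le_mul oU (ltW eta'0) Mw0 hd (Ck_leS (hw.2 _ Dv).2)).
    have : eta' <= eta / (2 * P * (Mw + 1)) by rewrite ge_min lexx orbT.
    rewrite ler_pdivlMr ?mulr_gt0 ?ltr_wpDl// => h.
    rewrite ler_pdivlMr// (le_trans _ h)//.
    have -> : eta' * (2 * P * (Mw + 1)) = 2 ^+ k * (eta' * Mw) * 2 + 2 * P * eta'.
      by rewrite /P; ring.
    by rewrite lerDl !mulr_ge0// ltW.
  have hs : Ck_le D U k (1 + M1) (fun z => 'D_1 a (w z + u z)).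
    have := Ck_le_add oU hd hM1; under eq_fun do rewrite subrK.
    by apply: Ck_le_mono; rewrite lerD2r ge_min lexx.
  apply: Ck_le_mono (Ck_le_mul oU (addr_ge0 ler01 M10) (ltW e20) hs (Ck_le_derive hu3 Dv)).
  rewrite /e2 /P le_eqVlt; apply/orP; left; apply/eqP; field.
  by rewrite gt_eqF ?ltr_wpDl// gt_eqF.
Qed.

End Comp.

Lemma is_derive0_small {R : realType} (r : R -> R) : r 0 = 0 ->
  (forall e : R, 0 < e -> \forall t \near (0 : R), `|r t| <= e * `|t|) ->
  is_derive (0 : R) (1 : R) r 0.
Proof.
move=> r0 H.
have C : (fun h : R => h^-1 *: ((r \o shift 0) (h *: (1 : R)) - r 0)) @ 0^' --> (0 : R).
  apply/cvgr0Pnorm_le => e e0.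
  suff : \forall t \near (0 : R), t != 0 ->
    `|t^-1 *: ((r \o shift 0) (t *: (1 : R)) - r 0)| <= e by [].
  apply: filterS (H e e0) => t ht t0 /=.
  rewrite r0 subr0 addr0 [t *: 1]mulr1 normrM normfV.
  by rewrite ler_pdivrMl ?normr_gt0// mulrC.
split; first by apply/cvg_ex; exists 0.
exact: cvg_lim C.
Qed.

Lemma derive0_lip {R : realType} (q : R -> R) d : q 0 = 0 ->
  is_derive (0 : R) (1 : R) q d ->
  \forall t \near (0 : R), `|q t| <= (`|d| + 1) * `|t|.
Proof.
move=> q0 [dq dl].
have hl : (fun h : R => h^-1 *: ((q \o shift 0) (h *: (1 : R)) - q 0)) @ 0^' --> d.
  by rewrite -dl; exact: dq.
have h : \forall t \near 0^',
    `|t^-1 *: ((q \o shift 0) (t *: (1 : R)) - q 0)| <= `|d| + 1.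
  by apply: (@cvgr_norm_le _ _ _ _ _ _ d hl); rewrite ltrDl.
have h' : \forall t \near (0 : R), t != 0 ->
    `|t^-1 *: ((q \o shift 0) (t *: (1 : R)) - q 0)| <= `|d| + 1 := h.
apply: filterS h' => t; have [-> _|t0 /(_ isT)] := eqVneq t 0.
  by rewrite q0 !normr0 mulr0.
rewrite /= q0 subr0 addr0 [t *: 1]mulr1 normrM normfV.
by rewrite ler_pdivrMl ?normr_gt0// mulrC.
Qed.

(** * Changes of variables in the plane *)

Section Precomp.
Context {R : realType} {V : normedModType R}.

Lemma is_derive_affine (A : V -> V) (Av : V) (u : V -> R) z v d :
  (forall t, A (z + t *: v) = A z + t *: Av) ->
  is_derive (A z) Av u d -> is_derive z v (u \o A) d.
Proof.
move=> hA /is_derive_line h; apply/is_derive_line.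
by rewrite (_ : (fun t => _) = (fun t => u (A z + t *: Av)))//;
  apply/funext => t /=; rewrite hA.
Qed.

Lemma Ck_le_shift D k M (u : V -> R) p : Ck_le D setT k M u ->
  Ck_le D setT k M (fun z => u (z + p)).
Proof.
elim: k u => [|k IH] u hu.
all: have h1 z : {for z, continuous (fun z => u (z + p))} by
  apply: (@continuous_comp _ _ _ (fun z => z + p) u);
  [apply: cvgD; [exact: cvg_id|exact: cvg_cst]|exact: Ck_le_cont hu _].
all: have h2 z : `|u (z + p)| <= M by exact: Ck_le_bnd hu _.
  by split=> // z _; split.
apply: (@Ck_le_intro _ _ _ _ _ _ _ (fun v z => 'D_v u (z + p))) => //.
  exact: openT.
  move=> z v _ Dv; apply: (@is_derive_affine (fun z => z + p) v).
    by move=> t; rewrite addrAC.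
  exact: Ck_le_is_derive hu Dv _.
by move=> v Dv; apply: (IH ('D_v u)); exact: Ck_le_derive.
Qed.

End Precomp.

Section Plane.
Context {R : realType}.
Local Notation R2 := (plane R).
Implicit Types (u : R2 -> R) (z : R2).

Definition dirs : set R2 := [set ((1 : R), (0 : R)); ((0 : R), (1 : R))].
Local Notation CkT_le := (Ck_le dirs setT).

Definition swap z : R2 := (z.2, z.1).

Lemma swapK : involutive swap. Proof. by case. Qed.

Lemma pair_cont (T : topologicalType) (f g : T -> R) (x : T) :
  {for x, continuous f} -> {for x, continuous g} ->
  {for x, continuous (fun y => (f y, g y) : R2)}.
Proof. move=> cf cg; rewrite /prop_for /continuous_at.
exact: (cvg_pair cf cg). Qed.

Lemma fst_cont : continuous (fun z : R2 => z.1).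
Proof. by move=> z; exact: cvg_fst. Qed.

Lemma snd_cont : continuous (fun z : R2 => z.2).
Proof. by move=> z; exact: cvg_snd. Qed.

Lemma swap_cont : continuous swap.
Proof. by move=> z; apply: (@pair_cont _ (fun z => z.2) (fun z => z.1));
  [exact: snd_cont|exact: fst_cont]. Qed.

Lemma Ck_le_swap k M u : CkT_le k M u -> CkT_le k M (u \o swap).
Proof.
elim: k u => [|k IH] u hu.
all: have h1 z : {for z, continuous (u \o swap)} by
  apply: continuous_comp; [exact: swap_cont|exact: Ck_le_cont hu _].
all: have h2 z : `|(u \o swap) z| <= M by exact: Ck_le_bnd hu _.
  by split=> // z _; split.
have sd v : dirs v -> dirs (swap v) by move=> [->|->]; [right|left].
apply: (@Ck_le_intro _ _ _ _ _ _ _ (fun v => 'D_(swap v) u \o swap)) => //.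
  exact: openT.
  move=> z v _ Dv; apply: (@is_derive_affine _ _ swap (swap v)).
    by move=> t; rewrite /swap/=.
  exact: Ck_le_is_derive hu (sd _ Dv) _.
by move=> v Dv; apply: (IH ('D_(swap v) u)); apply: Ck_le_derive => //; exact: sd.
Qed.

Definition shear (a : R -> R) z : R2 := (z.1 + a z.2, z.2).

Lemma shear_cont a : continuous a -> continuous (shear a).
Proof.
move=> ca z; apply: (@pair_cont _ (fun z => z.1 + a z.2) (fun z => z.2));
  last exact: snd_cont.
apply: cvgD; first exact: fst_cont.
by apply: continuous_comp; [exact: snd_cont|exact: ca].
Qed.

(** A chain rule that asks for the continuity of only one partial derivative: move
first vertically, where u is differentiable, then horizontally, where the mean
value theorem applies near p. *)
Lemma is_derive_curve u (p : R2) (q : R -> R) d d1 d2 :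
  (forall z, derivable u z ((1 : R), (0 : R))) ->
  {for p, continuous ('D_((1 : R), (0 : R)) u)} ->
  'D_((1 : R), (0 : R)) u p = d1 ->
  is_derive p ((0 : R), (1 : R)) u d2 ->
  q 0 = 0 -> is_derive (0 : R) (1 : R) q d ->
  is_derive (0 : R) (1 : R) (fun t => u (p + (q t, t))) (d1 * d + d2).
Proof.
move=> du cu d1E h2 q0 hq.
set e1 : R2 := ((1 : R), (0 : R)) in du cu d1E *.
set e2 : R2 := ((0 : R), (1 : R)) in h2 *.
have pE s t : p + (s, t) = p + t *: e2 + s *: e1.
  rewrite /e1 /e2 -addrA; congr (_ + _); congr pair => /=.
    by rewrite [t *: 0]mulr0 [s *: 1]mulr1 add0r.
  by rewrite [t *: 1]mulr1 [s *: 0]mulr0 addr0.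
pose r t := u (p + t *: e2 + q t *: e1) - u (p + t *: e2) - d1 * q t.
have r0 : r 0 = 0 by rewrite /r q0 !scale0r !addr0 subrr mulr0 subrr.
have hr : is_derive (0 : R) (1 : R) r 0.
  apply: is_derive0_small => // e e0.
  have C0 : 0 < `|d| + 1 by rewrite ltr_wpDl.
  have e'0 : 0 < e / (`|d| + 1) by rewrite divr_gt0.
  have [dl dl0 hdl] : exists2 dl : R, 0 < dl & forall s t : R, `|s| < dl -> `|t| < dl ->
      `|'D_e1 u (p + t *: e2 + s *: e1) - d1| <= e / (`|d| + 1).
    move: cu; rewrite /continuous_at => /cvgr_dist_le/(_ _ e'0).
    move=> /nbhs_ballP[dl /= dl0 hdl]; exists dl => // s t hs ht.
    have := hdl (p + t *: e2 + s *: e1); rewrite d1E distrC; apply.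
    rewrite -pE; split => /=; rewrite /ball /= opprD addrA subrr add0r normrN //.
  near=> t.
  have hqt : `|q t| <= (`|d| + 1) * `|t| by near: t; exact: derive0_lip.
  have tdl : (`|d| + 1) * `|t| < dl.
    rewrite mulrC -ltr_pdivlMr//; near: t; apply/nbhs_ballP.
    exists (dl / (`|d| + 1)); first exact: divr_gt0.
    by move=> s; rewrite /ball /= sub0r normrN.
  have tdl' : `|t| < dl.
    by apply: le_lt_trans tdl; rewrite ler_peMl// lerDr.
  have qdl : `|q t| < dl by exact: le_lt_trans tdl.
  (* Subtracting the linear part leaves a function with small partial derivative. *)
  pose w z := u z - d1 * (z.1 - p.1).
  have dw z : is_derive z e1 w ('D_e1 u z - d1).
    suff h3 : is_derive z e1 (fun z : R2 => d1 * (z.1 - p.1)) d1.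
      exact: is_deriveB (derivableP (du z)) h3.
    apply/is_derive_line.
    have -> : (fun t0 : R => d1 * ((z + t0 *: e1).1 - p.1)) =
              (fun t0 : R => d1 * (z.1 - p.1) + d1 * t0).
      by apply/funext => s /=; rewrite [s *: 1]mulr1; ring.
    apply: is_derive_eq.
    by rewrite add0r mul1r [_ *: 1]mulr1.
  have := @mvt_line _ _ w (p + t *: e2) e1 (q t) (e / (`|d| + 1)).
  have -> : w (p + t *: e2 + q t *: e1) - w (p + t *: e2) = r t.
    rewrite /w /r /= [t *: 0]mulr0 [q t *: 1]mulr1; ring.
  move=> H; apply: le_trans (H _ _) _.
  - by move=> s; have [] := dw (p + t *: e2 + s *: e1).
  - move=> s hs; have [_ ->] := dw (p + t *: e2 + s *: e1).
    by apply: hdl => //; exact: le_lt_trans qdl.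
  - rewrite -mulrA ler_pM2l// mulrC ler_pdivrMr// mulrC //.
have -> : (fun t => u (p + (q t, t))) =
  (fun t => r t + d1 * q t + u (p + t *: e2)).
  by apply/funext => t; rewrite pE /r; ring.
have h3 := (is_derive_line u p e2 d2).1 h2.
have h4 : is_derive (0 : R) (1 : R) (fun t => d1 * q t) (d1 * d) by exact: is_deriveZ.
apply: is_derive_eq (is_deriveD (is_deriveD hr h4) h3) _.
by rewrite add0r.
Unshelve. all: by end_near. Qed.

Lemma is_derive_shear2 u a z : smooth_bounded a ->
  (forall z, derivable u z ((1 : R), (0 : R))) ->
  (forall z, derivable u z ((0 : R), (1 : R))) ->
  continuous ('D_((1 : R), (0 : R)) u) ->
  is_derive z ((0 : R), (1 : R)) (u \o shear a)
    ('D_((1 : R), (0 : R)) u (shear a z) * 'D_1 a z.2 +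
     'D_((0 : R), (1 : R)) u (shear a z)).
Proof.
move=> Sa d1 d2 c1; apply/is_derive_line.
pose q (t : R) := a (z.2 + t) - a z.2.
have -> : (fun t => (u \o shear a) (z + t *: ((0 : R), (1 : R)))) =
   (fun t => u (shear a z + (q t, t))).
  apply/funext => t /=; rewrite /shear /q /=; congr u; congr pair => /=.
    by rewrite [t *: 0]mulr0 [t *: 1]mulr1; ring.
  by rewrite [t *: 1]mulr1.
apply: is_derive_curve => //.
- exact: c1.
- by rewrite /q addr0 subrr.
- rewrite /q -[X in is_derive _ _ _ X]subr0; apply: is_deriveB.
  have := smooth_bounded_is_der z.2 Sa => /is_derive_line.
  by under eq_fun do rewrite [_ *: 1]mulr1.
Qed.

Lemma is_derive_snd z v : is_derive z v (fun z : R2 => z.2) v.2.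
Proof.
apply/is_derive_line; rewrite /=.
have -> : (fun t : R => z.2 + t *: v.2) = (fun t : R => z.2 + v.2 * t).
  by apply/funext => t; rewrite [in RHS]mulrC.
apply: is_derive_eq.
by rewrite add0r mul1r [_ *: 1]mulr1.
Qed.

Lemma is_derive_fst z v : is_derive z v (fun z : R2 => z.1) v.1.
Proof.
apply: (@is_derive_affine _ _ swap (swap v) (fun z => z.2)); first by [].
exact: is_derive_snd.
Qed.

Lemma dCk_le_snd k : dCk_le dirs setT k 1 (fun z : R2 => z.2).
Proof.
split; first by move=> z _; exact: snd_cont.
move=> v hv; split=> [z _|]; first by have [] := is_derive_snd z v.
rewrite (_ : 'D_v _ = fun=> v.2); last first.
  by apply/funext => z; have [] := is_derive_snd z v.
apply: Ck_le_cst; first exact: openT.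
by case: hv => -> /=; rewrite ?normr0// normr1.
Qed.

(** The partial derivatives of the composition are polynomials in the composed
partial derivatives and in the derivative of a, which allows an induction on k. *)
Lemma Ck_le_shear a k : smooth_bounded a -> forall eta, 0 < eta -> exists2 e, 0 < e &
  forall u, CkT_le k e u -> CkT_le k eta (u \o shear a).
Proof.
move=> Sa; elim: k => [|k IH] eta eta0.
all: have h1 u k' e z : CkT_le k' e u -> {for z, continuous (u \o shear a)} by
  move=> hu; apply: continuous_comp;
  [exact/shear_cont/smooth_bounded_cont|exact: Ck_le_cont hu _].
  exists eta => // u hu; split=> // z _; split; first exact: h1 hu.
  exact: Ck_le_bnd hu _.
have [M M0 hM] := Ck_le_comp (@openT R2) ler01 (smooth_bounded_der Sa) (dCk_le_snd k).
pose e' := eta / (2 * (2 ^+ k * (M + 1))).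
have e'0 : 0 < e' by rewrite divr_gt0// !mulr_gt0// ?exprn_gt0// ltr_wpDl.
have [e e0 he] := IH _ e'0.
have eta20 : 0 < eta / 2 by rewrite divr_gt0.
have [f f0 hf] := IH _ eta20.
exists (Num.min eta (Num.min e f)); first by rewrite !lt_min eta0 e0 f0.
move=> u hu.
have hu1 : CkT_le k.+1 eta u by apply: Ck_le_mono hu; rewrite ge_min lexx.
have hu2 : CkT_le k.+1 e u by apply: Ck_le_mono hu; rewrite !ge_min lexx orbT.
have hu3 : CkT_le k.+1 f u by apply: Ck_le_mono hu; rewrite !ge_min lexx !orbT.
have D1 : dirs ((1 : R), (0 : R)) by left.
have D2 : dirs ((0 : R), (1 : R)) by right.
pose du (v z : R2) := 'D_((1 : R), (0 : R)) u (shear a z) * (v.1 + v.2 * 'D_1 a z.2)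
   + v.2 * 'D_((0 : R), (1 : R)) u (shear a z).
apply: (@Ck_le_intro _ _ _ _ _ _ _ du).
- exact: openT.
- by move=> z _; exact: h1 hu.
- by move=> z _; exact: Ck_le_bnd hu1 _.
- move=> z v _ [->|->].
    apply: is_derive_eq.
      apply: (@is_derive_affine _ _ (shear a) ((1 : R), (0 : R))).
        move=> t; rewrite /shear /=; congr pair => /=.
        by rewrite [t *: 0]mulr0 [t *: 1]mulr1 addr0 addrAC.
      exact: Ck_le_is_derive hu D1 _.
    by rewrite /du /= !mul0r !addr0 mulr1.
  apply: is_derive_eq.
    apply: is_derive_shear2 => //.
    - by move=> y; exact: Ck_le_derivable hu D1 _.
    - by move=> y; exact: Ck_le_derivable hu D2 _.
    - by move=> y; exact: Ck_le_cont (Ck_le_derive hu D1) _.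
  by rewrite /du /= !mul1r add0r.
have eta2 : 0 <= eta / 2 by exact: ltW.
move=> v [->|->]; rewrite /du /=.
  apply: (@Ck_le_eq _ _ _ _ _ _ ('D_((1 : R), (0 : R)) u \o shear a)).
  - exact: openT.
  - by move=> z _ /=; rewrite !mul0r !addr0 mulr1.
  apply: Ck_le_mono (hf _ (Ck_le_derive hu3 D1)).
  by lra.
have -> : eta = eta / 2 + eta / 2 by field.
apply: Ck_le_add; first exact: openT.
  have H := Ck_le_mul (@openT R2) (ltW e'0) M0 (he _ (Ck_le_derive hu2 D1)) hM.
  apply: (@Ck_le_eq _ _ _ _ _ _ (fun z => ('D_((1 : R), (0 : R)) u \o shear a) z *
    ('D_1 a \o (fun z : R2 => z.2)) z)).
  - exact: openT.
  - by move=> z _ /=; rewrite mul1r add0r.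
  apply: Ck_le_mono H; rewrite /e'.
  have P0 : (0 : R) < 2 ^+ k by rewrite exprn_gt0.
  have M10 : 0 < M + 1 by rewrite ltr_wpDl.
  have -> : 2 ^+ k * (eta / (2 * (2 ^+ k * (M + 1))) * M) = eta / 2 * (M / (M + 1)).
    by field; rewrite !gt_eqF.
  by rewrite ler_piMr// ler_pdivrMr// mul1r lerDl.
apply: (@Ck_le_eq _ _ _ _ _ _ ('D_((0 : R), (1 : R)) u \o shear a)).
- exact: openT.
- by move=> z _ /=; rewrite mul1r.
exact: hf (Ck_le_derive hu3 D2).
Qed.

End Plane.

(** * Term-by-term differentiation of series *)

Section Series.
Context {R : realType}.
Implicit Types (a b m : nat -> R).

(** The value is meaningful when the series converges, which domination by a
convergent series ensures wherever it is used. *)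
Definition rsum a : R := limn (series a).

Lemma series_dominated_cvg a m : (forall n, `|a n| <= m n) -> cvgn (series m) ->
  cvgn (series a).
Proof.
move=> am cm; apply: normed_cvg; apply: series_le_cvg (am) cm => // n.
exact: le_trans (normr_ge0 _) (am n).
Qed.

Lemma rsum_tail a m N : (forall n, `|a n| <= m n) -> cvgn (series m) ->
  `|rsum a - series a N| <= rsum m - series m N.
Proof.
move=> am cm; have ca := series_dominated_cvg am cm.
have h1 : (fun n => `|series a n - series a N|) @ \oo --> `|rsum a - series a N|.
  by apply: cvg_norm; apply: cvgB => //; exact: cvg_cst.
have h2 : (fun n => series m n - series m N) @ \oo --> rsum m - series m N.
  by apply: cvgB => //; exact: cvg_cst.
rewrite -(cvg_lim _ h1)// -(cvg_lim _ h2)//.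
apply: ler_lim; [by apply/cvg_ex; eexists; exact: h1|by apply/cvg_ex; eexists; exact: h2|].
exists N => // n /= Nn; rewrite !sub_series_geq//.
by apply: le_trans (ler_norm_sum _ _ _) _; apply: ler_sum => i _.
Qed.

Lemma rsum_le a m : (forall n, `|a n| <= m n) -> cvgn (series m) -> `|rsum a| <= rsum m.
Proof.
move=> am cm; have := rsum_tail 0 am cm.
by rewrite /series /= !big_geq// !subr0.
Qed.

Lemma rsumB a b : cvgn (series a) -> cvgn (series b) ->
  rsum (fun n => a n - b n) = rsum a - rsum b.
Proof. exact: lim_seriesB. Qed.

Lemma rsumZ (c : R) a : cvgn (series a) -> rsum (fun n => c * a n) = c * rsum a.
Proof. exact: lim_seriesZ. Qed.

Lemma rsum_single a n0 : (forall n, n != n0 -> a n = 0) -> rsum a = a n0.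
Proof.
move=> h; apply: cvg_lim => //; apply/cvgrPdist_le => e e0.
exists n0.+1 => // n /= nn; rewrite /series /=.
rewrite big_mkord (bigD1 (Ordinal nn))//= big1 ?addr0 ?subrr ?normr0 ?ltW//.
by move=> i ii; apply: h; apply: contra ii => /eqP ii; apply/eqP/val_inj.
Qed.

(** Dominated convergence for series: the tail is uniformly small by domination, and
the remaining finite sum tends to 0. *)
Lemma tannery (T : Type) (F : set_system T) {FilF : Filter F} (f : nat -> T -> R) m :
  (forall n x, `|f n x| <= m n) -> cvgn (series m) ->
  (forall n, f n @ F --> (0 : R)) -> (fun x => rsum (f ^~ x)) @ F --> (0 : R).
Proof.
move=> fm cm f0; apply/cvgr0Pnorm_le => e e0.
have [N hN] : exists N, rsum m - series m N <= e / 2.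
  have e20 : 0 < e / 2 by rewrite divr_gt0.
  move: (cm) => /cvgrPdist_le/(_ _ e20)[N _ hN]; exists N.
  by apply: le_trans (hN N (leqnn N)); exact: ler_norm.
have hs : (fun x => series (f ^~ x) N) @ F --> (0 : R).
  elim: N {hN} => [|N IH].
    by rewrite /series /=; under eq_fun do rewrite big_geq//; exact: cvg_cst.
  under eq_fun do rewrite seriesSr.
  by rewrite -[0]addr0; apply: cvgD => //; exact: f0.
have e20 : 0 < e / 2 by rewrite divr_gt0.
move/cvgr0Pnorm_le/(_ _ e20) : hs; apply: filterS => x hx.
have := rsum_tail N (fun n => fm n x) cm => ht.
rewrite -(subrK (series (f ^~ x) N) (rsum _)) (le_trans (ler_normD _ _))//.
by rewrite (splitr e) lerD// (le_trans ht).
Qed.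

Lemma cvgn_series_scale (c : R) m : cvgn (series m) ->
  cvgn (series (fun n => c * m n)).
Proof. exact: is_cvg_seriesZ. Qed.

Context {V : normedModType R}.

(** The increments u n x - u n z are dominated by 2 m_n and tend to 0, so this is an
instance of tannery. *)
Lemma rsum_cont (D : set V) m (u : nat -> V -> R) z k :
  (forall n, Ck_le D setT k (m n) (u n)) -> cvgn (series m) ->
  {for z, continuous (fun z => rsum (u ^~ z))}.
Proof.
move=> hu cm.
have bnd y n : `|u n y| <= m n by exact: Ck_le_bnd (hu n) _.
have cu y : cvgn (series (u ^~ y)) by apply: series_dominated_cvg cm.
apply/subr_cvg0.
have := @tannery _ (nbhs z) _ (fun n x => u n x - u n z) (fun n => 2 * m n).
under [X in _ -> _ -> _ -> X @ _ --> _]eq_fun do rewrite rsumB//.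
apply.
- by move=> n x; rewrite (le_trans (ler_normB _ _))// mulr_natl mulr2n lerD.
- exact: cvgn_series_scale.
- by move=> n; apply/subr_cvg0; exact: Ck_le_cont (hu n) _.
Qed.

(** The difference quotients of u n are dominated by m_n, by the mean value
inequality, so tannery gives differentiation term by term; induction on k then
applies to the series of derivatives. *)
Lemma Ck_le_series (D : set V) k m (u : nat -> V -> R) :
  (forall n, Ck_le D setT k (m n) (u n)) -> cvgn (series m) ->
  Ck_le D setT k (rsum m) (fun z => rsum (u ^~ z)).
Proof.
elim: k u => [|k IH] u hu cm.
all: have bnd z n : `|u n z| <= m n by exact: Ck_le_bnd (hu n) _.
all: have h2 z : `|rsum (u ^~ z)| <= rsum m by exact: rsum_le.
all: have cu z : cvgn (series (u ^~ z)) by apply: series_dominated_cvg cm.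
all: have h1 z : {for z, continuous (fun z => rsum (u ^~ z))} by exact: rsum_cont.
  by split.
apply: (@Ck_le_intro _ _ _ _ _ _ _ (fun v z => rsum (fun n => 'D_v (u n) z))) => //.
- exact: openT.
- move=> z v _ Dv.
  have bd n y : `|'D_v (u n) y| <= m n by exact: Ck_le_bnd (Ck_le_derive (hu n) Dv) _.
  have cd y : cvgn (series (fun n => 'D_v (u n) y)) by apply: series_dominated_cvg cm.
  suff C : (fun h : R => h^-1 *: (((fun z => rsum (u ^~ z)) \o shift z) (h *: v) -
       rsum (u ^~ z))) @ 0^' --> rsum (fun n => 'D_v (u n) z).
    split; [by apply/cvg_ex; exists (rsum (fun n => 'D_v (u n) z))|exact: cvg_lim C].
  have := @tannery _ (0^') _
   (fun n (h : R) => h^-1 * (u n (h *: v + z) - u n z) - 'D_v (u n) z)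
   (fun n => 2 * m n).
  have -> : (fun h : R => rsum ((fun n (h : R) =>
      h^-1 * (u n (h *: v + z) - u n z) - 'D_v (u n) z) ^~ h)) =
    (fun h : R => h^-1 * (rsum (u ^~ (h *: v + z)) - rsum (u ^~ z)) -
       rsum (fun n => 'D_v (u n) z)).
    apply/funext => h; rewrite rsumB//; last first.
      by apply: cvgn_series_scale; apply: is_cvg_seriesB.
    rewrite rsumZ; last exact: is_cvg_seriesB.
    by rewrite rsumB.
  move=> H; apply/subr_cvg0; apply: H.
  + move=> n h; rewrite (le_trans (ler_normB _ _))// mulr_natl mulr2n lerD//.
    have [->|h0] := eqVneq h 0.
      by rewrite invr0 mul0r normr0; exact: le_trans (bnd z n).
    rewrite normrM normfV ler_pdivrMl ?normr_gt0// mulrC [_ + z]addrC.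
    apply: mvt_line => s; first exact: Ck_le_derivable (hu n) Dv _.
    by move=> _; exact: bd.
  + exact: cvgn_series_scale.
  + move=> n; apply/subr_cvg0.
    have [] := Ck_le_is_derive (hu n) Dv (I : setT z).
    by move=> h _; exact: h.
- move=> v Dv; apply: (IH (fun n => 'D_v (u n))) => // n; exact: Ck_le_derive (hu n) Dv.
Qed.

End Series.

(** * Flat functions *)

Section Flat.
Context {R : realType}.
Implicit Types p : {poly R}.

(** All the derivatives of exp (-1 / t) have the form p (1 / t) exp (-1 / t); the
whole family is treated at once because it is closed under derivation. *)
Definition flat_poly p (t : R) : R :=
  if 0 < t then p.[t^-1] * expR (- t^-1) else 0.

Lemma pow_exp_bnd n : exists M : R, forall s, 0 < s -> s ^+ n * expR (- s) <= M.
Proof.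
case: n => [|n]; first by exists 1 => s s0; rewrite mul1r expR_le1 oppr_le0 ltW.
exists (n.+1)`!%:R => s s0; rewrite expRN ler_pdivrMr ?expR_gt0//.
have := expR_ge1Dxn n (ltW s0) => h.
have : s ^+ n.+1 / (n.+1)`!%:R <= expR s by apply: le_trans h; rewrite lerDr.
by rewrite ler_pdivrMr ?ltr0n ?fact_gt0// mulrC.
Qed.

Lemma poly_exp_bnd p n :
  exists M : R, forall s, 0 < s -> `|p.[s] * s ^+ n * expR (- s)| <= M.
Proof.
elim/poly_ind: p n => [|p c IH] n.
  by exists 0 => s s0; rewrite horner0 !mul0r normr0.
have [M hM] := IH n.+1; have [N hN] := pow_exp_bnd n.
exists (M + `|c| * N) => s s0; rewrite hornerMXaddC.
rewrite !mulrDl (le_trans (ler_normD _ _))// lerD//.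
  by rewrite -(mulrA p.[s] s) -exprS hM.
rewrite -mulrA normrM ler_wpM2l// ger0_norm ?hN//.
by rewrite mulr_ge0 ?expR_ge0// exprn_ge0// ltW.
Qed.

Lemma flat_poly_bnd p : exists M : R, forall t, `|flat_poly p t| <= M.
Proof.
have [M hM] := poly_exp_bnd p 0; exists (`|M|) => t; rewrite /flat_poly.
case: ifP => t0; last by rewrite normr0.
have := hM t^-1; rewrite invr_gt0 expr0 mulr1 => /(_ t0) h.
exact: le_trans (ler_norm M).
Qed.

(** At 0 the derivative vanishes because |flat_poly p t| <= t^2 M, where M bounds the
member of the family with polynomial 'X^2 * p. *)
Lemma is_derive_flat_poly p (t : R) :
  is_derive t (1 : R) (flat_poly p) (flat_poly ('X^2 * (p - p^`())) t).
Proof.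
have [t0|t0|->] := ltgtP t 0.
- have E : {near t, cst (0 : R) =1 flat_poly p}.
    near=> s; rewrite /flat_poly ifF//; apply/negbTE; rewrite -leNgt ltW//.
    by near: s; exact: lt_nbhsl.
  have [h1 h2] := is_derive_cst (0 : R) t (1 : R).
  split; first exact: near_eq_derivable E h1.
  by rewrite -(near_eq_derive (1 : R) E) h2 /flat_poly ifF// ltNge ltW.
- have E : {near t, (fun s => p.[s^-1] * expR (- s^-1)) =1 flat_poly p}.
    near=> s; rewrite /flat_poly ifT//.
    by near: s; exact: lt_nbhsr.
  have tn0 : t != 0 by rewrite gt_eqF.
  have hV : is_derive t (1 : R) (fun s : R => s^-1) (- t ^- 2).
    have := @is_deriveV _ id t 1 1 tn0 (is_derive_id _ _).
    by rewrite [_ *: 1]mulr1.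
  have hp : is_derive t (1 : R) (fun s : R => p.[s^-1]) (p^`().[t^-1] * - t ^- 2).
    exact: (@is_derive1_comp _ (horner p) (fun s : R => s^-1)).
  have hE : is_derive t (1 : R) (fun s : R => expR (- s^-1))
      (expR (- t^-1) * - - t ^- 2).
    exact: (@is_derive1_comp _ expR (fun s : R => - s^-1)).
  have [h1 h2] := is_deriveM hp hE.
  split; first exact: near_eq_derivable E h1.
  rewrite -(near_eq_derive (1 : R) E) [LHS]h2 /flat_poly t0 hornerM hornerXn hornerD hornerN.
  rewrite /GRing.scale /= -!exprVn; ring.
- have -> : flat_poly ('X^2 * (p - p^`())) 0 = 0 by rewrite /flat_poly ltxx.
  have [M hM] := flat_poly_bnd ('X^2 * p).
  apply: is_derive0_small; first by rewrite /flat_poly ltxx.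
  move=> e e0; have M0 : 0 <= M by exact: le_trans (hM 0).
  near=> s.
  have hs : `|flat_poly p s| <= `|s| ^+ 2 * M.
    have := hM s; rewrite /flat_poly; case: ifP => s0 h; last first.
      by rewrite normr0 mulr_ge0// exprn_ge0.
    have sn0 : s != 0 by rewrite gt_eqF.
    rewrite -ler_pdivrMl ?exprn_gt0 ?normr_gt0//.
    apply: le_trans h; rewrite hornerM hornerXn -[in leRHS]mulrA [in leRHS]normrM.
    by rewrite normrX normfV exprVn.
  rewrite (le_trans hs)// expr2 -mulrA mulrC ler_wpM2r//.
  have : `|s| <= e / (M + 1).
    near: s; apply/nbhs_ballP; exists (e / (M + 1)) => /=.
      by rewrite divr_gt0// ltr_wpDl.
    by move=> s; rewrite /ball /= sub0r normrN => /ltW.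
  rewrite ler_pdivlMr ?ltr_wpDl// => h; apply: le_trans h.
  by rewrite ler_wpM2l// lerDl.
Unshelve. all: by end_near. Qed.

Lemma flat_poly_smooth p : smooth_bounded (flat_poly p).
Proof.
move=> k; suff [M hM] : exists M, Ck_le [set (1 : R)] setT k M (flat_poly p).
  by exists M => //; exact: (Ck_le_ge0 (I : setT (0 : R)) hM).
elim: k p => [|k IH] p.
all: have [M hM] := flat_poly_bnd p.
all: have h1 t : {for t, continuous (flat_poly p)} by
  (apply/differentiable_continuous/derivable1_diffP; have [] := is_derive_flat_poly p t).
  by exists M; split.
have [N hN] := IH ('X^2 * (p - p^`())).
exists (Num.max M N); apply: (@Ck_le_intro _ _ _ _ _ _ _
   (fun _ => flat_poly ('X^2 * (p - p^`())))) => //.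
- exact: openT.
- by move=> z _; rewrite le_max hM.
- by move=> z v _ ->; exact: is_derive_flat_poly.
- by move=> v _; apply: Ck_le_mono hN; rewrite le_max lexx orbT.
Qed.

End Flat.

Section Smooth1Closure.
Context {R : realType}.
Implicit Types a b : R -> R.

Lemma smooth_bounded_cst (c : R) : smooth_bounded (fun _ : R => c).
Proof. by move=> k; exists `|c| => //; apply: Ck_le_cst => //; exact: openT. Qed.

Lemma smooth_bounded_dCk_le a k : smooth_bounded a ->
  exists2 M, 0 <= M & dCk_le [set (1 : R)] setT k M a.
Proof. by move=> /(_ k.+1)[M M0 /Ck_le_dCk_le]; exists M. Qed.

Lemma smooth_bounded_comp a b : smooth_bounded a -> smooth_bounded b -> smooth_bounded (a \o b).
Proof.
move=> Sa Sb k; have [M M0 hb] := smooth_bounded_dCk_le k Sb.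
exact: Ck_le_comp openT M0 Sa hb.
Qed.

Lemma smooth_bounded_affine a (c d : R) : smooth_bounded a ->
  smooth_bounded (fun t => a (c * t + d)).
Proof.
move=> Sa k; apply: (@Ck_le_comp _ _ _ _ _ `|c| (fun t => c * t + d) a openT) => //.
have H (t : R) : is_derive t (1 : R) (fun t => c * t + d) c.
  by apply: is_derive_eq; rewrite addr0 [_ *: 1]mulr1.
split.
  move=> t _; apply/differentiable_continuous/derivable1_diffP.
  by have [] := H t.
move=> _ ->; split=> [t _|]; first by have [] := H t.
rewrite (_ : 'D_(1 : R) _ = fun=> c); first by apply: Ck_le_cst => //; exact: openT.
by apply/funext => t; have [] := H t.
Qed.

Lemma smooth_bounded_add a b : smooth_bounded a -> smooth_bounded b ->
  smooth_bounded (fun t => a t + b t).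
Proof.
move=> Sa Sb k; have [M M0 h] := Sa k; have [N N0 h'] := Sb k.
exists (M + N); first exact: addr_ge0.
by apply: Ck_le_add => //; exact: openT.
Qed.

Lemma smooth_bounded_scale a (c : R) : smooth_bounded a -> smooth_bounded (fun t => c * a t).
Proof.
move=> Sa k; have [M M0 h] := Sa k; have [N N0 h'] := smooth_bounded_cst c k.
eexists; last by apply: Ck_le_mul h' h => //; exact: openT.
by rewrite !mulr_ge0// exprn_ge0.
Qed.

Lemma Ck_le_sin_cos k :
  Ck_le [set (1 : R)] setT k 1 (@sin R) /\ Ck_le [set (1 : R)] setT k 1 (@cos R).
Proof.
elim: k => [|k [IHs IHc]].
  split; split=> // t _; split.
  - exact: continuous_sin.
  - exact: sin_max.
  - exact: continuous_cos.
  - exact: cos_max.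
split.
- apply: (@Ck_le_intro _ _ _ _ _ _ _ (fun _ => cos)).
  + exact: openT.
  + by move=> t _; exact: continuous_sin.
  + by move=> t _; exact: sin_max.
  + by move=> t _ _ ->; exact: is_derive_sin.
  + by [].
- apply: (@Ck_le_intro _ _ _ _ _ _ _ (fun _ t => - sin t)).
  + exact: openT.
  + by move=> t _; exact: continuous_cos.
  + by move=> t _; exact: cos_max.
  + by move=> t _ _ ->; exact: is_derive_cos.
  + by move=> _ _; apply: Ck_le_opp => //; exact: openT.
Qed.

Lemma smooth_bounded_sin : smooth_bounded (@sin R).
Proof. by move=> k; exists 1 => //; exact: (Ck_le_sin_cos k).1. Qed.

Lemma smooth_bounded_cos : smooth_bounded (@cos R).
Proof. by move=> k; exists 1 => //; exact: (Ck_le_sin_cos k).2. Qed.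

Definition flat : R -> R := flat_poly 1.

Lemma smooth_bounded_flat : smooth_bounded flat.
Proof. exact: flat_poly_smooth. Qed.

Lemma flat_le0 t : t <= 0 -> flat t = 0.
Proof. by move=> t0; rewrite /flat /flat_poly ifF// ltNge t0. Qed.

Lemma flat_gt0 t : 0 < t -> 0 < flat t.
Proof. by move=> t0; rewrite /flat /flat_poly t0 hornerC mul1r expR_gt0. Qed.

Lemma flat_le1 t : flat t <= 1.
Proof.
rewrite /flat /flat_poly; case: ifP => // t0.
by rewrite hornerC mul1r expR_le1 oppr_le0 invr_ge0 ltW.
Qed.

End Smooth1Closure.

(** * From bounds on displacements to smooth maps of the plane *)

Section CkPlane.
Context {R : realType}.
Local Notation R2 := (plane R).
Local Notation CkT_le := (Ck_le dirs (setT : set R2)).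

Lemma is_derive_pair (u w : R2 -> R) z v d e : is_derive z v u d ->
  is_derive z v w e -> is_derive z v (fun z => (u z, w z) : R2) (d, e).
Proof.
move=> [du hd] [dw he].
have C : (fun h : R => h^-1 *: (((fun z => (u z, w z) : R2) \o shift z) (h *: v) -
    (u z, w z))) @ 0^' --> ((d, e) : R2).
  rewrite -hd -he; exact: (cvg_pair du dw).
by split; [apply/cvg_ex; eexists; exact: C|exact: cvg_lim C].
Qed.

Lemma Ck_on_pair k M u w : CkT_le k M u -> CkT_le k M w ->
  Ck_on k setT (fun z => (u z, w z) : R2).
Proof.
elim: k u w => [|k IH] u w hu hw /=.
all: have h1 : {in [set: R2], continuous (fun z => (u z, w z) : R2)} by
  move=> z _; apply: (@pair_cont _ _ u w); [exact: Ck_le_cont hu _|exact: Ck_le_cont hw _].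
  by split.
have H v z : dirs v -> is_derive z v (fun z => (u z, w z) : R2) ('D_v u z, 'D_v w z).
  move=> Dv; apply: is_derive_pair; first exact: Ck_le_is_derive hu Dv _.
  exact: Ck_le_is_derive hw Dv _.
have E v : dirs v -> 'D_v (fun z => (u z, w z) : R2) = (fun z => ('D_v u z, 'D_v w z)).
  by move=> Dv; apply/funext => z; have [] := H v z Dv.
have D1 : dirs ((1 : R), (0 : R)) by left.
have D2 : dirs ((0 : R), (1 : R)) by right.
split=> //; split.
- by move=> z _; have [] := H _ z D1.
- by move=> z _; have [] := H _ z D2.
- by rewrite E//; apply: IH; exact: Ck_le_derive.
- by rewrite E//; apply: IH; exact: Ck_le_derive.
Qed.

(** A map of the plane that commutes with integer translations is unbounded, so the
bounds can only concern its displacement. *)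
Lemma smooth_on_displacement (u w : R2 -> R) :
  (forall k, exists M, CkT_le k M u) -> (forall k, exists M, CkT_le k M w) ->
  smooth_on setT (fun z => (z.1 + u z, z.2 + w z) : R2).
Proof.
move=> Hu Hw k; have [M1 hu'] := Hu k.+1; have [M2 hw'] := Hw k.+1.
pose M := Num.max M1 M2.
have hu : CkT_le k.+1 M u by apply: Ck_le_mono hu'; rewrite le_max lexx.
have hw : CkT_le k.+1 M w by apply: Ck_le_mono hw'; rewrite le_max lexx orbT.
have h1 : {in [set: R2], continuous (fun z => (z.1 + u z, z.2 + w z) : R2)}.
  move=> z _; apply: (@pair_cont _ _ (fun z => z.1 + u z) (fun z => z.2 + w z)).
    by apply: cvgD; [exact: fst_cont|exact: Ck_le_cont hu _].
  by apply: cvgD; [exact: snd_cont|exact: Ck_le_cont hw _].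
case: k Hu Hw hu' hw' hu hw => [|k] Hu Hw hu' hw' hu hw; first by split.
have H v z : dirs v -> is_derive z v (fun z => (z.1 + u z, z.2 + w z) : R2)
    (v.1 + 'D_v u z, v.2 + 'D_v w z).
  move=> Dv; apply: is_derive_pair; apply: is_deriveD.
  - exact: is_derive_fst.
  - exact: Ck_le_is_derive hu Dv _.
  - exact: is_derive_snd.
  - exact: Ck_le_is_derive hw Dv _.
have E v : dirs v -> 'D_v (fun z => (z.1 + u z, z.2 + w z) : R2) =
    (fun z => (v.1 + 'D_v u z, v.2 + 'D_v w z)).
  by move=> Dv; apply/funext => z; have [] := H v z Dv.
have C v : dirs v -> Ck_on k setT (fun z => (v.1 + 'D_v u z, v.2 + 'D_v w z) : R2).
  move=> Dv; apply: (@Ck_on_pair _ (1 + M)).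
    apply: Ck_le_add; [exact: openT| |exact: Ck_leS (Ck_le_derive hu Dv)].
    by apply: Ck_le_cst; [exact: openT|case: Dv => ->; rewrite /= ?normr0 ?normr1].
  apply: Ck_le_add; [exact: openT| |exact: Ck_leS (Ck_le_derive hw Dv)].
  by apply: Ck_le_cst; [exact: openT|case: Dv => ->; rewrite /= ?normr0 ?normr1].
have D1 : dirs ((1 : R), (0 : R)) by left.
have D2 : dirs ((0 : R), (1 : R)) by right.
split=> //; split.
- by move=> z _; have [] := H _ z D1.
- by move=> z _; have [] := H _ z D2.
- by rewrite (E _ D1); exact: C.
- by rewrite (E _ D2); exact: C.
Qed.

End CkPlane.

(** * The unit cell and periodization *)

Section Frac.
Context {R : realType}.
Local Notation R2 := (plane R).

Definition frac (x : R) : R := x - (Num.floor x)%:~R.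

Lemma frac_itv x : 0 <= frac x < 1.
Proof.
have := floor_itv x; rewrite /frac intrD => /andP[h1 h2].
by apply/andP; split; lra.
Qed.

Lemma frac_uniq (x y : R) (n : int) : 0 <= y < 1 -> x = y + n%:~R -> frac x = y.
Proof.
move=> y01 ->; rewrite /frac (@floor_def _ _ n) ?addrK//.
by rewrite intrD; apply/andP; split; lra.
Qed.

Lemma frac_id y : 0 <= y < 1 -> frac y = y.
Proof. by move=> y01; apply: (@frac_uniq _ _ 0) => //; rewrite addr0. Qed.

Lemma fracDz (x : R) (n : int) : frac (x + n%:~R) = frac x.
Proof.
apply: (@frac_uniq _ _ (Num.floor x + n)); first exact: frac_itv.
by rewrite /frac intrD addrA subrK.
Qed.

Definition fracp (z : R2) : R2 := (frac z.1, frac z.2).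
Definition floorp (z : R2) : int * int := (Num.floor z.1, Num.floor z.2).
Definition unit_cell : set R2 := (`[0, 1[%classic `*` `[0, 1[%classic).

Lemma unit_cellE z : unit_cell z <-> (0 <= z.1 < 1) /\ (0 <= z.2 < 1).
Proof. by rewrite /unit_cell /setX /= !in_itv /=. Qed.

Lemma fracpE z : z = fracp z + int_vec (floorp z).
Proof. by case: z => x y; congr pair; rewrite /= subrK. Qed.

Lemma fracp_cell z : unit_cell (fracp z).
Proof. by apply/unit_cellE; split; exact: frac_itv. Qed.

Lemma fracp_id z : unit_cell z -> fracp z = z.
Proof. by case: z => x y /unit_cellE[h1 h2]; rewrite /fracp /= !frac_id. Qed.

Lemma fracpD z v : fracp (z + int_vec v) = fracp z.
Proof. by rewrite /fracp /= !fracDz. Qed.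

Lemma floorpD z v : unit_cell z -> floorp (z + int_vec v) = v.
Proof.
case: z v => x y [m n] /unit_cellE[/= h1 h2]; rewrite /floorp /=.
by congr pair; apply: floor_def; rewrite intrD; apply/andP; split; lra.
Qed.

Local Notation CkT_le := (Ck_le dirs (setT : set R2)).

(** Near every point g \o fracp is either an integer translate of g or, near the
grid of lines with integer coordinates, zero. *)
Lemma Ck_le_periodize k eta (g : R2 -> R) (kap : R) : 0 < kap ->
  (forall z, g z != 0 -> kap <= z.1 <= 1 - kap /\ kap <= z.2 <= 1 - kap) ->
  CkT_le k eta g -> CkT_le k eta (g \o fracp).
Proof.
move=> k0 hg Cg; apply: Ck_le_cover => z _.
have eta0 : 0 <= eta by exact: Ck_le_ge0 (I : setT (0 : R2)) Cg.
have cstrip (p : R2 -> R) (n : int) : continuous p ->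
    open [set w | `|p w - n%:~R| < kap].
  move=> cp; apply: (@open_comp _ _ (fun w => `|p w - n%:~R|) [set x | x < kap]).
    move=> w _; apply: cvg_norm; apply: cvgB; [exact: cp|exact: cvg_cst].
  exact: open_lt.
have strip (x : R) (n : int) : `|x - n%:~R| < kap ->
    ~ (kap <= frac x <= 1 - kap).
  rewrite /frac ltr_norml => /andP[h1 h2] /andP[h3 h4].
  have [h|h] := leP (n%:~R) x.
    have E : Num.floor x = n by apply: floor_def; rewrite intrD; apply/andP; split; lra.
    by move: h3; rewrite E; lra.
  have E : Num.floor x = n - 1.
    by apply: floor_def; rewrite !intrD mulrN1z; apply/andP; split; lra.
  by move: h4; rewrite E intrD mulrN1z; lra.
have g0 w : ~ (kap <= frac w.1 <= 1 - kap) \/ ~ (kap <= frac w.2 <= 1 - kap) ->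
    0 = (g \o fracp) w.
  move=> h; apply/esym/eqP/negPn/negP => /hg /= [h1 h2].
  by case: h; apply.
(* On a strip around a line with integer coordinates the function vanishes. *)
have [z1|z1] := eqVneq (frac z.1) 0.
  exists [set w | `|w.1 - (Num.floor z.1)%:~R| < kap].
    by move: z1; rewrite /frac /= => ->; rewrite normr0.
  apply: (@Ck_le_eq _ _ _ _ _ _ (fun=> 0)).
  - by apply: cstrip; exact: fst_cont.
  - by move=> w /= hw; apply: g0; left; exact: strip hw.
  - by apply: Ck_le_cst; [apply: cstrip; exact: fst_cont|rewrite normr0].
have [z2|z2] := eqVneq (frac z.2) 0.
  exists [set w | `|w.2 - (Num.floor z.2)%:~R| < kap].
    by move: z2; rewrite /frac /= => ->; rewrite normr0.
  apply: (@Ck_le_eq _ _ _ _ _ _ (fun=> 0)).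
  - by apply: cstrip; exact: snd_cont.
  - by move=> w /= hw; apply: g0; right; exact: strip hw.
  - by apply: Ck_le_cst; [apply: cstrip; exact: snd_cont|rewrite normr0].
pose v := floorp z.
pose U : set R2 := [set w | v.1%:~R < w.1] `&` [set w | w.1 < v.1%:~R + 1] `&`
  ([set w | v.2%:~R < w.2] `&` [set w | w.2 < v.2%:~R + 1]).
have oU : open U.
  have o1 (p : R2 -> R) (c : R) : continuous p -> open [set w | c < p w].
    by move=> cp; apply: (@open_comp _ _ p [set x | c < x]) => [w _|];
      [exact: cp|exact: open_gt].
  have o2 (p : R2 -> R) (c : R) : continuous p -> open [set w | p w < c].
    by move=> cp; apply: (@open_comp _ _ p [set x | x < c]) => [w _|];
      [exact: cp|exact: open_lt].
  by apply: openI; apply: openI;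
    [apply: o1|apply: o2|apply: o1|apply: o2];
    try exact: fst_cont; exact: snd_cont.
exists U.
  have := frac_itv z.1; have := frac_itv z.2; move: z1 z2; rewrite /U /frac /=.
  move=> z1 z2 /andP[h1 h2] /andP[h3 h4].
  have h5 : 0 < frac z.1 by rewrite lt_neqAle eq_sym z1 h3.
  have h6 : 0 < frac z.2 by rewrite lt_neqAle eq_sym z2 h1.
  by move: h5 h6; rewrite /frac; split; split => /=; lra.
apply: (@Ck_le_eq _ _ _ _ _ _ (fun w => g (w - int_vec v))) => //.
- move=> w [[/= h1 h2] [/= h3 h4]]; congr g; rewrite /fracp.
  case: w h1 h2 h3 h4 => x y /= h1 h2 h3 h4; congr pair => /=.
    by apply/esym; apply: (@frac_uniq _ _ v.1); [apply/andP; split; lra|rewrite subrK].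
  by apply/esym; apply: (@frac_uniq _ _ v.2); [apply/andP; split; lra|rewrite subrK].
- apply: Ck_le_subset (Ck_le_shift (- int_vec v) Cg) => //.
Qed.

End Frac.

(** * Twists of a disc *)

Section Twist.
Context {R : realType}.
Local Notation R2 := (plane R).
Variables (c d : R).
Hypotheses (d0 : 0 < d) (dc : 2 * d < c) (dc1 : c + 2 * d < 1).
Implicit Types (z w : R2) (e f : R).

Definition sqdist z : R := (z.1 - c) ^+ 2 + (z.2 - c) ^+ 2.
(** Vanishes outside the disc of radius 2 * d, with all its derivatives at the
boundary, and is constant on each circle, so that twists compose by addition
of their parameters. *)
Definition twist_angle e z : R := e * flat (4 * d ^+ 2 - sqdist z).
Definition rotation (phi : R) z : R2 :=
  (c + ((z.1 - c) * cos phi - (z.2 - c) * sin phi),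
   c + ((z.1 - c) * sin phi + (z.2 - c) * cos phi)).
Definition twist0 e z : R2 := rotation (twist_angle e z) z.
(** Performs the twist in all the integer translates of the disc. *)
Definition twist e z : R2 := twist0 e (fracp z) + int_vec (floorp z).

Lemma sqdist_rotation phi z : sqdist (rotation phi z) = sqdist z.
Proof.
rewrite /sqdist /rotation /= !(addrC c) !addrK.
have := cos2Dsin2 phi; set C := cos phi; set s := sin phi => h.
transitivity (((z.1 - c) ^+ 2 + (z.2 - c) ^+ 2) * (C ^+ 2 + s ^+ 2)); first by ring.
by rewrite h mulr1.
Qed.

Lemma twist_angle_rotation phi e z : twist_angle e (rotation phi z) = twist_angle e z.
Proof. by rewrite /twist_angle sqdist_rotation. Qed.

Lemma rotationD phi psi z : rotation phi (rotation psi z) = rotation (phi + psi) z.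
Proof. by rewrite /rotation /= cosD sinD; congr pair; ring. Qed.

Lemma rotation0 z : rotation 0 z = z.
Proof.
case: z => x y; rewrite /rotation /= cos0 sin0.
by congr pair; ring.
Qed.

Lemma twist0D e f z : twist0 e (twist0 f z) = twist0 (e + f) z.
Proof. by rewrite /twist0 twist_angle_rotation rotationD /twist_angle -mulrDl. Qed.

Lemma twist00 z : twist0 0 z = z.
Proof. by rewrite /twist0 /twist_angle mul0r rotation0. Qed.

Lemma twist0_out e z : 4 * d ^+ 2 <= sqdist z -> twist0 e z = z.
Proof. by move=> h; rewrite /twist0 /twist_angle flat_le0 ?mulr0 ?rotation0// subr_le0. Qed.

Lemma in_disc z : sqdist z < 4 * d ^+ 2 ->
  (c - 2 * d < z.1 < c + 2 * d) /\ (c - 2 * d < z.2 < c + 2 * d).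
Proof.
rewrite /sqdist => h.
have H (X Y : R) : X ^+ 2 + Y ^+ 2 < 4 * d ^+ 2 -> - (2 * d) < X < 2 * d.
  move=> hXY; have hX : X ^+ 2 < (2 * d) ^+ 2.
    by have := sqr_ge0 Y; rewrite exprMn -natrX /=; lra.
  by rewrite -ltr_norml -(@ltr_pXn2r _ 2)// ?nnegrE ?mulr_ge0 ?ltW// real_normK// num_real.
have /andP[h1 h2] := H _ _ h; rewrite addrC in h; have /andP[h3 h4] := H _ _ h.
by split; apply/andP; split; lra.
Qed.

Lemma disc_cell z : sqdist z < 4 * d ^+ 2 -> unit_cell z.
Proof.
move=> /in_disc; move: z.1 z.2 (unit_cellE z) => x y [_ QE] [/andP[h1 h2] /andP[h3 h4]].
have hdc := dc; have hdc1 := dc1.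
have a1 : 0 <= x by lra.
have a2 : x < 1 by lra.
have a3 : 0 <= y by lra.
have a4 : y < 1 by lra.
by apply: QE; split; apply/andP; split.
Qed.

Lemma twist0_cell e z : unit_cell z -> unit_cell (twist0 e z).
Proof.
move=> Qz; have [h|h] := leP (4 * d ^+ 2) (sqdist z); first by rewrite twist0_out.
by apply: disc_cell; rewrite sqdist_rotation.
Qed.

Lemma fracp_twist e z : fracp (twist e z) = twist0 e (fracp z).
Proof. by rewrite /twist fracpD fracp_id//; apply: twist0_cell; exact: fracp_cell. Qed.

Lemma twist_equivariant e z v : twist e (z + int_vec v) = twist e z + int_vec v.
Proof.
rewrite /twist fracpD -addrA; congr (_ + _).
rewrite {1}(fracpE z) -addrA.
have -> : int_vec (floorp z) + int_vec v = int_vec (floorp z + v) :> R2.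
  by rewrite /int_vec /=; congr pair => /=; rewrite intrD.
by rewrite floorpD//; exact: fracp_cell.
Qed.

Lemma twistD e f z : twist e (twist f z) = twist (e + f) z.
Proof.
rewrite {1}/twist fracp_twist twist0D /twist.
by congr (_ + int_vec _); rewrite floorpD//; apply: twist0_cell; exact: fracp_cell.
Qed.

Lemma twist_0 z : twist 0 z = z.
Proof. by rewrite /twist twist00 -fracpE. Qed.

Lemma twist_cell e z : unit_cell z -> twist e z = twist0 e z.
Proof.
move=> Qz; rewrite /twist fracp_id// -[RHS]addr0; congr (_ + _).
have := @floorpD _ z 0 Qz; rewrite (_ : z + int_vec 0 = z) => [->//|].
by rewrite /int_vec /= [X in z + X](_ : _ = 0)// addr0.
Qed.

Lemma twist_supp e z : twist e z <> z -> sqdist (fracp z) < 4 * d ^+ 2.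
Proof.
move=> h; rewrite ltNge; apply/negP => h'; apply: h.
by rewrite /twist twist0_out// -fracpE.
Qed.

Lemma twist_supp_inv e z : sqdist (fracp z) < 4 * d ^+ 2 ->
  sqdist (fracp (twist e z)) < 4 * d ^+ 2.
Proof. by rewrite fracp_twist sqdist_rotation. Qed.

Lemma cell_diam z w v : unit_cell z -> unit_cell w -> `|(z + v) - (w + v)| <= 1.
Proof.
move=> /unit_cellE[/andP[a1 a2] /andP[a3 a4]] /unit_cellE[/andP[b1 b2] /andP[b3 b4]].
rewrite opprD addrACA subrr addr0 prod_normE /= ge_max !ler_norml.
by apply/andP; split; apply/andP; split; lra.
Qed.

Lemma twist_dist e z : `|twist e z - z| <= 1.
Proof.
by rewrite {2}(fracpE z) /twist; apply: cell_diam; [apply: twist0_cell|]; exact: fracp_cell.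
Qed.

End Twist.

(** * Families of maps that tend to the identity *)

Section SmallFam.
Context {R : realType}.
Local Notation R2 := (plane R).
Local Notation CkT_le := (Ck_le dirs (setT : set R2)).
Implicit Types (T : R -> R2 -> R2).

(** Convergence of T e to the identity in C^k for every k, as e tends to 0. *)
Definition small_fam T := forall k (eta : R), 0 < eta ->
  exists2 e0 : R, 0 < e0 & forall e : R, `|e| <= e0 ->
    CkT_le k eta (fun z => (T e z).1 - z.1) /\ CkT_le k eta (fun z => (T e z).2 - z.2).

Lemma small_fam_swap T : small_fam T -> small_fam (fun e => swap \o T e \o swap).
Proof.
move=> ST k eta eta0; have [e0 e00 h] := ST k eta eta0; exists e0 => // e /h[h1 h2].
by split; [exact: Ck_le_swap h2|exact: Ck_le_swap h1].
Qed.

(** The conjugation adds to the first displacement u1 the difference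
a (y + u2) - a y, where u2 is the second displacement. *)
Lemma small_fam_shear T a b : smooth_bounded a -> smooth_bounded b -> (forall t, b t = - a t) ->
  small_fam T -> small_fam (fun e => shear a \o T e \o shear b).
Proof.
move=> Sa Sb ba ST k eta eta0.
have eta20 : 0 < eta / 2 by rewrite divr_gt0.
have [e1 e10 h1] := Ck_le_shear k Sb eta20.
have [e2 e20 h2] := @Ck_le_comp_small _ _ dirs setT k 1 (fun z : R2 => z.2)
  a openT ler01 Sa (dCk_le_snd k) _ eta20.
have [e3 e30 h3] := Ck_le_shear k Sb e20.
have m0 : 0 < Num.min e1 e3 by rewrite lt_min e10.
have [e0 e00 h] := ST k _ m0; exists e0 => // e /h[H1 H2].
have G1 := h1 _ (Ck_le_mono (_ : Num.min e1 e3 <= e1) H1).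
have G2 := h1 _ (Ck_le_mono (_ : Num.min e1 e3 <= e1) H2).
have G3 := h2 _ (h3 _ (Ck_le_mono (_ : Num.min e1 e3 <= e3) H2)).
rewrite ge_min lexx in G1; rewrite ge_min lexx in G2.
rewrite ge_min lexx orbT in G3.
split; last first.
  apply: Ck_le_mono (Ck_le_eq _ _ (G2 isT)); [lra|exact: openT|by []].
have -> : eta = eta / 2 + eta / 2 by field.
apply: Ck_le_eq (Ck_le_add _ (G1 isT) (G3 isT)); [exact: openT| |exact: openT].
move=> z _ /=; rewrite (addrC z.2) subrK ba; ring.
Qed.

(** Supplements small_fam: once a parameter e is chosen small for the C^k norm with a
given k, the norms of higher order still have to be finite. *)
Definition bdd_fam T := forall k e, exists M : R,
    CkT_le k M (fun z => (T e z).1 - z.1) /\ CkT_le k M (fun z => (T e z).2 - z.2).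

Definition tame_fam T := small_fam T /\ bdd_fam T.

(** Composition with the shear is linear in u, so the statement about small
functions gives one about all bounded functions by scaling. *)
Lemma Ck_le_shear_bdd a k M u : smooth_bounded a -> CkT_le k M u ->
  exists2 N, 0 <= N & CkT_le k N (u \o shear a).
Proof.
move=> Sa hu; have [e e0 h] := Ck_le_shear k Sa ltr01.
have M0 : 0 <= M by exact: Ck_le_ge0 (I : setT (0 : R2)) hu.
pose r := e / (2 ^+ k * (M + 1)).
have P0 : (0 : R) < 2 ^+ k by rewrite exprn_gt0.
have M10 : 0 < M + 1 by rewrite ltr_wpDl.
have r0 : 0 < r by rewrite divr_gt0// mulr_gt0.
have h1 : CkT_le k e (fun z => r * u z).
  have := Ck_le_mul (@openT R2) (ltW r0) M0 (Ck_le_cst dirs k (@openT R2) (_ : `|r| <= r)) hu.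
  rewrite gtr0_norm// lexx => /(_ isT); apply: Ck_le_mono.
  rewrite /r; have -> : 2 ^+ k * (e / (2 ^+ k * (M + 1)) * M) = e * (M / (M + 1)).
    by field; rewrite !gt_eqF.
  by rewrite ler_piMr ?ltW// ltr_pdivrMr// mul1r ltrDl.
have := Ck_le_mul (@openT R2) (_ : 0 <= r^-1) ler01
  (Ck_le_cst dirs k (@openT R2) (_ : `|r^-1| <= r^-1)) (h _ h1).
rewrite gtr0_norm ?invr_gt0// invr_ge0 (ltW r0) lexx => /(_ isT isT) h2.
eexists; last first.
  apply: Ck_le_eq h2; first exact: openT.
  by move=> z _ /=; rewrite mulKf// gt_eqF.
by rewrite mulr_ge0 ?ltW// mulr1 invr_gt0.
Qed.

Lemma bdd_fam_swap T : bdd_fam T -> bdd_fam (fun e => swap \o T e \o swap).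
Proof.
move=> ST k e; have [M [h1 h2]] := ST k e; exists M.
by split; [exact: Ck_le_swap h2|exact: Ck_le_swap h1].
Qed.

Lemma bdd_fam_shear T a b : smooth_bounded a -> smooth_bounded b -> (forall t, b t = - a t) ->
  bdd_fam T -> bdd_fam (fun e => shear a \o T e \o shear b).
Proof.
move=> Sa Sb ba ST k e; have [M [h1 h2]] := ST k.+1 e.
have [N1 N10 G1] := Ck_le_shear_bdd Sb h1.
have [N2 N20 G2] := Ck_le_shear_bdd Sb h2.
have hw : dCk_le dirs setT k (1 + N2)
    (fun z : R2 => z.2 + (((fun z => (T e z).2 - z.2) \o shear b) z)).
  have [c1 d1] := @dCk_le_snd R k; have [c2 d2] := Ck_le_dCk_le G2.
  split; first by move=> z _; apply: cvgD; [exact: c1|exact: c2].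
  move=> v Dv; have [e1 f1] := d1 v Dv; have [e2 f2] := d2 v Dv.
  split; first by move=> z _; apply: derivableD; [exact: e1|exact: e2].
  apply: Ck_le_eq (Ck_le_add (@openT R2) f1 f2); first exact: openT.
  by move=> z _; rewrite -(deriveD (e1 z I) (e2 z I)).
have [N3 N30 G3] := Ck_le_comp (@openT R2) (addr_ge0 ler01 N20) Sa hw.
have [N4 N40 G4] := Ck_le_comp (@openT R2) ler01 Sa (dCk_le_snd k).
exists (N1 + (N3 + N4) + N2); split; last first.
  by apply: Ck_le_mono (Ck_le_eq _ _ (Ck_leS G2)); [rewrite lerDr !addr_ge0|exact: openT|].
apply: Ck_le_mono (Ck_le_eq _ _ (Ck_le_add (@openT R2) (Ck_leS G1)
   (Ck_le_add (@openT R2) G3 (Ck_le_opp (@openT R2) G4)))).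
- by rewrite lerDl.
- exact: openT.
- by move=> z _ /=; rewrite (addrC z.2) subrK ba; ring.
Qed.

Lemma tame_fam_swap T : tame_fam T -> tame_fam (fun e => swap \o T e \o swap).
Proof. by move=> [h1 h2]; split; [exact: small_fam_swap|exact: bdd_fam_swap]. Qed.

Lemma tame_fam_shear T a b : smooth_bounded a -> smooth_bounded b -> (forall t, b t = - a t) ->
  tame_fam T -> tame_fam (fun e => shear a \o T e \o shear b).
Proof.
by move=> Sa Sb ba [h1 h2]; split; [exact: small_fam_shear|exact: bdd_fam_shear].
Qed.

End SmallFam.

Section TwistSmall.
Context {R : realType}.
Local Notation R2 := (plane R).
Variables (c d : R).
Hypotheses (d0 : 0 < d) (dc : 2 * d < c) (dc1 : c + 2 * d < 1).

(** A neighborhood of the disc on which the coordinates are bounded. *)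
Definition near_disc : set R2 := [set z | `|z.1 - c| < 1] `&` [set z | `|z.2 - c| < 1].

Lemma open_norm_lt (p : R2 -> R) (r : R) : continuous p ->
  open [set w | `|p w - c| < r].
Proof.
move=> cp; apply: (@open_comp _ _ (fun w => `|p w - c|) [set x | x < r]).
  move=> w _; apply: cvg_norm; apply: cvgB; [exact: cp|exact: cvg_cst].
exact: open_lt.
Qed.

Lemma open_near_disc : open near_disc.
Proof.
by apply: openI; apply: open_norm_lt; [exact: fst_cont|exact: snd_cont].
Qed.

Lemma Ck_le_fst_sub k : Ck_le dirs near_disc k 1 (fun z => z.1 - c).
Proof.
have h1 : forall z : R2, {for z, continuous (fun z => z.1 - c)}.
  by move=> z; apply: cvgB; [exact: fst_cont|exact: cvg_cst].
case: k => [|k]; first by split=> // z [/ltW ? _]; split.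
apply: (@Ck_le_intro _ _ _ _ _ _ _ (fun v _ => v.1)).
- exact: open_near_disc.
- by move=> z _.
- by move=> z [/ltW].
- move=> z v _ _; rewrite -[v.1]subr0; apply: is_deriveB; exact: is_derive_fst.
- move=> v Dv; apply: Ck_le_cst; first exact: open_near_disc.
  by case: Dv => ->; rewrite /= ?normr0 ?normr1.
Qed.

Lemma Ck_le_snd_sub k : Ck_le dirs near_disc k 1 (fun z => z.2 - c).
Proof.
have h1 : forall z : R2, {for z, continuous (fun z => z.2 - c)}.
  by move=> z; apply: cvgB; [exact: snd_cont|exact: cvg_cst].
case: k => [|k]; first by split=> // z [_ /ltW ?]; split.
apply: (@Ck_le_intro _ _ _ _ _ _ _ (fun v _ => v.2)).
- exact: open_near_disc.
- by move=> z _.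
- by move=> z [_ /ltW].
- move=> z v _ _; rewrite -[v.2]subr0; apply: is_deriveB; exact: is_derive_snd.
- move=> v Dv; apply: Ck_le_cst; first exact: open_near_disc.
  by case: Dv => ->; rewrite /= ?normr0 ?normr1.
Qed.

Lemma Ck_le_sqdist k : exists2 M, 0 <= M &
  Ck_le dirs near_disc k M (fun z => 4 * d ^+ 2 - sqdist c z).
Proof.
have H1 := Ck_le_mul open_near_disc ler01 ler01 (Ck_le_fst_sub k) (Ck_le_fst_sub k).
have H2 := Ck_le_mul open_near_disc ler01 ler01 (Ck_le_snd_sub k) (Ck_le_snd_sub k).
have H3 := Ck_le_cst dirs k open_near_disc (lexx `|4 * d ^+ 2|).
have H4 := Ck_le_add open_near_disc H3 (Ck_le_opp open_near_disc (Ck_le_add open_near_disc H1 H2)).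
eexists; last by apply: Ck_le_eq H4; [exact: open_near_disc|move=> z _; rewrite /sqdist !expr2].
by rewrite !addr_ge0// mulr_ge0// exprn_ge0.
Qed.

Lemma Ck_le_flat_sqdist k : exists2 M, 0 <= M &
  Ck_le dirs near_disc k M (fun z => flat (4 * d ^+ 2 - sqdist c z)).
Proof.
have [M M0 /Ck_le_dCk_le h] := Ck_le_sqdist k.+1.
exact: Ck_le_comp open_near_disc M0 smooth_bounded_flat h.
Qed.

Lemma Ck_le_angle_small k eta : 0 < eta -> exists2 e0 : R, 0 < e0 &
  forall e : R, `|e| <= e0 -> Ck_le dirs near_disc k eta (twist_angle c d e).
Proof.
move=> eta0; have [M M0 h] := Ck_le_flat_sqdist k.
have P0 : (0 : R) < 2 ^+ k by rewrite exprn_gt0.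
have M10 : 0 < M + 1 by rewrite ltr_wpDl.
exists (eta / (2 ^+ k * (M + 1))); first by rewrite divr_gt0// mulr_gt0.
move=> e he.
apply: Ck_le_mono (Ck_le_mul open_near_disc (normr_ge0 e) M0
  (Ck_le_cst dirs k open_near_disc (lexx _)) h).
move: he; rewrite ler_pdivlMr ?mulr_gt0// => he; apply: le_trans he.
rewrite mulrCA; apply: ler_wpM2l => //; apply: ler_wpM2l; first exact: ltW.
by rewrite lerDl.
Qed.

Lemma Ck_le_comp_angle_small (a : R -> R) k eta : smooth_bounded a -> 0 < eta ->
  exists2 e0 : R, 0 < e0 & forall e : R, `|e| <= e0 ->
    Ck_le dirs near_disc k eta (fun z => a (twist_angle c d e z) - a 0).
Proof.
move=> Sa eta0.
have hw : dCk_le dirs near_disc k 0 (fun _ : R2 => 0 : R).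
  by apply: Ck_le_dCk_le; apply: Ck_le_cst; [exact: open_near_disc|rewrite normr0].
have [e1 e10 h1] := Ck_le_comp_small open_near_disc (lexx 0) Sa hw eta0.
have [e0 e00 h0] := Ck_le_angle_small k e10.
exists e0 => // e /h0/h1; apply: Ck_le_eq; first exact: open_near_disc.
by move=> z _; rewrite add0r.
Qed.

Lemma twist0_small_near k eta : 0 < eta -> exists2 e0 : R, 0 < e0 &
  forall e : R, `|e| <= e0 ->
   Ck_le dirs near_disc k eta (fun z => (twist0 c d e z).1 - z.1) /\
   Ck_le dirs near_disc k eta (fun z => (twist0 c d e z).2 - z.2).
Proof.
move=> eta0; pose eta' := eta / (2 * 2 ^+ k).
have eta'0 : 0 < eta' by rewrite divr_gt0// mulr_gt0// exprn_gt0.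
have [e1 e10 h1] := Ck_le_comp_angle_small k (@smooth_bounded_cos R) eta'0.
have [e2 e20 h2] := Ck_le_comp_angle_small k (@smooth_bounded_sin R) eta'0.
exists (Num.min e1 e2); first by rewrite lt_min e10.
move=> e; rewrite le_min => /andP[/h1 H1 /h2 H2].
have XC := Ck_le_mul open_near_disc ler01 (ltW eta'0) (Ck_le_fst_sub k) H1.
have YS := Ck_le_mul open_near_disc ler01 (ltW eta'0) (Ck_le_snd_sub k) H2.
have XS := Ck_le_mul open_near_disc ler01 (ltW eta'0) (Ck_le_fst_sub k) H2.
have YC := Ck_le_mul open_near_disc ler01 (ltW eta'0) (Ck_le_snd_sub k) H1.
have E : eta = 2 ^+ k * (1 * eta') + 2 ^+ k * (1 * eta').
  by rewrite /eta'; field; rewrite gt_eqF// exprn_gt0.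
rewrite E; split.
  apply: Ck_le_eq (Ck_le_add open_near_disc XC (Ck_le_opp open_near_disc YS));
    first exact: open_near_disc.
  by move=> z _; rewrite /twist0 /rotation /= sin0 cos0; ring.
apply: Ck_le_eq (Ck_le_add open_near_disc XS YC); first exact: open_near_disc.
by move=> z _; rewrite /twist0 /rotation /= sin0 cos0; ring.
Qed.

Lemma open_out : open [set z | 4 * d ^+ 2 < sqdist c z].
Proof.
apply: (@open_comp _ _ (sqdist c) [set x | 4 * d ^+ 2 < x]) => [z _|].
  have h1 : {for z, continuous (fun z : R2 => z.1 - c)}.
    by apply: cvgB; [exact: fst_cont|exact: cvg_cst].
  have h2 : {for z, continuous (fun z : R2 => z.2 - c)}.
    by apply: cvgB; [exact: snd_cont|exact: cvg_cst].
  rewrite /sqdist; under eq_fun do rewrite !expr2.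
  by apply: cvgD; apply: cvgM.
exact: open_gt.
Qed.

Lemma twist0_bdd_near k e : exists2 M : R, 0 <= M &
   Ck_le dirs near_disc k M (fun z => (twist0 c d e z).1 - z.1) /\
   Ck_le dirs near_disc k M (fun z => (twist0 c d e z).2 - z.2).
Proof.
have [N N0 h] := Ck_le_flat_sqdist k.+1.
have ha := Ck_le_dCk_le (Ck_le_mul open_near_disc (normr_ge0 e) N0
  (Ck_le_cst dirs k.+1 open_near_disc (lexx _)) h).
have N10 : 0 <= 2 ^+ k.+1 * (`|e| * N) by rewrite !mulr_ge0// exprn_ge0.
have [M1 M10 H1'] := Ck_le_comp open_near_disc N10 (@smooth_bounded_cos R) ha.
have H1 := Ck_le_add open_near_disc H1' (Ck_le_cst dirs k open_near_disc (lexx `|- 1|)).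
have [M2 M20 H2] := Ck_le_comp open_near_disc N10 (@smooth_bounded_sin R) ha.
have M110 : 0 <= M1 + `|- 1| by rewrite addr_ge0.
have XC := Ck_le_mul open_near_disc ler01 M110 (Ck_le_fst_sub k) H1.
have YS := Ck_le_mul open_near_disc ler01 M20 (Ck_le_snd_sub k) H2.
have XS := Ck_le_mul open_near_disc ler01 M20 (Ck_le_fst_sub k) H2.
have YC := Ck_le_mul open_near_disc ler01 M110 (Ck_le_snd_sub k) H1.
have P0 : (0 : R) <= 2 ^+ k by rewrite exprn_ge0.
exists (2 ^+ k * (1 * (M1 + `|- 1|)) + 2 ^+ k * (1 * M2)).
  by rewrite addr_ge0// mulr_ge0// mul1r.
split.
  apply: Ck_le_eq (Ck_le_add open_near_disc XC (Ck_le_opp open_near_disc YS));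
    first exact: open_near_disc.
  by move=> z _; rewrite /twist0 /rotation /twist_angle /=; ring.
rewrite addrC; apply: Ck_le_eq (Ck_le_add open_near_disc XS YC); first exact: open_near_disc.
by move=> z _; rewrite /twist0 /rotation /twist_angle /=; ring.
Qed.

Lemma twist0_of_near k eta e : 0 <= eta ->
  Ck_le dirs near_disc k eta (fun z => (twist0 c d e z).1 - z.1) ->
  Ck_le dirs near_disc k eta (fun z => (twist0 c d e z).2 - z.2) ->
   Ck_le dirs setT k eta (fun z => (twist0 c d e z).1 - z.1) /\
   Ck_le dirs setT k eta (fun z => (twist0 c d e z).2 - z.2).
Proof.
move=> eta0 h1 h2.
have cover z : near_disc z \/ 4 * d ^+ 2 < sqdist c z.
  have [|h3] := leP (sqdist c z) (4 * d ^+ 2); last by right.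
  move=> h3; left; have hdc := dc; have hdc1 := dc1; have hd0 := d0.
  have hd1 : 4 * d ^+ 2 < 1.
    have : (2 * d) ^+ 2 < 1 by rewrite expr_lt1 ?mulr_ge0 ?ltW//; lra.
    by rewrite exprMn -natrX.
  have H (X Y : R) : X ^+ 2 + Y ^+ 2 <= 4 * d ^+ 2 -> `|X| < 1.
    move=> hXY; rewrite -(@expr_lt1 _ 2)// real_normK ?num_real//.
    by have := sqr_ge0 Y; lra.
  by split; [exact: H h3|apply: (H _ (z.1 - c)); rewrite addrC].
have H (u : R2 -> R) : Ck_le dirs near_disc k eta u ->
    (forall z, 4 * d ^+ 2 <= sqdist c z -> u z = 0) -> Ck_le dirs setT k eta u.
  move=> hu u0; apply: Ck_le_cover => z _; case: (cover z) => hz.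
    by exists near_disc.
  exists [set z | 4 * d ^+ 2 < sqdist c z] => //.
  apply: (@Ck_le_eq _ _ _ _ _ _ (fun=> 0)); first exact: open_out.
    by move=> w /= /ltW /u0.
  by apply: Ck_le_cst; [exact: open_out|rewrite normr0].
by split; apply: H => // z hz; rewrite twist0_out// subrr.
Qed.

Lemma twist_of_near k eta e : 0 <= eta ->
  Ck_le dirs near_disc k eta (fun z => (twist0 c d e z).1 - z.1) ->
  Ck_le dirs near_disc k eta (fun z => (twist0 c d e z).2 - z.2) ->
   Ck_le dirs setT k eta (fun z => (twist c d e z).1 - z.1) /\
   Ck_le dirs setT k eta (fun z => (twist c d e z).2 - z.2).
Proof.
move=> eta0 h1' h2'; have [h1 h2] := twist0_of_near eta0 h1' h2'.
have hdc := dc; have hdc1 := dc1; have hd0 := d0.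
pose kap := Num.min (c - 2 * d) (1 - (c + 2 * d)).
have k0 : 0 < kap by rewrite lt_min; apply/andP; split; lra.
have kl1 : kap <= c - 2 * d by rewrite ge_min lexx.
have kl2 : kap <= 1 - (c + 2 * d) by rewrite ge_min lexx orbT.
have supp (z : R2) : twist0 c d e z <> z ->
    kap <= z.1 <= 1 - kap /\ kap <= z.2 <= 1 - kap.
  move=> hz; have : sqdist c z < 4 * d ^+ 2.
    by rewrite ltNge; apply/negP => /(twist0_out e).
  move/(in_disc d0) => [/andP[a1 a2] /andP[a3 a4]].
  by split; apply/andP; split; lra.
split.
  apply: Ck_le_eq (Ck_le_periodize k0 _ h1); first exact: openT.
    move=> z _.
  change ((twist0 c d e (fracp z)).1 - frac z.1 = (twist c d e z).1 - z.1).
  rewrite /twist; move: (twist0 c d e (fracp z)) => A /=.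
    by rewrite /frac; ring.
  move=> z hz; apply: supp => hz'; move: hz; by rewrite hz' subrr eqxx.
apply: Ck_le_eq (Ck_le_periodize k0 _ h2); first exact: openT.
  move=> z _.
  change ((twist0 c d e (fracp z)).2 - frac z.2 = (twist c d e z).2 - z.2).
  rewrite /twist; move: (twist0 c d e (fracp z)) => A /=.
  by rewrite /frac; ring.
move=> z hz; apply: supp => hz'; move: hz; by rewrite hz' subrr eqxx.
Qed.

Lemma twist_tame : tame_fam (twist c d).
Proof.
split=> [k eta eta0|k e].
  have [e0 e00 h] := twist0_small_near k eta0; exists e0 => // e /h[h1 h2].
  exact: twist_of_near (ltW eta0) h1 h2.
have [M M0 [h1 h2]] := twist0_bdd_near k e; exists M.
exact: twist_of_near M0 h1 h2.
Qed.

End TwistSmall.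

(** * Invariance of the Lebesgue measure *)

Section Meas1.
Context {R : realType}.
Local Notation lam := (@lebesgue_measure R).

Lemma lebesgue_shift (A : set R) (t : R) : measurable A ->
  lam [set x | A (x + t)] = lam A.
Proof.
move=> mA.
pose f : R -> measurableTypeR R := fun x => x + t.
have mf : measurable_fun setT f by exact: measurable_funD.
have E := @lebesgue_measure_unique R (pushforward lam f) _ A mA.
rewrite -/(f @^-1` A) -[LHS]/(pushforward lam f A) E//.
move=> X -[[a b] _ <-].
transitivity (lam `](a - t), (b - t)]%classic).
  rewrite !lebesgue_measure_itv/= !lte_fin ltrD2r.
  by case: ifP => // _; rewrite -!EFinD; congr (_%:E); ring.
rewrite /pushforward; congr (lam _).
by apply/seteqP; split=> x /=; rewrite /f /= !in_itv /= ltrBlDr lerBrDr.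
Qed.

(** The translated unit interval [t, t + 1[ is cut at 1, and the right piece is moved
back by 1. *)
Lemma lebesgue_periodic (A : set R) (t : R) : measurable A ->
  (forall x (n : int), A (x + n%:~R) <-> A x) ->
  lam ([set x | A (x + t)] `&` `[0, 1[) = lam (A `&` `[0, 1[).
Proof.
move=> mA pA.
have -> : [set x | A (x + t)] = [set x | A (x + frac t)].
  apply/seteqP; split => x /=; rewrite -(pA (x + frac t) (Num.floor t)) /frac;
  by rewrite addrA subrK.
have := frac_itv t; move: (frac t) => {}t /andP[t0 t1].
have -> : [set x | A (x + t)] `&` `[0, 1[ =
   [set x | (A `&` `[t, (1 + t)[) (x + t)].
  apply/seteqP; split => x /=; rewrite !in_itv /=.
    by move=> [h /andP[h1 h2]]; split=> //; apply/andP; split; lra.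
  by move=> [h /andP[h1 h2]]; split=> //; apply/andP; split; lra.
rewrite lebesgue_shift; last exact: measurableI.
have -> : A `&` `[t, (1 + t)[ = (A `&` `[t, 1[) `|` (A `&` `[1, (1 + t)[).
  rewrite -setIUr; congr (_ `&` _); apply/seteqP; split => x /=; rewrite !in_itv /=.
    move=> /andP[h1 h2]; case: (ltP x 1) => h3; [left|right]; apply/andP; split; lra.
  by move=> [|] /andP[h1 h2]; apply/andP; split; lra.
have -> : A `&` `[0, 1[ = (A `&` `[t, 1[) `|` (A `&` `[0, t[).
  rewrite -setIUr; congr (_ `&` _); apply/seteqP; split => x /=; rewrite !in_itv /=.
    move=> /andP[h1 h2]; case: (ltP x t) => h3; [right|left]; apply/andP; split; lra.
  by move=> [|] /andP[h1 h2]; apply/andP; split; lra.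
rewrite !measureU//; try exact: measurableI.
- congr (_ + _)%E; rewrite -[LHS](@lebesgue_shift _ 1); last exact: measurableI.
  congr (lam _); apply/seteqP; split => x /=; rewrite !in_itv /= -[1]/(1%:~R) pA.
    by move=> [h /andP[h1 h2]]; split=> //; apply/andP; split; lra.
  by move=> [h /andP[h1 h2]]; split=> //; apply/andP; split; lra.
- apply/seteqP; split => x //= -[[_ h1] [_ h2]]; move: h1 h2; rewrite !in_itv /=.
  by move=> /andP[h1 h2] /andP[h3 h4]; lra.
- apply/seteqP; split => x //= -[[_ h1] [_ h2]]; move: h1 h2; rewrite !in_itv /=.
  by move=> /andP[h1 h2] /andP[h3 h4]; lra.
Qed.

End Meas1.

Section Meas2.
Context {R : realType}.
Local Notation R2 := (plane R).
Local Notation lam := (@lebesgue_measure R).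
Definition area : set R2 -> \bar R := (lam \x lam)%E.
Implicit Types E P : set R2.

Definition borel2 E : Prop := measurable (E : set (measurableTypeR R * measurableTypeR R)).

Lemma area_ysec E E' : borel2 E -> borel2 E' ->
  (forall y, lam [set x | E (x, y)] = lam [set x | E' (x, y)]) -> area E = area E'.
Proof.
move=> mE mE' h; rewrite /area.
have H X : borel2 X -> (lam \x lam)%E X = (lam \x^ lam)%E X.
  by move=> mX; apply: product_measure_unique => // A B mA mB;
    exact: (@product_measure2E _ _ _ _ _ lam lam A B mA mB).
rewrite !H// /product_measure2; apply: eq_integral => y _ /=.
by rewrite !ysectionE; exact: h.
Qed.

Lemma borel2_sec1 E y : borel2 E -> measurable [set x : R | E (x, y)].
Proof. by move=> mE; have := measurable_ysection y mE; rewrite ysectionE. Qed.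

Lemma borel2_cell : borel2 unit_cell.
Proof. by apply: measurableX; exact: measurable_itv. Qed.

(** An open set is the union of the countably many rational boxes that it contains. *)
Lemma borel2_open E : open E -> borel2 E.
Proof.
move=> oE.
pose box (q : rat * rat * nat) : set R2 :=
  `](ratr q.1.1 - q.2.+1%:R^-1), (ratr q.1.1 + q.2.+1%:R^-1)[%classic `*`
  `](ratr q.1.2 - q.2.+1%:R^-1), (ratr q.1.2 + q.2.+1%:R^-1)[%classic.
pose F (q : rat * rat * nat) : set R2 := if `[< box q `<=` E >] then box q else set0.
have -> : E = \bigcup_q F q.
  apply/seteqP; split => [[x y] Exy|z [q _]]; last first.
    by rewrite /F; case: ifPn => // /asboolP; exact.
  have /nbhs_ballP[r /= r0 hr] : nbhs (x, y) E by exact: open_nbhs_nbhs.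
  have [k hk] : exists k : nat, k.+1%:R^-1 < r / 2.
    have r20 : 0 < r / 2 by rewrite divr_gt0.
    have [k _ h] := near_infty_natSinv_lt (PosNum r20).
    by exists k; exact: (h k (leqnn k)).
  have k0 : (0 : R) < k.+1%:R^-1 by rewrite invr_gt0 ltr0n.
  have rq (u : R) : exists q : rat, u - k.+1%:R^-1 < ratr q < u + k.+1%:R^-1.
    have [|q] := @rat_in_itvoo R (u - k.+1%:R^-1) (u + k.+1%:R^-1).
      by rewrite ltrBlDr -addrA ltrDl addr_gt0.
    by rewrite in_itv /=; exists q.
  have [p /andP[p1 p2]] := rq x; have [q /andP[q1 q2]] := rq y.
  exists (p, q, k); first by [].
  rewrite /F ifT.
    move: p1 p2 q1 q2; rewrite /box; move: (k.+1%:R^-1) => w p1 p2 q1 q2.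
    by split; rewrite /= in_itv /=; apply/andP; split; lra.
  apply/asboolP => -[u v] [] /=; rewrite !in_itv /= => /andP[u1 u2] /andP[v1 v2].
  move: hk p1 p2 q1 q2 u1 u2 v1 v2.
  move: (k.+1%:R^-1) => w hk p1 p2 q1 q2 u1 u2 v1 v2.
  by apply: hr; split; rewrite /ball /= ltr_norml; apply/andP; split; lra.
apply: countable_bigcupT_measurable; first exact: countableP.
move=> q; rewrite /F; case: ifP => _; last exact: measurable0.
by apply: measurableX; exact: measurable_itv.
Qed.

Lemma borel2_shear E a : continuous a -> borel2 E -> borel2 (shear a @^-1` E).
Proof.
move=> ca mE.
have ma : measurable_fun setT a by exact: continuous_measurable_fun.
have mS : measurable_fun setT (shear a : measurableTypeR R * measurableTypeR R ->
    measurableTypeR R * measurableTypeR R).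
  apply: measurable_fun_pair; last exact: measurable_snd.
  apply: measurable_funD; first exact: measurable_fst.
  by apply: measurableT_comp => //; exact: measurable_snd.
by have := mS measurableT E mE; rewrite setTI.
Qed.

Lemma borel2_swap E : borel2 E -> borel2 (swap @^-1` E).
Proof.
move=> mE.
have mS : measurable_fun setT (swap : measurableTypeR R * measurableTypeR R ->
    measurableTypeR R * measurableTypeR R).
  by apply: measurable_fun_pair; [exact: measurable_snd|exact: measurable_fst].
by have := mS measurableT E mE; rewrite setTI.
Qed.

Lemma area_swap E : borel2 E -> area (swap @^-1` E) = area E.
Proof.
move=> mE; rewrite /area.
rewrite (@product_measure_unique _ _ _ _ _ lam lam (lam \x^ lam)%E)//.
- by move=> A B mA mB; exact: (@product_measure2E _ _ _ _ _ lam lam A B mA mB).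
- exact: borel2_swap.
Qed.

Lemma area_shear E a : continuous a -> borel2 E -> area (shear a @^-1` E) = area E.
Proof.
move=> ca mE; apply: area_ysec => //; first exact: borel2_shear.
by move=> y; rewrite -[RHS](@lebesgue_shift _ _ (a y))//; exact: borel2_sec1.
Qed.

Definition periodic2 P := forall z v, P (z + int_vec v) <-> P z.

Lemma area_shear_per P a : continuous a -> borel2 P -> periodic2 P ->
  area (shear a @^-1` P `&` unit_cell) = area (P `&` unit_cell).
Proof.
move=> ca mP pP; apply: area_ysec.
- by apply: measurableI; [exact: borel2_shear|exact: borel2_cell].
- by apply: measurableI => //; exact: borel2_cell.
move=> y; have [hy|hy] := boolP (0 <= y < 1); last first.
  congr (lam _); apply/seteqP; split => x [_ /unit_cellE[_ /= h]]; by rewrite h in hy.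
have H (X : set R) (Y : set R2) : (forall x, Y (x, y) <-> X x) ->
   [set x | (Y `&` unit_cell) (x, y)] = X `&` `[0, 1[.
  move=> XY; apply/seteqP; split => x /=; rewrite in_itv /=.
    by move=> [/XY h /unit_cellE[]].
  by move=> [/XY h h1]; split=> //; apply/unit_cellE.
rewrite (H [set x | P (x + a y, y)])//.
rewrite (H [set x | P (x, y)])//.
apply: (@lebesgue_periodic _ [set x | P (x, y)]); first exact: borel2_sec1.
move=> x n /=; have := pP (x, y) (n, 0).
rewrite (_ : (x, y) + _ = (x + n%:~R, y))//.
by congr pair; rewrite /= addr0.
Qed.

End Meas2.

(** * Maps that do not increase areas *)

Section MP.
Context {R : realType}.
Local Notation R2 := (plane R).
Local Notation lam := (@lebesgue_measure R).
Implicit Types E P : set R2.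

(** An inequality on open sets is what survives pointwise limits (area_liminf); the
opposite inequality comes from the inverse map. *)
Definition subpreserving (F : R2 -> R2) := forall P, open P -> periodic2 P ->
  (area (F @^-1` P `&` unit_cell) <= area (P `&` unit_cell))%E.

Definition equivariant (F : R2 -> R2) := forall z v, F (z + int_vec v) = F z + int_vec v.

Lemma open_pre (F : R2 -> R2) P : continuous F -> open P -> open (F @^-1` P).
Proof. by move=> cF oP; apply: open_comp => // z _; exact: cF. Qed.

Lemma periodic2_pre (F : R2 -> R2) P : equivariant F -> periodic2 P ->
  periodic2 (F @^-1` P).
Proof. by move=> eF pP z v; rewrite /preimage /= eF; exact: pP. Qed.

Lemma subpreserving_comp F G : continuous F -> equivariant F ->
  subpreserving F -> subpreserving G ->
  subpreserving (F \o G).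
Proof.
move=> cF eF mF mG P oP pP; rewrite comp_preimage.
apply: le_trans (mG _ (open_pre cF oP) (periodic2_pre eF pP)) _.
exact: mF.
Qed.

Lemma subpreserving_shear a : continuous a -> subpreserving (shear a).
Proof. by move=> ca P oP pP; rewrite area_shear_per//; exact: borel2_open. Qed.

Lemma swap_cell (z : R2) : unit_cell (swap z) <-> unit_cell z.
Proof. by split=> /unit_cellE[h1 h2]; apply/unit_cellE. Qed.

Lemma subpreserving_vshear a : continuous a -> subpreserving (swap \o shear a \o swap).
Proof.
move=> ca P oP pP.
have oP' : open (swap @^-1` P) by apply: open_pre => //; exact: swap_cont.
have pP' : periodic2 (swap @^-1` P).
  by move=> [x y] [m n]; exact: (pP (y, x) (n, m)).
have -> : (swap \o shear a \o swap) @^-1` P `&` unit_cell =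
   swap @^-1` (shear a @^-1` (swap @^-1` P) `&` unit_cell).
  by apply/seteqP; split => z [h1 h2]; split => //; exact/swap_cell.
have mS := borel2_shear ca (borel2_open oP').
rewrite area_swap; last by apply: measurableI => //; exact: borel2_cell.
rewrite area_shear_per//; last exact: borel2_open.
rewrite -[in leRHS]area_swap; last by apply: measurableI; [exact: borel2_open|exact: borel2_cell].
rewrite le_eqVlt; apply/orP; left; apply/eqP; congr (area _).
by apply/seteqP; split => z [h1 h2]; split => //; exact/swap_cell.
Qed.

Lemma le_area E E' : borel2 E -> borel2 E' -> E `<=` E' -> (area E <= area E')%E.
Proof. by move=> mE mE' EE; apply: le_measure => //; rewrite inE. Qed.

(** Fatou's lemma for indicator functions. *)
Lemma area_liminf (A : set R2) (B : nat -> set R2) c :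
  borel2 A -> (forall n, borel2 (B n)) -> (forall n, (area (B n) <= c)%E) ->
  (forall z, A z -> \forall n \near \oo, B n z) -> (area A <= c)%E.
Proof.
move=> mA mB Bc AB.
pose E N := \bigcap_(n in [set n | (N <= n)%N]) B n.
have mE N : borel2 (E N).
  by apply: bigcap_measurable => [|k _]; [exists N => /=; exact: leqnn|exact: mB].
have mU : borel2 (\bigcup_N E N) by apply: bigcup_measurable => N _; exact: mE.
have AE : A `<=` \bigcup_N E N.
  by move=> z /AB[N _ hN]; exists N => // n /= Nn; exact: hN.
apply: (le_trans (le_area mA mU AE)).
have ndE : nondecreasing_seq E.
  move=> m n mn; apply/subsetPset => z Em k /= nk; apply: Em => /=.
  exact: leq_trans nk.
have C := @nondecreasing_cvg_mu _ _ _ (lam \x lam)%E E mE mU ndE.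
rewrite -[area _](cvg_lim _ C)//; apply: lime_le.
  by apply/cvg_ex; eexists; exact: C.
near=> N; apply: le_trans (Bc N); apply: le_area => // z; apply => /=.
exact: leqnn.
Unshelve. all: by end_near. Qed.

Lemma area_bigcup_le (K : countType) (C D : K -> set R2) :
  (forall k, borel2 (C k)) -> (forall k, borel2 (D k)) -> trivIset setT D ->
  (forall k, area (C k) = area (D k)) -> (area (\bigcup_k C k) <= area (\bigcup_k D k))%E.
Proof.
move=> mC mD tD CD.
(* Reindexing by nat, where sigma-additivity is available. *)
pose G (X : K -> set R2) (i : nat) : set R2 := if pickle_inv i is Some k then X k else set0.
have GE X : \bigcup_k X k = \bigcup_i G X i.
  apply/seteqP; split => z [k _ h].
    by exists (pickle k) => //; rewrite /G pickleK_inv.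
  by move: h; rewrite /G; case: pickle_inv => // k' h; exists k'.
have mG X : (forall k, borel2 (X k)) -> forall i, borel2 (G X i).
  by move=> mX i; rewrite /G; case: pickle_inv => // ; exact: measurable0.
have tG : trivIset setT (G D).
  move=> i j _ _ [z []]; rewrite /G.
  have := @pickle_invK K i; have := @pickle_invK K j.
  case: (@pickle_inv K i) => // k; case: (@pickle_inv K j) => // k' /= <- <- h1 h2.
  by congr pickle; apply: tD => //; exists z.
rewrite !GE.
have m1 : borel2 (\bigcup_i G C i) by apply: bigcup_measurable => i _; exact: mG.
have -> : area (\bigcup_i G D i) = (\sum_(i <oo) area (G D i))%E.
  rewrite /area (measure_bigcup (lam \x lam)%E)//; last by move=> i _; exact: mG.
  by apply: eq_eseriesl => i; rewrite in_setT.
have -> : (\sum_(i <oo) area (G D i) = \sum_(i <oo) area (G C i))%E.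
  apply: eq_eseriesr => i _; rewrite /G; case: pickle_inv => [k|//].
  exact/esym/CD.
apply: (@measure_sigma_subadditive _ _ _ (lam \x lam)%E) => //.
by move=> i; exact: mG.
Qed.

Variables (c d : R).
Hypotheses (d0 : 0 < d) (dc : 2 * d < c) (dc1 : c + 2 * d < 1).

(** With t the tangent of half the angle, the linear map is the product of the
horizontal shear by - t, the vertical shear by the sine, and the first one
again. *)
Lemma rotation_shears phi : 0 < 1 + cos phi ->
  let t := sin phi / (1 + cos phi) in
  rotation c phi = shear (fun y => - t * (y - c)) \o
    (swap \o shear (fun x => sin phi * (x - c)) \o swap) \o
    shear (fun y => - t * (y - c)).
Proof.
move=> C0 t; apply/funext => -[x y].
rewrite /rotation /shear /swap /=.
have := cos2Dsin2 phi; rewrite /t.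
move: C0; set C := cos phi; set s := sin phi => C0 h.
have C1 : 1 + C != 0 by rewrite gt_eqF.
have ts : s / (1 + C) * s = 1 - C.
  have -> : s / (1 + C) * s = s ^+ 2 / (1 + C) by rewrite expr2; ring.
  have -> : s ^+ 2 = 1 - C ^+ 2 by rewrite -h; ring.
    have -> : 1 - C ^+ 2 = (1 - C) * (1 + C) by ring.
  by rewrite mulfK.
have tC : s / (1 + C) * (1 + C) = s by rewrite divfK.
move: ts tC; move: (s / (1 + C)) => {}t ts tC.
congr pair.
  transitivity (x - (t * s) * (x - c) - t * (1 + C) * (y - c)).
    by rewrite ts tC; ring.
  have -> : t * (1 + C) = 2 * t - t * (t * s) by rewrite ts; ring.
  ring.
transitivity (y + s * (x - c) - (t * s) * (y - c)); last by ring.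
by rewrite ts; ring.
Qed.

Lemma area_rotation_small phi E : 0 < 1 + cos phi -> borel2 E ->
  borel2 (rotation c phi @^-1` E) /\ area (rotation c phi @^-1` E) = area E.
Proof.
move=> /rotation_shears/= -> mE.
have ca (k : R) : continuous (fun y : R => k * (y - c)).
  move=> y; apply: cvgM; first exact: cvg_cst.
  by apply: cvgB; [exact: cvg_id|exact: cvg_cst].
rewrite !comp_preimage.
have m1 := borel2_shear (ca _) mE.
have m2 k := borel2_shear (ca k) (borel2_swap (m1 (- (sin phi / (1 + cos phi))))).
have m3 k := borel2_swap (m2 k).
split; first exact: borel2_shear.
rewrite (area_shear (ca _) (m3 _)) (area_swap (m2 _)).
by rewrite (area_shear (ca _) (borel2_swap (m1 _))) (area_swap (m1 _)) (area_shear (ca _) mE).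
Qed.

(** The decomposition into shears breaks down at angle pi, so the rotation is first
written as a power of a rotation by a small angle. *)
Lemma area_rotation phi E : borel2 E ->
  borel2 (rotation c phi @^-1` E) /\ area (rotation c phi @^-1` E) = area E.
Proof.
move=> mE.
have cos_near : exists2 r : R, 0 < r & forall x, `|x| < r -> 0 < 1 + cos x.
  have : {for (0 : R), continuous (@cos R)} by exact: continuous_cos.
  rewrite /prop_for /continuous_at cos0 => /cvgr_dist_lt/(_ 1 ltr01).
  move=> /nbhs_ballP[r /= r0 h]; exists r => // x xr.
  have := h x; rewrite /ball /= sub0r normrN => /(_ xr).
  by rewrite ltr_norml => /andP[h1 h2]; lra.
have [r r0 hr] := cos_near.
pose n := (Num.trunc (`|phi| / r)).+1.
pose psi := phi / n%:R.
have n0 : (0 : R) < n%:R by rewrite ltr0n.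
have hpsi : 0 < 1 + cos psi.
  apply: hr; rewrite normrM normfV (gtr0_norm n0) ltr_pdivrMr//.
  by rewrite mulrC -ltr_pdivrMr// /n; exact: truncnS_gt.
have -> : phi = psi * n%:R by rewrite divfK// gt_eqF.
elim: n {n0 hpsi psi} (psi) hpsi => [|n IH] psi hpsi.
  rewrite mulr0 (_ : rotation c 0 @^-1` E = E)//.
  by apply/seteqP; split => z; rewrite /preimage /= rotation0.
have -> : rotation c (psi * n.+1%:R) = rotation c (psi * n%:R) \o rotation c psi.
  by apply/funext => z /=; rewrite rotationD mulrSr mulrDr mulr1.
rewrite comp_preimage; have [h1 h2] := IH _ hpsi.
have [h3 h4] := area_rotation_small hpsi h1.
by split; [exact: h3|rewrite h4; exact: h2].
Qed.

Lemma twist_angle_cont e : continuous (twist_angle c d e).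
Proof.
move=> z; rewrite /twist_angle.
have h1 : {for z, continuous (fun z : R2 => z.1 - c)}.
  by apply: cvgB; [exact: fst_cont|exact: cvg_cst].
have h2 : {for z, continuous (fun z : R2 => z.2 - c)}.
  by apply: cvgB; [exact: snd_cont|exact: cvg_cst].
apply: cvgM; first exact: cvg_cst.
apply: (@continuous_comp _ _ _ (fun z => 4 * d ^+ 2 - sqdist c z) flat); last first.
  exact: (smooth_bounded_cont smooth_bounded_flat).
apply: cvgB; first exact: cvg_cst.
rewrite /sqdist; under eq_fun do rewrite !expr2.
by apply: cvgD; apply: cvgM.
Qed.

Lemma twist0_cont e : continuous (twist0 c d e).
Proof.
move=> z; have ca := @twist_angle_cont e z.
have h1 : {for z, continuous (fun z : R2 => z.1 - c)}.
  by apply: cvgB; [exact: fst_cont|exact: cvg_cst].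
have h2 : {for z, continuous (fun z : R2 => z.2 - c)}.
  by apply: cvgB; [exact: snd_cont|exact: cvg_cst].
have ccos : {for z, continuous (cos \o twist_angle c d e)}.
  by apply: continuous_comp => //; exact: continuous_cos.
have cs : {for z, continuous (sin \o twist_angle c d e)}.
  by apply: continuous_comp => //; exact: continuous_sin.
apply: (@pair_cont _ _
  (fun z => c + ((z.1 - c) * cos (twist_angle c d e z) - (z.2 - c) * sin (twist_angle c d e z)))
  (fun z => c + ((z.1 - c) * sin (twist_angle c d e z) + (z.2 - c) * cos (twist_angle c d e z)))).
  by apply: cvgD; [exact: cvg_cst|apply: cvgB; apply: cvgM].
by apply: cvgD; [exact: cvg_cst|apply: cvgD; apply: cvgM].
Qed.

(** Rounding the angle down to a multiple of 1 / n.+1 gives a map that rotates by a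
constant angle on each of countably many pieces, which it preserves; it
preserves areas, and tends to the twist as n grows. *)
Lemma subpreserving_twist e : subpreserving (twist c d e).
Proof.
move=> P oP pP.
have mPQ : borel2 (P `&` unit_cell) by apply: measurableI; [exact: borel2_open|exact: borel2_cell].
pose A (n : nat) (k : int) : set R2 := [set z | Num.floor (n.+1%:R * twist_angle c d e z) = k].
have mA n k : borel2 (A n k).
  have -> : A n k = ~` [set z | n.+1%:R * twist_angle c d e z < k%:~R] `&`
                    [set z | n.+1%:R * twist_angle c d e z < (k + 1)%:~R].
    apply/seteqP; split => z; rewrite /A /=.
      by move=> <-; split; [apply/negP; rewrite -leNgt floor_le_tmp|rewrite floorD1_gt].
    by move=> [/negP]; rewrite -leNgt => h1 h2; apply: floor_def; rewrite h1 h2.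
  have co (x : R) : borel2 [set z | n.+1%:R * twist_angle c d e z < x].
    apply: borel2_open.
    apply: (@open_comp _ _ (fun z => n.+1%:R * twist_angle c d e z) [set y | y < x]).
      by move=> z _; apply: cvgM; [exact: cvg_cst|exact: twist_angle_cont].
    exact: open_lt.
  by apply: measurableI; [exact: (measurableC (co _))|exact: co].
(* The approximation of the twist by rotations with rounded angles. *)
pose r (n : nat) z := rotation c ((Num.floor (n.+1%:R * twist_angle c d e z))%:~R / n.+1%:R) z.
pose B (n : nat) : set R2 := [set z | P (r n z)] `&` unit_cell.
pose C n k := rotation c (k%:~R / n.+1%:R) @^-1` (P `&` unit_cell `&` A n k).
have Arot n k phi z : A n k (rotation c phi z) <-> A n k z by rewrite /A /= twist_angle_rotation.
have Qrot n k z : A n k z -> unit_cell (rotation c (k%:~R / n.+1%:R) z) <-> unit_cell z.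
  move=> Az; have [k0|k0] := eqVneq k 0; first by rewrite k0 mul0r rotation0.
  have : sqdist c z < 4 * d ^+ 2.
    rewrite ltNge; apply/negP => h; move: Az k0; rewrite /A /= /twist_angle flat_le0 ?subr_le0//.
    by rewrite !mulr0 floor0 => <-; rewrite eqxx.
  move=> h; split => _; first exact: (disc_cell d0 dc dc1 h).
  by apply: (disc_cell d0 dc dc1); rewrite sqdist_rotation.
have BC n : B n = \bigcup_k C n k.
  apply/seteqP; split => z.
    move=> [h1 h2]; exists (Num.floor (n.+1%:R * twist_angle c d e z)) => //.
    by split; [split=> //; exact/Qrot|exact/Arot].
  move=> [k _ [[h1 h2] /Arot h3]]; split; last exact/(Qrot _ _ _ h3).
  by rewrite /= /r h3.
have tA n (X : set R2) : trivIset setT (fun k => X `&` A n k).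
  by move=> i j _ _ [z [[_ h1] [_ h2]]]; rewrite -h1 -h2.
have mPA n k : borel2 (P `&` unit_cell `&` A n k) by exact: (measurableI _ _ mPQ (mA n k)).
have mC n k : borel2 (C n k) by exact: (area_rotation _ (mPA n k)).1.
have leB n : (area (B n) <= area (P `&` unit_cell))%E.
  have -> : P `&` unit_cell = \bigcup_k (P `&` unit_cell `&` A n k).
    apply/seteqP; split => z; last by move=> [k _ []].
    by move=> h; exists (Num.floor (n.+1%:R * twist_angle c d e z)).
  rewrite BC; apply: (@area_bigcup_le int (C n) (fun k => P `&` unit_cell `&` A n k)).
  - exact: mC.
  - exact: mPA.
  - exact: tA.
  - by move=> k; exact: (area_rotation _ (mPA n k)).2.
apply: (@area_liminf _ B) => //.
- have -> : twist c d e @^-1` P `&` unit_cell = twist0 c d e @^-1` P `&` unit_cell.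
    by apply/seteqP; split => z [h1 h2]; split => //; move: h1; rewrite /preimage /= twist_cell.
  apply: measurableI; last exact: borel2_cell.
  apply: borel2_open; apply: open_pre => //; exact: twist0_cont.
- by move=> n; rewrite BC; apply: countable_bigcupT_measurable; [exact: countableP|exact: mC].
- move=> z [h1 h2].
  have hz : P (rotation c (twist_angle c d e z) z) by move: h1; rewrite /preimage /= twist_cell.
  have cr : {for twist_angle c d e z, continuous (fun phi => rotation c phi z)}.
    have ccos (x : R) : {for x, continuous (@cos R)} by exact: continuous_cos.
    have cs (x : R) : {for x, continuous (@sin R)} by exact: continuous_sin.
    apply: (@pair_cont _ _
      (fun phi => c + ((z.1 - c) * cos phi - (z.2 - c) * sin phi))
      (fun phi => c + ((z.1 - c) * sin phi + (z.2 - c) * cos phi))).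
      by apply: cvgD; [exact: cvg_cst|apply: cvgB; apply: cvgM; try exact: cvg_cst;
        [exact: ccos|exact: cs]].
    by apply: cvgD; [exact: cvg_cst|apply: cvgD; apply: cvgM; try exact: cvg_cst;
        [exact: cs|exact: ccos]].
  have : \forall phi \near twist_angle c d e z, P (rotation c phi z).
    by apply: cr; exact: open_nbhs_nbhs.
  move=> /nbhs_ballP[rr /= rr0 hrr].
  have [N _ hN] := near_infty_natSinv_lt (PosNum rr0).
  exists N => // n /= Nn; split=> //; rewrite /= /r; apply: hrr; rewrite /ball /=.
  apply: le_lt_trans (hN n Nn) => /=.
  have n0 : (0 : R) < n.+1%:R by rewrite ltr0n.
  set a := twist_angle c d e z; have := floor_itv (n.+1%:R * a); rewrite intrD => /andP[f1 f2].
  rewrite -(@ler_pM2l _ n.+1%:R)// mulfV ?gt_eqF// -{1}(gtr0_norm n0) -normrM mulrBr.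
  rewrite [n.+1%:R * (_ / _)]mulrC divfK ?gt_eqF// ler_norml.
  by apply/andP; split; lra.
Qed.

End MP.

(** * Coordinate changes of the torus *)

Section TorusCoord.
Context {R : realType}.
Local Notation R2 := (plane R).
Implicit Types (g h gi hi : R2 -> R2) (z w : R2).

(** What is required from a change of coordinates so that all the properties of
twists pass to their conjugates.  The coarse bound is stable by composition,
which makes the conjugate of a map with bounded displacement have bounded
displacement; the Lipschitz bound tells how precisely an orbit must be
followed before the change of coordinates. *)
Record torus_coord g gi : Prop := TorusCoord {
  torus_coordVK : cancel gi g;
  torus_coordK : cancel g gi;
  torus_coord_equivariant : equivariant g;
  torus_coord_cont : continuous g;
  torus_coordV_cont : continuous gi;
  torus_coord_subpreserving : subpreserving g;
  torus_coordV_subpreserving : subpreserving gi;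
  torus_coord_coarse : exists D : R, forall z w, `|g z - g w| <= `|z - w| + D;
  torus_coord_lipschitz : exists2 L : R, 0 <= L & forall z w, `|g z - g w| <= L * `|z - w|;
  torus_coord_tame : forall T, tame_fam T -> tame_fam (fun e => g \o T e \o gi) }.

Lemma torus_coordV_equivariant g gi : torus_coord g gi -> equivariant gi.
Proof.
move=> G z v; apply: (can_inj (torus_coordK G)).
by rewrite (torus_coord_equivariant G) !(torus_coordVK G).
Qed.

Lemma torus_coord_id : torus_coord id id.
Proof.
split=> //.
- by move=> z; exact: cvg_id.
- by move=> z; exact: cvg_id.
- by exists 0 => z w; rewrite addr0.
- by exists 1 => // z w; rewrite mul1r.
Qed.

Lemma torus_coord_comp g gi h hi : torus_coord g gi -> torus_coord h hi ->
  torus_coord (g \o h) (hi \o gi).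
Proof.
move=> G H; split.
- by move=> z /=; rewrite (torus_coordVK H) (torus_coordVK G).
- by move=> z /=; rewrite (torus_coordK G) (torus_coordK H).
- by move=> z v /=; rewrite (torus_coord_equivariant H) (torus_coord_equivariant G).
- by move=> z; apply: continuous_comp; [exact: torus_coord_cont H _|exact: torus_coord_cont G _].
- by move=> z; apply: continuous_comp; [exact: torus_coordV_cont G _|exact: torus_coordV_cont H _].
- apply: subpreserving_comp; [exact: torus_coord_cont G| | |].
  + exact: torus_coord_equivariant G.
  + exact: torus_coord_subpreserving G.
  + exact: torus_coord_subpreserving H.
- apply: subpreserving_comp; [exact: torus_coordV_cont H| | |].
  + exact: torus_coordV_equivariant H.
  + exact: torus_coordV_subpreserving H.
  + exact: torus_coordV_subpreserving G.
- have [D1 h1] := torus_coord_coarse G; have [D2 h2] := torus_coord_coarse H;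
    exists (D2 + D1) => z w /=.
  by rewrite (le_trans (h1 _ _))// addrA lerD2r.
- have [L1 l1 h1] := torus_coord_lipschitz G; have [L2 l2 h2] := torus_coord_lipschitz H;
    exists (L1 * L2).
    exact: mulr_ge0.
  by move=> z w /=; rewrite (le_trans (h1 _ _))// -mulrA ler_wpM2l.
- by move=> T /(torus_coord_tame H)/(torus_coord_tame G).
Qed.

Lemma norm_pair_le (z : R2) (r : R) : (`|z| <= r) = (`|z.1| <= r) && (`|z.2| <= r).
Proof. by rewrite prod_normE ge_max. Qed.

Lemma norm_fst_le z : `|z.1| <= `|z|.
Proof. by have := lexx `|z|; rewrite norm_pair_le => /andP[]. Qed.

Lemma norm_snd_le z : `|z.2| <= `|z|.
Proof. by have := lexx `|z|; rewrite norm_pair_le => /andP[]. Qed.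

Lemma norm_swap z : `|swap z| = `|z|.
Proof. by rewrite !prod_normE /= maxC. Qed.

Lemma swapB z w : swap z - swap w = swap (z - w).
Proof. by []. Qed.

Section GoodShear.
Variable a : R -> R.
Hypotheses (Sa : smooth_bounded a) (pa : forall t (n : int), a (t + n%:~R) = a t).

Let b t := - a t.

Let Sb : smooth_bounded b.
Proof.
have := smooth_bounded_scale (-1) Sa; rewrite /b.
by under eq_fun do rewrite mulN1r.
Qed.

Lemma shearK : cancel (shear a) (shear b).
Proof. by case=> x y; rewrite /shear /b /= addrK. Qed.

Lemma shearVK : cancel (shear b) (shear a).
Proof. by case=> x y; rewrite /shear /b /= subrK. Qed.

Lemma shear_equivariant : equivariant (shear a).
Proof. by move=> [x y] [m n]; rewrite /shear /int_vec /= pa; congr pair => /=; ring. Qed.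

Lemma shear_coarse : exists D : R, forall z w, `|shear a z - shear a w| <= `|z - w| + D.
Proof.
have [M M0 hM] := smooth_bounded_bnd Sa; exists (2 * M) => z w.
rewrite norm_pair_le; apply/andP; split; last first.
  by rewrite (le_trans (norm_snd_le (z - w)))// lerDl mulr_ge0.
have -> : (shear a z - shear a w).1 = (z - w).1 + (a z.2 - a w.2) by rewrite /=; ring.
rewrite (le_trans (ler_normD _ _))// lerD ?norm_fst_le//.
by rewrite (le_trans (ler_normB _ _))// mulr_natl mulr2n lerD.
Qed.

Lemma shear_lip : exists2 L : R, 0 <= L &
  forall z w, `|shear a z - shear a w| <= L * `|z - w|.
Proof.
have [M M0 hM] := smooth_bounded_lip Sa; exists (1 + M); first exact: addr_ge0.
move=> z w; rewrite norm_pair_le; apply/andP; split; last first.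
  by rewrite (le_trans (norm_snd_le (z - w)))// mulrDl mul1r lerDl mulr_ge0.
have -> : (shear a z - shear a w).1 = (z - w).1 + (a z.2 - a w.2) by rewrite /=; ring.
rewrite (le_trans (ler_normD _ _))// mulrDl mul1r lerD ?norm_fst_le//.
by rewrite (le_trans (hM _ _))// ler_wpM2l// (norm_snd_le (z - w)).
Qed.

Lemma torus_coord_shear : torus_coord (shear a) (shear b).
Proof.
split.
- exact: shearVK.
- exact: shearK.
- exact: shear_equivariant.
- exact/shear_cont/smooth_bounded_cont.
- exact/shear_cont/smooth_bounded_cont.
- exact/subpreserving_shear/smooth_bounded_cont.
- exact/subpreserving_shear/smooth_bounded_cont.
- exact: shear_coarse.
- exact: shear_lip.
- by move=> T; exact: tame_fam_shear.
Qed.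

Lemma torus_coord_vshear : torus_coord (swap \o shear a \o swap) (swap \o shear b \o swap).
Proof.
have sc (k : R -> R) : smooth_bounded k -> continuous (swap \o shear k \o swap).
  move=> Sk z; apply: (@continuous_comp _ _ _ swap (swap \o shear k)); first exact: swap_cont.
  apply: continuous_comp; last exact: swap_cont.
  exact/shear_cont/smooth_bounded_cont.
split.
- by move=> z /=; rewrite swapK shearVK swapK.
- by move=> z /=; rewrite swapK shearK swapK.
- move=> z v.
  have -> : (swap \o shear a \o swap) (z + int_vec v) =
     swap (shear a (swap z + int_vec (v.2, v.1))) by [].
  by rewrite shear_equivariant.
- exact: sc.
- exact: sc.
- exact/subpreserving_vshear/smooth_bounded_cont.
- exact/subpreserving_vshear/smooth_bounded_cont.
- have [D hD] := shear_coarse; exists D => z w /=.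
  by rewrite swapB norm_swap (le_trans (hD _ _))// swapB norm_swap.
- have [L L0 hL] := shear_lip; exists L => // z w /=.
  by rewrite swapB norm_swap (le_trans (hL _ _))// swapB norm_swap.
- move=> T hT.
  exact: (tame_fam_swap (tame_fam_shear Sa Sb (fun=> erefl) (tame_fam_swap hT))).
Qed.

End GoodShear.
End TorusCoord.

(** * Discs and tubes *)

Section Param.
Context {R : realType}.
Local Notation R2 := (plane R).
Implicit Types (m n : nat) (z w : R2) (t e : R).

(** The n-th disc has center (c_n, c_n), with c_n = 8 r_n, and radius 2 r_n.  So its
projections lie in ]6 r_n, 10 r_n[, and these intervals are pairwise disjoint
as r_n is halved at each step. *)
Definition disc_r n : R := 2^-1 ^+ (n + 4).
Definition disc_c n : R := 8 * disc_r n.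

Lemma disc_r_gt0 n : 0 < disc_r n.
Proof. by rewrite exprn_gt0// invr_gt0. Qed.

Lemma disc_rS n : disc_r n = 2 * disc_r n.+1.
Proof. by rewrite /disc_r addSn exprS mulrA mulfV ?mul1r. Qed.

Lemma disc_r_le m n : (m <= n)%N -> disc_r n <= disc_r m.
Proof.
move=> mn; rewrite /disc_r ler_wiXn2l ?leq_add2r//; lra.
Qed.

Lemma disc_r_lt m n : (m < n)%N -> 2 * disc_r n <= disc_r m.
Proof. by move=> mn; rewrite (disc_rS m) ler_pM2l// disc_r_le. Qed.

Lemma disc_r_le16 n : 16 * disc_r n <= 1.
Proof.
have := @disc_r_le 0 n (leq0n n); rewrite /disc_r add0n => h.
have : (2^-1 : R) ^+ 4 = 16^-1 by rewrite exprVn -natrX.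
by move: h; set x := _ ^+ (n + 4); lra.
Qed.

Lemma disc_c_gt n : 2 * disc_r n < disc_c n.
Proof. by have := disc_r_gt0 n; rewrite /disc_c; lra. Qed.

Lemma disc_c_lt n : disc_c n + 2 * disc_r n < 1.
Proof. by have := disc_r_gt0 n; have := disc_r_le16 n; rewrite /disc_c; lra. Qed.

(** A function of period 1 with value n at c_n, which vanishes at distance at least
r_n from c_n modulo 1. *)
Definition wave n t : R := n%:R / flat (1 - cos (2 * pi * disc_r n)) *
  flat (cos (2 * pi * (t - disc_c n)) - cos (2 * pi * disc_r n)).

Lemma wave_smooth n : smooth_bounded (wave n).
Proof.
apply: smooth_bounded_scale.
apply: (@smooth_bounded_comp _ flat
  (fun t => cos (2 * pi * (t - disc_c n)) - cos (2 * pi * disc_r n))).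
  exact: smooth_bounded_flat.
apply: (@smooth_bounded_add _ (fun t => cos (2 * pi * (t - disc_c n)))
  (fun=> - cos (2 * pi * disc_r n))); last exact: smooth_bounded_cst.
have := smooth_bounded_affine (2 * pi) (- (2 * pi * disc_c n)) (@smooth_bounded_cos R).
by under eq_fun do rewrite -mulrBr.
Qed.

Lemma wave_periodic n t (k : int) : wave n (t + k%:~R) = wave n t.
Proof.
rewrite /wave; congr (_ * flat (_ - _)).
have cper (x : R) (j : nat) : cos (x + 2 * pi * j%:R) = cos x.
  have := @periodicn _ _ (@cos R) _ (@cosD2pi R) j x => <-.
  by congr (cos (x + _)); rewrite -mulrA mulr_natl mulr_natr mulrnAC.
case: k => j.
  by rewrite -(cper (2 * pi * (t - disc_c n)) j); congr cos; rewrite -pmulrn; ring.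
rewrite -(cper (2 * pi * (t + (Negz j)%:~R - disc_c n)) j.+1); congr cos.
by rewrite NegzE mulrNz -pmulrn; ring.
Qed.

Lemma cos2pi_lt (x y : R) : 0 <= x -> x < y -> y <= 2^-1 ->
  cos (2 * pi * y) < cos (2 * pi * x).
Proof.
move=> x0 xy y1; have p0 := pi_gt0 R.
have h (u : R) : 0 <= u -> u <= 2^-1 -> 2 * pi * u \in `[0, pi].
  move=> u0 u1; rewrite in_itv /=; apply/andP; split.
    by rewrite !mulr_ge0// ltW.
  by rewrite mulrAC ler_piMl ?(ltW p0)//; lra.
rewrite ltr_cos; first by rewrite ltr_pM2l// mulr_gt0.
  by apply: h; lra.
by apply: h; lra.
Qed.

Lemma wave_den_gt0 n : 0 < flat (1 - cos (2 * pi * disc_r n)).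
Proof.
apply: flat_gt0; rewrite subr_gt0.
have := @cos2pi_lt 0 (disc_r n) (lexx 0) (disc_r_gt0 n); rewrite mulr0 cos0; apply.
by have := disc_r_le16 n; have := disc_r_gt0 n; lra.
Qed.

Lemma wave_out n t :
  disc_r n <= t - disc_c n <= 1 - disc_r n \/
  disc_r n <= disc_c n - t <= 1 - disc_r n ->
  wave n t = 0.
Proof.
have H x : disc_r n <= x <= 1 - disc_r n -> cos (2 * pi * x) <= cos (2 * pi * disc_r n).
  move=> /andP[h1 h2]; have d0 := disc_r_gt0 n.
  have [h|h] := leP x 2^-1.
    move: h1; rewrite le_eqVlt => /orP[/eqP -> //|h1].
    by apply/ltW/cos2pi_lt => //; exact: ltW.
  have -> : cos (2 * pi * x) = cos (2 * pi * (1 - x)).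
    rewrite -[RHS]cosN -[RHS](@cosD2pi R); congr cos.
    by rewrite -[pi *+ 2]mulr_natl; ring.
  have : disc_r n <= 1 - x by lra.
  rewrite le_eqVlt => /orP[/eqP -> //|h3].
  by apply/ltW/cos2pi_lt => //; [exact: ltW|lra].
move=> h; rewrite /wave [X in _ * X]flat_le0 ?mulr0// subr_le0.
case: h => [/H//|/H]; rewrite -[disc_c n - t]opprB mulrN cosN//.
Qed.

Lemma wave_center n : wave n (disc_c n) = n%:R.
Proof. by rewrite /wave subrr mulr0 cos0 divfK// gt_eqF// wave_den_gt0. Qed.

Lemma wave_edge n : wave n (disc_c n + disc_r n) = 0.
Proof.
apply: wave_out; left; rewrite (addrC (disc_c n)) addrK lexx /=.
by have := disc_r_le16 n; have := disc_r_gt0 n; lra.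
Qed.

Definition slot n t := 6 * disc_r n < t < 10 * disc_r n.

Lemma wave_slot m n t : m <> n -> slot m t -> wave n t = 0.
Proof.
move=> mn /andP[h1 h2]; apply: wave_out; rewrite /disc_c.
have dm := disc_r_gt0 m; have dn := disc_r_gt0 n.
have dm1 := disc_r_le16 m; have dn1 := disc_r_le16 n.
have [h|h|//] := ltngtP m n.
  by left; have h3 := disc_r_lt h; apply/andP; split; lra.
by right; have h3 := disc_r_lt h; apply/andP; split; lra.
Qed.

Lemma slot_disj m n t : slot m t -> slot n t -> m = n.
Proof.
move=> /andP[h1 h2] /andP[h3 h4].
have dm := disc_r_gt0 m; have dn := disc_r_gt0 n.
by have [h|h|//] := ltngtP m n; have h5 := disc_r_lt h; exfalso; lra.
Qed.

(** Fixes all the discs but the n-th one.  In that disc, the horizontal shear spreads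
a vertical arc over the columns 0, ..., n of unit squares, and the vertical
shear makes it climb n units in each of these columns. *)
Definition wind1 n : R2 -> R2 := (swap \o shear (wave n) \o swap) \o shear (wave n).
Definition wind1V n : R2 -> R2 :=
  shear (fun t => - wave n t) \o (swap \o shear (fun t => - wave n t) \o swap).

Lemma torus_coord_wind1 n : torus_coord (wind1 n) (wind1V n).
Proof.
apply: torus_coord_comp; [apply: torus_coord_vshear|apply: torus_coord_shear];
  by [exact: wave_smooth|move=> *; rewrite wave_periodic].
Qed.

(** The factor of largest index acts first, so that it cannot move the images of the
previous discs. *)
Fixpoint wind n : R2 -> R2 := if n is n'.+1 then wind n' \o wind1 n' else id.
Fixpoint windV n : R2 -> R2 := if n is n'.+1 then wind1V n' \o windV n' else id.

Lemma torus_coord_wind n : torus_coord (wind n) (windV n).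
Proof.
elim: n => [|n IH]; first exact: torus_coord_id.
exact: torus_coord_comp IH (torus_coord_wind1 n).
Qed.

(** Membership in an integer translate of the n-th disc. *)
Definition in_discs n w := sqdist (disc_c n) (fracp w) < 4 * disc_r n ^+ 2.

Lemma in_discs_slot n w : in_discs n w -> slot n (frac w.1) /\ slot n (frac w.2).
Proof.
move/(in_disc (disc_r_gt0 n)) => [/andP[h1 h2] /andP[h3 h4]].
by move: h1 h2 h3 h4; rewrite /slot /disc_c /=; split; apply/andP; split; lra.
Qed.

Lemma wave_frac n t : wave n (frac t) = wave n t.
Proof. by rewrite -(wave_periodic n (frac t) (Num.floor t)) subrK. Qed.

Lemma wind1_fix m n w : m <> n -> in_discs n w -> wind1 m w = w.
Proof.
move=> mn /in_discs_slot[h1 h2]; have nm : n <> m by move=> E; apply: mn.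
have a1 : wave m w.1 = 0 by rewrite -wave_frac (wave_slot nm h1).
have a2 : wave m w.2 = 0 by rewrite -wave_frac (wave_slot nm h2).
by case: w h1 h2 a1 a2 => x y /= _ _ a1 a2; rewrite /wind1 /shear /swap /= a2 addr0 a1 addr0.
Qed.

Lemma wind1V_fix m n w : m <> n -> in_discs n w -> wind1V m w = w.
Proof.
move=> mn h; apply: (can_inj (torus_coordK (torus_coord_wind1 m))).
by rewrite (torus_coordVK (torus_coord_wind1 m)) (wind1_fix mn h).
Qed.

Lemma wind_fix m n w : (m <= n)%N -> in_discs n w -> wind m w = w.
Proof.
elim: m => [//|m IH] mn h /=.
rewrite (@wind1_fix m n) ?IH//; first exact: ltnW.
by move=> E; rewrite E ltnn in mn.
Qed.

(** The n-th tube, with its integer translates. *)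
Definition in_tube n z := in_discs n (windV n.+1 z).

Lemma windV_later n k z : in_tube n z -> windV (n.+1 + k)%N z = windV n.+1 z.
Proof.
move=> h; elim: k => [|k IH]; first by rewrite addn0.
rewrite addnS -[windV _ z]/(wind1V (n.+1 + k)%N (windV (n.+1 + k)%N z)) IH.
apply: (@wind1V_fix _ n) => // E.
by move/eqP: E; rewrite addSn eqn_leq ltnNge leq_addr.
Qed.

(** Points of two tubes are pulled back by the same map, that of larger index, which
sends them into two disjoint discs. *)
Lemma tube_disj m n z : in_tube m z -> in_tube n z -> m = n.
Proof.
wlog mn : m n / (m <= n)%N => [H h1 h2|h1 h2].
  by case/orP: (leq_total m n) => mn; [|apply/esym]; exact: H.
move: h2; rewrite /in_tube -(subnK mn) addnC -addSn (windV_later _ h1) addnC subnK//.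
move: h1; rewrite /in_tube => /in_discs_slot[h1 _] /in_discs_slot[h2 _].
exact: slot_disj h1 h2.
Qed.

Definition disc_twist n := twist (disc_c n) (disc_r n).
Definition tube_twist n e : R2 -> R2 := wind n.+1 \o disc_twist n e \o windV n.+1.

Lemma tube_twist_tame n : tame_fam (tube_twist n).
Proof.
apply: (torus_coord_tame (torus_coord_wind n.+1)); apply: twist_tame.
- exact: disc_r_gt0.
- exact: disc_c_gt.
- exact: disc_c_lt.
Qed.

Lemma tube_twist_tube n e z : in_tube n z -> in_tube n (tube_twist n e z).
Proof.
rewrite /in_tube /tube_twist [(_ \o _) z]/comp (torus_coordK (torus_coord_wind n.+1)).
by apply: twist_supp_inv; [exact: disc_r_gt0|exact: disc_c_gt|exact: disc_c_lt].
Qed.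

Lemma tube_twist_out n e z : ~ in_tube n z -> tube_twist n e z = z.
Proof.
move=> nB; rewrite /tube_twist /comp.
case: (pselect (disc_twist n e (windV n.+1 z) = windV n.+1 z)).
  by move=> ->; rewrite (torus_coordVK (torus_coord_wind n.+1)).
by move/(@twist_supp _ (disc_c n) (disc_r n)) => h; case: nB.
Qed.

Lemma tube_twistD n e f z : tube_twist n e (tube_twist n f z) = tube_twist n (e + f) z.
Proof.
rewrite /tube_twist /comp (torus_coordK (torus_coord_wind n.+1)) /disc_twist twistD//.
- exact: disc_r_gt0.
- exact: disc_c_gt.
- exact: disc_c_lt.
Qed.

Lemma tube_twist0 n z : tube_twist n 0 z = z.
Proof.
by rewrite /tube_twist /comp /disc_twist twist_0 (torus_coordVK (torus_coord_wind n.+1)).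
Qed.

Lemma tube_twist_iter n e k z : iter k (tube_twist n e) z = tube_twist n (e * k%:R) z.
Proof.
elim: k => [|k IH]; first by rewrite mulr0 tube_twist0.
rewrite iterS IH tube_twistD; congr (tube_twist n _ z).
by rewrite -natr1 mulrDr mulr1 addrC.
Qed.

Lemma tube_twist_equivariant n e : equivariant (tube_twist n e).
Proof.
move=> z v; rewrite /tube_twist /comp (torus_coordV_equivariant (torus_coord_wind n.+1)).
by rewrite /disc_twist twist_equivariant (torus_coord_equivariant (torus_coord_wind n.+1)).
Qed.

Lemma tube_twist_bdd n : exists D : R, forall e z, `|tube_twist n e z - z| <= D.
Proof.
have [D hD] := torus_coord_coarse (torus_coord_wind n.+1); exists (1 + D) => e z.
rewrite /tube_twist /comp -{2}(torus_coordVK (torus_coord_wind n.+1) z).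
rewrite (le_trans (hD _ _))// lerD2r.
by apply: twist_dist; [exact: disc_r_gt0|exact: disc_c_gt|exact: disc_c_lt].
Qed.

Lemma tame_cont (T : R -> R2 -> R2) e : tame_fam T -> continuous (T e).
Proof.
move=> [_ /(_ 0%N e)[M [h1 h2]]] z.
have -> : T e = (fun z => (z.1 + ((T e z).1 - z.1), z.2 + ((T e z).2 - z.2))).
  by apply/funext => w; rewrite !(addrC w.1) !(addrC w.2) !subrK; case: (T e w).
apply: (@pair_cont _ _ (fun z => z.1 + ((T e z).1 - z.1)) (fun z => z.2 + ((T e z).2 - z.2))).
  by apply: cvgD; [exact: fst_cont|exact: Ck_le_cont h1 _].
by apply: cvgD; [exact: snd_cont|exact: Ck_le_cont h2 _].
Qed.

Lemma tube_twist_cont n e : continuous (tube_twist n e).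
Proof. exact: tame_cont (tube_twist_tame n). Qed.

Lemma disc_twist_cont n e : continuous (disc_twist n e).
Proof.
apply: tame_cont; apply: twist_tame; [exact: disc_r_gt0|exact: disc_c_gt|exact: disc_c_lt].
Qed.

Lemma tube_twist_subpreserving n e : subpreserving (tube_twist n e).
Proof.
have G := torus_coord_wind n.+1.
apply: (@subpreserving_comp _ (wind n.+1 \o disc_twist n e) (windV n.+1)).
- by move=> z; apply: continuous_comp; [exact: disc_twist_cont|exact: torus_coord_cont G _].
- by move=> z v; rewrite /comp /disc_twist twist_equivariant (torus_coord_equivariant G).
- apply: subpreserving_comp; [exact: torus_coord_cont G| | |].
    exact: torus_coord_equivariant G.
  exact: torus_coord_subpreserving G.
  by apply: subpreserving_twist; [exact: disc_r_gt0|exact: disc_c_gt|exact: disc_c_lt].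
- exact: torus_coordV_subpreserving G.
Qed.

End Param.

Lemma abs_shift (k : int) (K : nat) : (`|k| <= K)%N ->
  exists2 i : nat, (i <= K + K)%N & (i : int) = k + K.
Proof. by move=> hk; exists `|(k + K)%R|%N; lia. Qed.

(** * Orbits that visit many translates of the unit square *)

Section Visit.
Context {R : realType}.
Local Notation R2 := (plane R).
Local Notation disc_r := (@disc_r R).
Local Notation disc_c := (@disc_c R).
Local Notation wave := (@wave R).

(** The wave decreases from n to 0 between c_n and c_n + r_n. *)
Lemma wave_hit n j : (j <= n)%N ->
  exists2 s, disc_c n <= s <= disc_c n + disc_r n & wave n s = j%:R.
Proof.
move=> jn; have d0 := @disc_r_gt0 R n.
have [|||s] := @IVT R (wave n) (disc_c n) (disc_c n + disc_r n) j%:R.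
- by rewrite lerDl ltW.
- exact/continuous_subspaceT/smooth_bounded_cont/wave_smooth.
- rewrite wave_center wave_edge min_r ?ler0n// max_l ?ler0n//.
  by rewrite ler_nat.
- by rewrite in_itv /= => h1 h2; exists s.
Qed.

Definition circle_pt n (theta : R) : R2 :=
  (disc_c n + disc_r n * cos theta, disc_c n + disc_r n * sin theta).

(** Choose s with wave n s = j, then theta such that the horizontal shear sends the
point of the circle to abscissa s + i, which is possible because this abscissa
goes from c_n + r_n + n to c_n over a quarter of circle.  The vertical shear then
adds j, and the maps wind1 m for m < n fix what remains. *)
Lemma wind_circle n i j : (i <= n)%N -> (j <= n)%N -> exists theta (q : R2),
  [/\ disc_c n <= q.1 <= disc_c n + disc_r n,
      disc_c n <= q.2 <= disc_c n + disc_r n,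
      0 <= theta <= pi / 2 &
      wind n.+1 (circle_pt n theta) = q + int_vec (i : int, j : int)].
Proof.
move=> ni nj; have d0 := @disc_r_gt0 R n.
have [s /andP[s1 s2] hs] := wave_hit nj.
pose f (theta : R) := disc_c n + disc_r n * cos theta +
  wave n (disc_c n + disc_r n * sin theta).
have p0 : (0 : R) <= pi / 2 by rewrite divr_ge0// pi_ge0.
have cf : continuous f.
  move=> t; have ccos := @continuous_cos R t; have cs := @continuous_sin R t.
  apply: cvgD.
    by apply: cvgD; [exact: cvg_cst|apply: cvgM; [exact: cvg_cst|exact: ccos]].
  apply: (@continuous_comp _ _ _ (fun t => disc_c n + disc_r n * sin t) (wave n)); last first.
    exact/smooth_bounded_cont/wave_smooth.
  by apply: cvgD; [exact: cvg_cst|apply: cvgM; [exact: cvg_cst|exact: cs]].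
have f0 : f 0 = disc_c n + disc_r n + n%:R by rewrite /f cos0 sin0 mulr0 mulr1 addr0 wave_center.
have f1 : f (pi / 2) = disc_c n.
  by rewrite /f cos_pihalf sin_pihalf mulr0 mulr1 addr0 wave_edge addr0.
have ni' : (i%:R : R) <= n%:R by rewrite ler_nat.
have i0 : (0 : R) <= i%:R by rewrite ler0n.
have n0 : (0 : R) <= n%:R by rewrite ler0n.
have [||theta] := @IVT R f 0 (pi / 2) (s + i%:R) p0.
- exact: continuous_subspaceT.
- rewrite f0 f1 min_r; last by rewrite -addrA lerDl addr_ge0// ltW.
  rewrite max_l; last by rewrite -addrA lerDl addr_ge0// ltW.
  by apply/andP; split; lra.
rewrite in_itv /= => theta_itv ftheta.
have sin01 : 0 <= sin theta <= 1.
  rewrite sin_le1 andbT; apply: sin_ge0_pi.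
  have := pi_gt0 R; case/andP: theta_itv => t1 t2 p1.
  by apply/andP; split; lra.
case/andP: (sin01) => sn0 sn1.
exists theta, (s, disc_c n + disc_r n * sin theta); split=> //.
- by rewrite s1.
- by rewrite /= lerDl (mulr_ge0 (ltW d0) sn0) /= lerD2l ler_piMr// ltW.
have -> : wind1 n (circle_pt n theta) =
    (s, disc_c n + disc_r n * sin theta) + int_vec (i : int, j : int).
  rewrite /wind1 /circle_pt /shear /swap /=; move: ftheta; rewrite /f => ->.
  congr pair => //=.
  by rewrite (wave_periodic n s i) hs.
rewrite (torus_coord_equivariant (torus_coord_wind n)); congr (_ + _);
  apply: (@wind_fix _ n n) => //.
have Qs : unit_cell (s, disc_c n + disc_r n * sin theta).
  have hd := @disc_r_le16 R n; apply/unit_cellE => /=.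
  have a1 : disc_r n * sin theta <= disc_r n by rewrite ler_piMr// ltW.
  have a2 : 0 <= disc_r n * sin theta by rewrite mulr_ge0// ltW.
  by move: s1 s2; rewrite /disc_c; split; apply/andP; split; lra.
rewrite /in_discs fracp_id// /sqdist /= addrC (addrC (disc_c n)) addrK.
have h1 : (s - disc_c n) ^+ 2 <= disc_r n ^+ 2.
  have a1 : 0 <= s - disc_c n by lra.
  have a2 : s - disc_c n <= disc_r n by lra.
  by rewrite ler_sqr// nnegrE ltW.
have h2 : (disc_r n * sin theta) ^+ 2 <= disc_r n ^+ 2.
  by rewrite exprMn ler_piMr ?sqr_ge0// expr_le1.
have h3 : 0 < disc_r n ^+ 2 by rewrite exprn_gt0.
lra.
Qed.

Lemma sqdist_circle n theta : sqdist (disc_c n) (circle_pt n theta) = disc_r n ^+ 2.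
Proof.
rewrite /sqdist /circle_pt /= !(addrC (disc_c n)) !addrK !exprMn -mulrDr.
by rewrite cos2Dsin2 mulr1.
Qed.

Definition speed n : R := flat (3 * disc_r n ^+ 2).

Lemma speed_gt0 n : 0 < speed n.
Proof. by apply: flat_gt0; rewrite mulr_gt0// exprn_gt0// disc_r_gt0. Qed.

Lemma in_discs_circle n theta : in_discs n (circle_pt n theta) /\ unit_cell (circle_pt n theta).
Proof.
have h : sqdist (disc_c n) (circle_pt n theta) < 4 * disc_r n ^+ 2.
  have : 0 < disc_r n ^+ 2 by rewrite exprn_gt0// disc_r_gt0.
  by rewrite sqdist_circle; lra.
have q := disc_cell (@disc_r_gt0 R n) (@disc_c_gt R n) (@disc_c_lt R n) h.
by split => //; rewrite /in_discs fracp_id.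
Qed.

Lemma disc_twist_circle n e theta :
  disc_twist n e (circle_pt n theta) = circle_pt n (theta + e * speed n).
Proof.
have [_ q] := in_discs_circle n theta.
rewrite /disc_twist twist_cell//.
rewrite /twist0 /twist_angle sqdist_circle (_ : 4 * _ - _ = 3 * disc_r n ^+ 2); last by ring.
rewrite -/(speed n) /rotation /circle_pt /= !(addrC (disc_c n)) !addrK cosD sinD.
by congr pair; ring.
Qed.

Lemma cos_sin_lip (s t : R) : `|cos s - cos t| <= `|s - t| /\ `|sin s - sin t| <= `|s - t|.
Proof.
split; rewrite -[leRHS]mul1r; apply: lip_of_derive => u.
- by have [] := is_derive_cos u.
- by have [_ ->] := is_derive_cos u; rewrite normrN sin_max.
- by have [] := is_derive_sin u.
- by have [_ ->] := is_derive_sin u; exact: cos_max.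
Qed.

Lemma circle_pt_lip n s t : `|circle_pt n s - circle_pt n t| <= `|s - t|.
Proof.
have [h1 h2] := cos_sin_lip s t; have d0 := @disc_r_gt0 R n; have d1 := @disc_r_le16 R n.
have H x : `|x| <= `|s - t| -> `|disc_r n * x| <= `|s - t|.
  move=> hx; apply: le_trans hx; rewrite normrM gtr0_norm// ler_piMl//; lra.
rewrite norm_pair_le; apply/andP; split => /=.
  rewrite (_ : _ - _ = disc_r n * (cos s - cos t)); [exact: H|ring].
by rewrite (_ : _ - _ = disc_r n * (sin s - sin t)); [exact: H|ring].
Qed.

(** The orbit turns around the circle of radius r_n in the n-th disc by steps smaller
than the precision dictated by the Lipschitz constant of wind n.+1.  It starts
from the point that is sent over (K, K), so that after translation by (- K, - K)
the squares with coordinates between - K and K are those that are visited. *)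
Lemma visit n : exists2 eta : R, 0 < eta & forall e : R, 0 < e <= eta ->
  forall K : nat, (K + K <= n)%N -> exists z : R2,
  [/\ unit_square z, in_tube n z &
   forall v : int * int, (`|v.1| <= K)%N -> (`|v.2| <= K)%N ->
     exists m, exists2 w, unit_square w & iter m (tube_twist n e) z = w + int_vec v].
Proof.
have G := @torus_coord_wind R n.+1; have [L L0 hL] := torus_coord_lipschitz G.
have d0 := @disc_r_gt0 R n; have d1 := @disc_r_le16 R n.
have L1 : 0 < L + 1 by rewrite ltr_wpDl.
exists (disc_r n / (L + 1)); first by rewrite divr_gt0.
move=> e /andP[e0 he] K Kn.
have Kn' : (K <= n)%N by apply: leq_trans Kn; exact: leq_addr.
have [th0 [q0 [q01 q02 hth0 E0]]] := wind_circle Kn' Kn'.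
pose u := int_vec (K : int, K : int) : R2.
exists q0; split.
- move: q01 q02 => /andP[a1 a2] /andP[a3 a4]; split; rewrite /= in_itv /=;
  by move: a1 a2 a3 a4; rewrite /disc_c => a1 a2 a3 a4; apply/andP; split; lra.
- rewrite /in_tube (_ : q0 = wind n.+1 (circle_pt n th0) + int_vec (- (K : int), - (K : int)));
    last first.
    rewrite E0 -addrA (_ : int_vec _ + int_vec _ = 0) ?addr0//.
    by congr pair; rewrite /= mulrNz subrr.
  rewrite (torus_coordV_equivariant G) (torus_coordK G) /in_discs fracpD;
    exact: (in_discs_circle n th0).1.
move=> v v1 v2.
have iK (k : int) : (`|k| <= K)%N -> exists2 i : nat, (i <= n)%N & (i : int) = k + K.
  by move=> /abs_shift[i iK iE]; exists i => //; exact: leq_trans Kn.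
have [i ni iE] := iK _ v1; have [j nj jE] := iK _ v2.
have [th [q [q1 q2 hth E]]] := wind_circle ni nj.
pose sp := e * speed n.
have sp0 : 0 < sp by rewrite mulr_gt0// speed_gt0.
have sple : sp <= e by rewrite ler_piMr ?flat_le1// ltW.
(* The additional full turn makes the number of steps nonnegative. *)
pose x := (th + pi * 2 - th0) / sp.
have x0 : 0 <= x.
  apply: divr_ge0; last exact: ltW.
  have p0 := pi_gt0 R; case/andP: hth => t1 t2; case/andP: hth0 => t3 t4; lra.
pose m := Num.trunc x.
have /andP[m1 m2] := truncn_itv x0.
pose w0 := circle_pt n (th0 + sp * m%:R).
have hw0 : `|w0 - circle_pt n th| <= disc_r n / (L + 1).
  have -> : circle_pt n th = circle_pt n (th + pi * 2).
    by rewrite /circle_pt mulr_natr cosD2pi sinD2pi.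
  apply: le_trans (circle_pt_lip n _ _) _; apply: le_trans he; apply: le_trans sple.
  have xE : th + pi * 2 - th0 = x * sp by rewrite divfK// gt_eqF.
  have -> : th0 + sp * m%:R - (th + pi * 2) = - (sp * (x - m%:R)).
    by rewrite mulrBr (mulrC sp x) -xE; ring.
  rewrite normrN normrM gtr0_norm// ler_piMr ?(ltW sp0)//.
  rewrite ger0_norm ?subr_ge0//; move: m2; rewrite -natr1; lra.
have TE : iter m (tube_twist n e) q0 = wind n.+1 w0 - u.
  have E0' : q0 = wind n.+1 (circle_pt n th0) + int_vec (- (K : int), - (K : int)).
    rewrite E0 -addrA (_ : int_vec _ + int_vec _ = 0) ?addr0//.
    by congr pair; rewrite /= mulrNz subrr.
  rewrite E0' tube_twist_iter (tube_twist_equivariant n (e * m%:R)).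
  rewrite /tube_twist /comp (torus_coordK G) disc_twist_circle.
  rewrite mulrAC -/sp -/w0; congr (_ + _); rewrite /u /int_vec /=.
  by congr pair; rewrite mulrNz.
pose w := wind n.+1 w0 - (int_vec (i : int, j : int)).
have hw : `|w - q| <= disc_r n.
  have -> : w - q = wind n.+1 w0 - wind n.+1 (circle_pt n th).
    by rewrite E opprD (addrC (- q)) addrA.
  rewrite (le_trans (hL _ _))//.
  apply: le_trans (_ : L * (disc_r n / (L + 1)) <= _); first exact: ler_wpM2l.
  by rewrite mulrCA ler_piMr ?(ltW d0)// ler_pdivrMr// mul1r lerDl.
exists m; exists w.
  move: hw; rewrite norm_pair_le /= !ler_norml => /andP[/andP[b1 b2] /andP[b3 b4]].
  move: q1 q2 => /andP[a1 a2] /andP[a3 a4]; move: a1 a2 a3 a4; rewrite /disc_c => a1 a2 a3 a4.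
  by split; rewrite /= in_itv /=; apply/andP; split; rewrite /w /=; lra.
rewrite TE /w -addrA; congr (_ + _); rewrite /u /int_vec iE jE /=.
by congr pair => /=; rewrite intrD; ring.
Qed.

End Visit.

(** * The product of all the twists *)

Section TheMap.
Context {R : realType}.
Local Notation R2 := (plane R).
Local Notation CkT_le := (Ck_le dirs (setT : set R2)).
Implicit Types (n m : nat) (z w : R2).

Lemma amplitude_ex n : exists e0 : R, [/\ 0 < e0,
   (forall e : R, `|e| <= e0 -> CkT_le n (2^-1 ^+ n) (fun z => (tube_twist n e z).1 - z.1) /\
      CkT_le n (2^-1 ^+ n) (fun z => (tube_twist n e z).2 - z.2)) &
   forall K : nat, (K + K <= n)%N -> exists z : R2,
    [/\ unit_square z, in_tube n z &
     forall v : int * int, (`|v.1| <= K)%N -> (`|v.2| <= K)%N ->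
     exists m, exists2 w, unit_square w & iter m (tube_twist n e0) z = w + int_vec v]].
Proof.
have [H _] := @tube_twist_tame R n.
have h0 : (0 : R) < 2^-1 ^+ n by rewrite exprn_gt0// invr_gt0.
have [e1 e10 h1] := H n _ h0; have [e2 e20 h2] := @visit R n.
have m0 : 0 < Num.min e1 e2 by rewrite lt_min e10.
exists (Num.min e1 e2); split=> //.
- by move=> e he; apply: h1; apply: le_trans he _; rewrite ge_min lexx.
- by apply: h2; rewrite m0 ge_min lexx orbT.
Qed.

Definition amplitude n : R := sval (cid (amplitude_ex n)).

Lemma amplitudeP n : [/\ 0 < amplitude n,
   (forall e : R, `|e| <= amplitude n ->
      CkT_le n (2^-1 ^+ n) (fun z => (tube_twist n e z).1 - z.1) /\
      CkT_le n (2^-1 ^+ n) (fun z => (tube_twist n e z).2 - z.2)) &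
   forall K : nat, (K + K <= n)%N -> exists z : R2,
    [/\ unit_square z, in_tube n z &
     forall v : int * int, (`|v.1| <= K)%N -> (`|v.2| <= K)%N ->
     exists m, exists2 w, unit_square w & iter m (tube_twist n (amplitude n)) z = w + int_vec v]].
Proof. exact: svalP (cid (amplitude_ex n)). Qed.

Definition disp1 (s : R) n z : R := (tube_twist n (s * amplitude n) z).1 - z.1.
Definition disp2 (s : R) n z : R := (tube_twist n (s * amplitude n) z).2 - z.2.
(** The case s = 1 is the map of the theorem and s = - 1 its inverse.  At each point at
most one term of the sums is nonzero. *)
Definition Phi (s : R) z : R2 := (z.1 + rsum (disp1 s ^~ z), z.2 + rsum (disp2 s ^~ z)).

Lemma Phi_tube s n z : in_tube n z -> Phi s z = tube_twist n (s * amplitude n) z.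
Proof.
move=> Bz; have out m : m != n -> tube_twist m (s * amplitude m) z = z.
  by move=> mn; apply: tube_twist_out => Bm; move/eqP: mn; apply; exact: tube_disj Bm Bz.
rewrite /Phi (rsum_single (n0 := n)); last by move=> m /out; rewrite /disp1 => ->; rewrite subrr.
rewrite (rsum_single (n0 := n)); last by move=> m /out; rewrite /disp2 => ->; rewrite subrr.
by rewrite /disp1 /disp2 !(addrC z.1) !(addrC z.2) !subrK; case: (tube_twist _ _ _).
Qed.

Lemma Phi_out s z : (forall n, ~ in_tube n z) -> Phi s z = z.
Proof.
move=> Bz; have out m : tube_twist m (s * amplitude m) z = z by exact: tube_twist_out.
rewrite /Phi (rsum_single (n0 := 0%N)); last by move=> m _; rewrite /disp1 out subrr.
rewrite (rsum_single (n0 := 0%N)); last by move=> m _; rewrite /disp2 out subrr.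
by rewrite /disp1 /disp2 out !subrr !addr0; case: z {Bz out}.
Qed.

Lemma Phi_in_tube s n z : in_tube n z -> in_tube n (Phi s z).
Proof. by move=> Bz; rewrite (Phi_tube s Bz); exact: tube_twist_tube. Qed.

Lemma in_tube_transl n z v : in_tube n z -> in_tube n (z + int_vec v).
Proof. by rewrite /in_tube (torus_coordV_equivariant (torus_coord_wind n.+1)) /in_discs fracpD. Qed.

Lemma Phi_equivariant s : equivariant (Phi s).
Proof.
move=> z v; case: (pselect (exists n, in_tube n z)) => [[n Bn]|Bn].
  by rewrite (Phi_tube s Bn) (Phi_tube s (in_tube_transl v Bn)) tube_twist_equivariant.
rewrite !Phi_out// => n h; apply: Bn; exists n => //.
have := in_tube_transl (- v) h; rewrite -addrA (_ : int_vec v + _ = 0) ?addr0//.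
by congr pair; rewrite /= mulrNz subrr.
Qed.

Lemma PhiK s : cancel (Phi s) (Phi (- s)).
Proof.
move=> z; case: (pselect (exists n, in_tube n z)) => [[n Bn]|Bn].
  rewrite (Phi_tube (- s) (Phi_in_tube s Bn)) (Phi_tube s Bn) tube_twistD.
  by rewrite mulNr addNr tube_twist0.
by rewrite (@Phi_out s) ?Phi_out// => n h; apply: Bn; exists n.
Qed.

Lemma Phi_iter s n m z : in_tube n z -> iter m (Phi s) z = tube_twist n (s * amplitude n * m%:R) z.
Proof.
move=> Bn; elim: m => [|m IH]; first by rewrite mulr0 tube_twist0.
rewrite iterS IH (Phi_tube s (tube_twist_tube _ Bn)) tube_twistD.
by congr (tube_twist n _ z); rewrite -natr1 mulrDr mulr1 addrC.
Qed.

Lemma Phi_iter_out s m z : (forall n, ~ in_tube n z) -> iter m (Phi s) z = z.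
Proof. by move=> Bz; elim: m => [//|m IH]; rewrite iterS IH Phi_out. Qed.

Lemma amplitude_scale n (s : R) : `|s| <= 1 -> `|s * amplitude n| <= amplitude n.
Proof.
have [e0 _ _] := amplitudeP n; move=> s1.
by rewrite normrM (gtr0_norm e0) ler_piMl// ltW.
Qed.

(** For the C^k norm, the terms of index at least k are bounded by 2^-n; multiplying
this by a constant takes care of the finitely many other terms. *)
Lemma Phi_smooth s : `|s| <= 1 -> smooth_on setT (Phi s).
Proof.
move=> s1.
have half : `|2^-1 : R| < 1 by rewrite gtr0_norm ?invr_gt0// invf_lt1// ltr1n.
have gc (C : R) : cvgn (series (fun n => C * 2^-1 ^+ n)).
  exact: (@is_cvg_geometric_series _ C _ half).
have big (M : nat -> R) k : exists2 C : R, 1 <= C &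
    forall n, (n < k)%N -> M n <= C * 2^-1 ^+ n.
  elim: k => [|k [C C1 hC]]; first by exists 1.
  exists (Num.max C (M k * 2 ^+ k)); first by rewrite le_max C1.
  move=> n; rewrite ltnS leq_eqVlt => /orP[/eqP ->|/hC h].
    rewrite exprVn ler_pdivlMr ?exprn_gt0// le_max lexx orbT//.
  by rewrite (le_trans h)// ler_wpM2r ?exprn_ge0 ?invr_ge0// le_max lexx.
have key (u : nat -> R2 -> R) : (forall n, CkT_le n (2^-1 ^+ n) (u n)) ->
    (forall k n, exists M, CkT_le k M (u n)) ->
    forall k, exists M, CkT_le k M (fun z => rsum (u ^~ z)).
  move=> h1 h2 k; have [M hM] := choice (h2 k).
  (* The constant C absorbs the finitely many terms of index below k. *)
  have [C C1 hC] := big M k.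
  exists (rsum (fun n => C * 2^-1 ^+ n)); apply: Ck_le_series => // n.
  have [nk|kn] := ltnP n k; first by apply: Ck_le_mono (hM n); exact: hC.
  apply: Ck_le_mono (Ck_le_leq kn (h1 n)).
  by rewrite ler_peMl// exprn_ge0// invr_ge0.
apply: smooth_on_displacement; apply: key => [n|k n].
- by have [_ /(_ _ (amplitude_scale n s1))[]] := amplitudeP n.
- have [_ /(_ k (s * amplitude n))[M [h1 h2]]] := @tube_twist_tame R n; by exists M.
- by have [_ /(_ _ (amplitude_scale n s1))[]] := amplitudeP n.
- have [_ /(_ k (s * amplitude n))[M [h1 h2]]] := @tube_twist_tame R n; by exists M.
Qed.

Lemma Phi_cont s : `|s| <= 1 -> continuous (Phi s).
Proof. by move=> /Phi_smooth/(_ 0%N)[h _] z; apply: h; rewrite inE. Qed.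

Lemma Phi_step s n z : `|s| <= 1 -> in_tube n z -> `|Phi s z - z| <= 2^-1 ^+ n.
Proof.
move=> s1 Bn; rewrite (Phi_tube s Bn).
have [_ /(_ _ (amplitude_scale n s1))[h1 h2] _] := amplitudeP n.
rewrite norm_pair_le; apply/andP; split; [exact: Ck_le_bnd h1 _|exact: Ck_le_bnd h2 _].
Qed.

Lemma Phi_bdd n : exists D : R, forall s m z, in_tube n z -> `|iter m (Phi s) z - z| <= D.
Proof.
have [D hD] := @tube_twist_bdd R n; exists D => s m z Bn.
by rewrite (Phi_iter s m Bn).
Qed.

(** Truncations of Phi, which agree with it at any given point from some index on and
transfer to it the control of areas. *)
Fixpoint Phi_upto (s : R) n : R2 -> R2 :=
  if n is n'.+1 then Phi_upto s n' \o tube_twist n' (s * amplitude n') else id.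

Lemma Phi_upto_cont s n : continuous (Phi_upto s n).
Proof.
elim: n => [|n IH]; first by move=> z; exact: cvg_id.
by move=> z; apply: continuous_comp; [exact: tube_twist_cont|exact: IH].
Qed.

Lemma Phi_upto_equivariant s n : equivariant (Phi_upto s n).
Proof. by elim: n => [//|n IH] z v /=; rewrite tube_twist_equivariant IH. Qed.

Lemma Phi_upto_subpreserving s n : subpreserving (Phi_upto s n).
Proof.
elim: n => [|n IH]; first by [].
apply: subpreserving_comp; [exact: Phi_upto_cont| |exact: IH|].
  exact: Phi_upto_equivariant.
exact: tube_twist_subpreserving.
Qed.

Lemma Phi_upto_small s n m z : (n <= m)%N -> in_tube m z -> Phi_upto s n z = z.
Proof.
elim: n => [//|n IH] nm Bm /=.
rewrite tube_twist_out ?IH//; first exact: ltnW.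
by move=> Bn; have E := tube_disj Bm Bn; move: nm; rewrite E ltnn.
Qed.

Lemma Phi_upto_near s z : \forall n \near \oo, Phi_upto s n z = Phi s z.
Proof.
case: (pselect (exists n, in_tube n z)) => [[n Bn]|Bn]; last first.
  have Bn' n : ~ in_tube n z by move=> h; apply: Bn; exists n.
  exists 0%N => // N _ /=; rewrite Phi_out//; elim: N => [//|N IH] /=.
  by rewrite tube_twist_out.
exists n.+1 => // N /= nN; rewrite (Phi_tube s Bn) -(subnK nN).
elim: (N - n.+1)%N => [|k IH].
  by rewrite add0n /= (@Phi_upto_small s n n)//; exact: tube_twist_tube.
rewrite addSn /= tube_twist_out// => Bk; have E := tube_disj Bn Bk.
by move/eqP: E; rewrite addnS eqn_leq [X in _ && X]ltnNge leq_addl andbF.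
Qed.

Lemma Phi_subpreserving s : `|s| <= 1 -> subpreserving (Phi s).
Proof.
move=> s1 P oP pP; apply: (@area_liminf _ _ (fun n => Phi_upto s n @^-1` P `&` unit_cell)).
- apply: measurableI; last exact: borel2_cell.
  by apply: borel2_open; apply: open_pre => //; exact: Phi_cont.
- move=> n; apply: measurableI; last exact: borel2_cell.
  by apply: borel2_open; apply: open_pre => //; exact: Phi_upto_cont.
- by move=> n; exact: Phi_upto_subpreserving.
- move=> z [h1 h2]; have := Phi_upto_near s z; apply: filterS => n E.
  by split=> //; rewrite /preimage /= E.
Qed.

Lemma Phi_fixed : exists z, Phi 1 z = z.
Proof.
pose c0 : R2 := (disc_c 0, disc_c 0).
have d0 := @disc_r_gt0 R 0; have h1 := @disc_c_gt R 0; have h2 := @disc_c_lt R 0.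
have r0 : sqdist (disc_c 0) c0 = 0 by rewrite /sqdist /= subrr expr0n /= addr0.
have in0 : sqdist (disc_c 0) c0 < 4 * disc_r 0 ^+ 2 by rewrite r0 mulr_gt0// exprn_gt0.
have q0 : unit_cell c0 by exact: (disc_cell d0 h1 h2 in0).
have B0 : in_tube 0 (wind 1 c0).
  by rewrite /in_tube (torus_coordK (torus_coord_wind 1)) /in_discs fracp_id.
exists (wind 1 c0); rewrite (Phi_tube 1 B0) /tube_twist /comp (torus_coordK (torus_coord_wind 1)).
congr (wind 1 _); rewrite /disc_twist (twist_cell _ _ _ q0) /twist0.
by move: (twist_angle _ _ _ _) => phi; rewrite /rotation /c0 /= subrr !mul0r subrr !addr0.
Qed.

(** Follows from |Phi^m z - z| <= D_N + m 2^-N, valid for all z and m. *)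
Lemma Phi_rotation_set : rotation_set (Phi 1) = [set (0, 0)].
Proof.
have n1 : `|1 : R| <= 1 by rewrite normr1.
apply/seteqP; split => v /=; last first.
  move=> ->; have [z hz] := Phi_fixed.
  exists (fun k => k.+1), (fun=> z); split=> //.
    by move=> A [N _ hN]; exists N => // k /= Nk; apply: hN; exact: leqW.
  rewrite (_ : (fun k => _) = (fun=> 0)); first exact: cvg_cst.
  apply/funext => k.
  have -> : iter k.+1 (Phi 1) z = z by elim: k.+1 => [//|m IH]; rewrite iterS IH hz.
  by rewrite subrr scaler0.
move=> [n [z [n0 noo hv]]].
pose w k := (n k)%:R^-1 *: (iter (n k) (Phi 1) (z k) - z k) : R2.
have step N : exists D : R, forall m y, `|iter m (Phi 1) y - y| <= D + m%:R * 2^-1 ^+ N.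
  have [D D0 hD'] : exists2 D : R, 0 <= D & forall j m y, (j < N)%N -> in_tube j y ->
      `|iter m (Phi 1) y - y| <= D.
    elim: N => [|N [D D0 hD]]; first by exists 0.
    have [D' hD'] := Phi_bdd N; exists (Num.max D D'); first by rewrite le_max D0.
    move=> j m y; rewrite ltnS leq_eqVlt => /orP[/eqP -> /hD' h|jN /hD h].
      by rewrite le_max h orbT.
    by rewrite le_max h.
  exists D => m y; have e0 : (0 : R) <= 2^-1 ^+ N by rewrite exprn_ge0// invr_ge0.
  case: (pselect (exists j, in_tube j y)) => [[j Bj]|Bn]; last first.
    by rewrite Phi_iter_out ?subrr ?normr0 ?addr_ge0 ?mulr_ge0// => j h; apply: Bn; exists j.
  have [jN|Nj] := ltnP j N.
    by rewrite (le_trans (hD' _ _ _ jN Bj))// lerDl mulr_ge0.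
  rewrite -[leLHS]add0r lerD//; elim: m => [|m IH]; first by rewrite subrr normr0 mul0r.
  rewrite iterS -natr1 mulrDl mul1r.
  have -> : Phi 1 (iter m (Phi 1) y) - y =
      (iter m (Phi 1) y - y) + (Phi 1 (iter m (Phi 1) y) - iter m (Phi 1) y).
    by rewrite [RHS]addrC addrA subrK.
  rewrite (le_trans (ler_normD _ _))// lerD//.
  have Bm : in_tube j (iter m (Phi 1) y) by rewrite (Phi_iter 1 m Bj); exact: tube_twist_tube.
  apply: le_trans (Phi_step n1 Bm) _.
  by rewrite ler_wiXn2l// ?invr_ge0// invf_le1// ler1n.
have v0 N : `|v| <= 2 * 2^-1 ^+ N.
  have [D hD] := step N.
  have e0 : (0 : R) < 2^-1 ^+ N by rewrite exprn_gt0// invr_gt0.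
  have hw : \forall k \near \oo, `|w k| <= 2 * 2^-1 ^+ N.
    have [K hK] : exists K : nat, `|D| / 2^-1 ^+ N <= K%:R.
      by exists (Num.trunc (`|D| / 2^-1 ^+ N)).+1; apply/ltW/truncnS_gt.
    have : \forall k \near \oo, (K <= n k)%N by apply: (noo [set j | (K <= j)%N]); exists K.
    apply: filterS => k Kk.
    have nk0 : (0 : R) < (n k)%:R by rewrite ltr0n.
    rewrite /w normrZ normfV gtr0_norm// ler_pdivrMl//.
    rewrite (le_trans (hD _ _))// mulrCA [leRHS]mulr_natl [leRHS]mulr2n.
    rewrite lerD2r.
    rewrite (le_trans (ler_norm D))// -ler_pdivrMr// (le_trans hK)// ler_nat//.
  have cw : (fun k => `|w k|) @ \oo --> `|v| by apply: cvg_norm; exact: hv.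
  rewrite -(cvg_lim _ cw)//; apply: limr_le; last exact: hw.
  by apply/cvg_ex; eexists; exact: cw.
have : `|v| <= 0.
  have c0 : (fun N => 2 * 2^-1 ^+ N : R) @ \oo --> (0 : R).
    rewrite -[X in _ --> X](mulr0 2); apply: cvgM; first exact: cvg_cst.
    by apply: cvg_expr; rewrite gtr0_norm ?invr_gt0// invf_lt1// ltr1n.
  rewrite -(cvg_lim _ c0)//; apply: limr_ge; last by exists 0%N => // N _ /=; exact: v0.
  by apply/cvg_ex; eexists; exact: c0.
by rewrite normr_le0 => /eqP.
Qed.

Lemma Phi_visit (V : set (int * int)) : finite_set V -> exists2 z : R2, unit_square z &
  forall v, V v -> exists m, exists2 w, unit_square w & iter m (Phi 1) z = w + int_vec v.
Proof.
move=> fV.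
have [K hK] : exists K : nat, forall v, V v -> (`|v.1| <= K)%N /\ (`|v.2| <= K)%N.
  have [X VX] := finite_fsetP.1 fV.
  pose f (v : int * int) := (`|v.1| + `|v.2|)%N.
  exists (\sum_(v <- finmap.enum_fset X) f v)%N => v.
  rewrite VX /= => vX.
  have : (f v <= \sum_(v <- finmap.enum_fset X) f v)%N.
    by rewrite (big_rem v)//= leq_addr.
  rewrite /f => h; split; apply: leq_trans h; [exact: leq_addr|exact: leq_addl].
have [_ _ /(_ K (leqnn _))[z [uz Bz hz]]] := amplitudeP (K + K).
exists z => // v /hK[v1 v2]; have [m [w uw E]] := hz v v1 v2.
exists m; exists w => //; by rewrite -E (Phi_iter 1 m Bz) mul1r tube_twist_iter.
Qed.

End TheMap.

(** * Descending to the torus *)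

Section TorusFacts.
Context {R : realType}.
Local Notation R2 := (plane R).
Local Notation T2 := (torus R).
Implicit Types (F G : R2 -> R2) (z w : R2).

Lemma torus_projP z w : reflect (exists v, w = z + int_vec v)
  (torus_proj z == torus_proj w).
Proof.
apply: (iffP idP).
  move=> /eqP/eqmodP; rewrite /Z2_eq => /andP[h1 h2].
  have /intrP[m hm] : w.1 - z.1 \is a Num.int by rewrite -opprB rpredN.
  have /intrP[n hn] : w.2 - z.2 \is a Num.int by rewrite -opprB rpredN.
  exists (m, n); case: z w h1 h2 hm hn => x y [x' y'] /= _ _ hm hn.
  by congr pair; rewrite /= -?hm -?hn addrC subrK.
move=> [[m n] ->]; apply/eqP/eqmodP; rewrite /= /Z2_eq /=.
by rewrite !opprD !addrA !subrr !sub0r !rpredN !intr_int.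
Qed.

Lemma torus_proj_transl z v : torus_proj (z + int_vec v) = torus_proj z.
Proof. by apply/esym/eqP/torus_projP; exists v. Qed.

Lemma torus_proj_repr (x : T2) : torus_proj (repr x) = x.
Proof. exact: reprK. Qed.

Lemma torus_proj_cont : continuous (torus_proj : R2 -> T2).
Proof. exact: pi_continuous. Qed.

(** The saturation of an open set is the union of its integer translates. *)
Lemma torus_proj_open (B : set R2) : open B -> open (torus_proj @` B).
Proof.
move=> oB; change (open (torus_proj @^-1` (torus_proj @` B))).
have -> : torus_proj @^-1` (torus_proj @` B) =
    \bigcup_(v in [set: int * int]) [set z | B (z + int_vec v)].
  apply/seteqP; split => z.
    by move=> [w Bw /eqP/eqP/esym/eqP/torus_projP[v E]]; exists v => //=; rewrite -E.
  by move=> [v _ /= h]; exists (z + int_vec v) => //; exact: torus_proj_transl.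
apply: bigcup_open => v _; apply: (@open_comp _ _ (fun z => z + int_vec v)) => // z _.
by apply: cvgD; [exact: cvg_id|exact: cvg_cst].
Qed.

Definition descend F (x : T2) : T2 := torus_proj (F (repr x)).

Lemma descendE F z : equivariant F -> descend F (torus_proj z) = torus_proj (F z).
Proof.
move=> eF; rewrite /descend.
have /eqP/torus_projP[v ->] : torus_proj z = torus_proj (repr (torus_proj z)).
  by rewrite torus_proj_repr.
by rewrite eF torus_proj_transl.
Qed.

Lemma descend_lift F : equivariant F -> continuous F -> is_lift F (descend F).
Proof. by move=> eF cF; split=> // z; rewrite descendE. Qed.

Lemma descendK F G : equivariant F -> equivariant G -> cancel F G ->
  cancel (descend F) (descend G).
Proof.
by move=> eF eG FG x; rewrite -(torus_proj_repr x) !descendE// FG.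
Qed.

Lemma descend_smooth F : equivariant F -> smooth_on setT F -> smooth_map (descend F).
Proof.
move=> eF sF p; exists setT, F; split=> //; first exact: openT.
by move=> x _; rewrite descendE.
Qed.

(** The segments from F z to z give a homotopy of equivariant maps.  It is continuous
on the quotient because the projection is open, also after taking the product
with the interval. *)
Lemma descend_homotopic F : equivariant F -> continuous F ->
  homotopic_to_id (descend F).
Proof.
move=> eF cF.
pose h (p : R * R2) : R2 := p.2 + (1 - p.1) *: (F p.2 - p.2).
have ch : continuous h.
  move=> p; apply: cvgD; first exact: cvg_snd.
  apply: cvgZ.
    by apply: cvgB; [exact: cvg_cst|exact: cvg_fst].
  apply: cvgB; last exact: cvg_snd.
  by apply: continuous_comp; [exact: cvg_snd|exact: cF].
have eh t z v : h (t, z + int_vec v) = h (t, z) + int_vec v.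
  by rewrite /h /= eF opprD addrACA subrr addr0 addrAC.
have hE t z : torus_proj (h (t, repr (torus_proj z))) = torus_proj (h (t, z)).
  have /eqP/torus_projP[v ->] : torus_proj z = torus_proj (repr (torus_proj z)).
    by rewrite torus_proj_repr.
  by rewrite eh torus_proj_transl.
exists (fun p => torus_proj (h (p.1, repr p.2))); split.
- apply: continuous_subspaceT => -[t x].
  rewrite /continuous_at /= => W; rewrite nbhsE => -[W' [oW' W'x] W'W].
  rewrite -(torus_proj_repr x) hE in W'x.
  have oO : open ((torus_proj \o h) @^-1` W').
    apply: open_comp => // p _; apply: continuous_comp; [exact: ch|exact: torus_proj_cont].
  have : nbhs (t, repr x) ((torus_proj \o h) @^-1` W') by exact: open_nbhs_nbhs.
  move=> [[A B] [/= nA nB] AB].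
  move: nB; rewrite nbhsE => -[B' [oB' B'z] B'B].
  exists (A, torus_proj @` B') => /=.
    split=> //; apply: open_nbhs_nbhs; split; first exact: torus_proj_open.
    by exists (repr x) => //; exact: torus_proj_repr.
  move=> [s y] /= [As [z Bz <-]]; apply: W'W; rewrite hE.
  by apply: (AB (s, z)); split=> //; exact: B'B.
- by move=> x; rewrite /h /= subr0 scale1r addrC subrK.
- by move=> x; rewrite /h /= subrr scale0r addr0 torus_proj_repr.
Qed.

Lemma area_cell_fin : (area (unit_cell : set R2) < +oo)%E.
Proof.
rewrite /area /unit_cell product_measure1E//.
have E : @lebesgue_measure R `[0%R, 1%R[%classic = 1%E.
  by rewrite lebesgue_measure_itv /= lte_fin ltr01 -EFinB subr0.
change (@lebesgue_measure R `[0%R, 1%R[%classic * @lebesgue_measure R `[0%R, 1%R[%classic < +oo)%E.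
by rewrite E mule1 ltry.
Qed.

(** On open sets the two areas are equal because F and G are both subpreserving;
the Dynkin class theorem extends this to Borel sets. *)
Lemma descend_area F G : equivariant F -> equivariant G -> continuous F -> continuous G ->
  cancel F G -> cancel G F -> subpreserving F -> subpreserving G -> area_preserving (descend F).
Proof.
move=> eF eG cF cG FG GF mF mG.
pose P (A : set T2) : set R2 := torus_proj @^-1` A.
have lebE A : leb_torus A = area (P A `&` unit_cell) by [].
have PF A : P (descend F @^-1` A) = F @^-1` P A.
  by apply/seteqP; split => z; rewrite /P /preimage /= descendE.
pose L : set (set T2) := [set A | [/\ borel2 (P A), borel2 (F @^-1` P A) &
   area (F @^-1` P A `&` unit_cell) = area (P A `&` unit_cell)]].
have pP A : periodic2 (P A) by move=> z v; rewrite /P /preimage /= torus_proj_transl.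
have openL : open `<=` L.
  move=> A oA.
  have oP : open (P A) by apply: open_comp => // z _; exact: torus_proj_cont.
  have oFP : open (F @^-1` P A) by exact: open_pre.
  split; [exact: borel2_open|exact: borel2_open|].
  apply/eqP; rewrite eq_le mF//=.
  have := mG _ oFP (periodic2_pre eF (pP A)).
  rewrite (_ : G @^-1` (F @^-1` P A) = P A)//.
  by apply/seteqP; split => z; rewrite /preimage /= GF.
have dL : dynkin L.
  split.
  - by split; rewrite /P !preimage_setT//; exact: measurableT.
  - move=> A [m1 m2 E].
    have m1Q : borel2 (unit_cell `\` P A) by apply: measurableD => //; exact: borel2_cell.
    split; [exact: (measurableC m1)|exact: (measurableC m2)|].
    have D (X : set R2) : borel2 X -> area (~` X `&` unit_cell) =
      (area unit_cell - area (X `&` unit_cell))%E.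
      move=> mX; rewrite setIC -setDE (setIC X) /area.
      by apply: measureD => //; [exact: borel2_cell|exact: area_cell_fin].
    change (area (~` (F @^-1` P A) `&` unit_cell) = area (~` (P A) `&` unit_cell)).
    by rewrite (D _ m2) (D _ m1) E.
  - move=> A tA LA.
    have U (X : nat -> set R2) : (forall n, borel2 (X n)) -> trivIset setT X ->
        area (\bigcup_n X n `&` unit_cell) = (\sum_(n <oo) area (X n `&` unit_cell))%E.
      move=> mX tX; rewrite setI_bigcupl /area measure_bigcup//.
      + by apply: eq_eseriesl => i; rewrite in_setT.
      + by move=> i _; exact: (measurableI _ _ (mX i) borel2_cell).
      + by move=> i j _ _ [z [[h1 _] [h2 _]]]; apply: tX => //; exists z.
    have tP : trivIset setT (fun n => P (A n)).
      by move=> i j _ _ [z [h1 h2]]; apply: tA => //; exists (torus_proj z).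
    have tFP : trivIset setT (fun n => F @^-1` P (A n)).
      by move=> i j _ _ [z [h1 h2]]; apply: tP => //; exists (F z).
    have m1 n : borel2 (P (A n)) by have [] := LA n.
    have m2 n : borel2 (F @^-1` P (A n)) by have [] := LA n.
    have PU : P (\bigcup_n A n) = \bigcup_n P (A n) by rewrite /P preimage_bigcup.
    split; rewrite PU ?preimage_bigcup.
    + by apply: bigcup_measurable => n _; exact: m1.
    + by apply: bigcup_measurable => n _; exact: m2.
    + rewrite (U _ m2 tFP) (U _ m1 tP); apply: eq_eseriesr => n _.
      by have [_ _ E] := LA n; exact: E.
move=> A sA; rewrite !lebE PF.
have : L A.
  move: A sA; rewrite -setI_closed_g_dynkin_g_sigma_algebra; last exact: openI.
  exact: smallest_sub.
by move=> [].
Qed.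

End TorusFacts.

Theorem theorem3 (R : realType) :
  exists (f : torus R -> torus R) (F : plane R -> plane R),
    [/\ smooth_diffeo f, area_preserving f, homotopic_to_id f, irrotational f
      & is_lift F f] /\
    (forall z : plane R, bounded_set (full_orbit F z)) /\
    (forall V : set (int * int), finite_set V ->
       exists2 z : plane R, unit_square z &
         forall v, V v ->
           full_orbit F z `&` [set w + int_vec v | w in unit_square] !=set0).
Proof.
have n1 : `|1 : R| <= 1 by rewrite normr1.
have n2 : `|- 1 : R| <= 1 by rewrite normrN normr1.
have e1 := @Phi_equivariant R 1; have e2 := @Phi_equivariant R (- 1).
have c1 := Phi_cont n1; have c2 := Phi_cont n2.
have K1 : cancel (Phi (1 : R)) (Phi (- 1)) by exact: PhiK.
have K2 : cancel (Phi (- 1 : R)) (Phi 1).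
  by have := @PhiK R (- 1); rewrite opprK.
have lF := descend_lift e1 c1.
exists (descend (Phi 1)), (Phi 1); split; [split|split].
- split; first exact: descend_smooth (Phi_smooth n1).
  exists (descend (Phi (- 1))); split.
  + exact: descendK.
  + exact: descendK.
  + exact: descend_smooth (Phi_smooth n2).
- by apply: (@descend_area _ _ (Phi (- 1))) => //; exact: Phi_subpreserving.
- exact: descend_homotopic.
- by exists (Phi 1); split=> //; exact: Phi_rotation_set.
- by [].
- move=> z.
  have pE : pinv setT (Phi (1 : R)) = Phi (- 1).
    apply/funext => w; rewrite -{1}(K2 w).
    by apply: pinvKV; rewrite ?inE// => x y _ _ h; exact: (can_inj K1 h).
  have [D hD] : exists D : R, forall s m, `|iter m (Phi s) z - z| <= D.
    case: (pselect (exists n, in_tube n z)) => [[n Bn]|Bn].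
      have [D hD] := @Phi_bdd R n; by exists D => s m; exact: hD.
    exists 0 => s m; rewrite Phi_iter_out ?subrr ?normr0// => n h.
    by apply: Bn; exists n.
  exists (`|z| + D); split; first exact: num_real.
  move=> M hM _ [n _ <-].
  apply: ltW; apply: le_lt_trans hM.
  have H s m : `|iter m (Phi s) z| <= `|z| + D.
    rewrite -(subrK z (iter m (Phi s) z)) (le_trans (ler_normD _ _))//.
    by rewrite addrC lerD2l.
  by case: n => m; rewrite /iterz ?pE; exact: H.
- move=> V /(@Phi_visit R)[z uz hz]; exists z => // v /hz[m [w uw E]].
  exists (iter m (Phi 1) z); split; first by exists (Posz m).
  by exists w.
Qed.
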